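(* Let $m\ge 1$ and let $\mathcal F$ be a family of $(m+1)$-tuples $(f,f_1,\dots,f_m)$ of non-negative measurable functions on $\mathbb R^n$. Let $1\le \mathfrak p_i^-<\mathfrak p_i^+\le\infty$ for $i=1,\dots,m$. Assume that for each $i=1,\dots,m$ there is an exponent $q_i\in(0,\infty)$ with $q_i\in[\mathfrak p_i^-,\mathfrak p_i^+]$ such that for all weights $v_i$ with $v_i^{q_i}\in A_{q_i/\mathfrak p_i^-}\cap RH_{(\mathfrak p_i^+/q_i)'}$, $i=1,\dots,m$, $$\|f\|_{L^q(v^q)}\le \prod_{i=1}^m\Phi_i\big([v_i^{q_i}]_{A_{q_i/\mathfrak p_i^-}\cap RH_{(\mathfrak p_i^+/q_i)'}}\big)\|f_i\|_{L^{q_i}(v_i^{q_i})},\qquad (f,f_1,\dots,f_m)\in\mathcal F,$$ where $\frac1q=\sum_{i=1}^m\frac1{q_i}$, $v=\prod_{i=1}^m v_i$, and each $\Phi_i:[1,\infty)\to[1,\infty)$ is an increasing function. Then for all exponents $p_i\in(\mathfrak p_i^-,\mathfrak p_i^+)$ and all weights $w_i$ with $w_i^{p_i}\in A_{p_i/\mathfrak p_i^-}\cap RH_{(\mathfrak p_i^+/p_i)'}$, $i=1,\dots,m$, $$\|f\|_{L^p(w^p)}\le\prod_{i=1}^m \mathfrak C_i\,\Phi_i\big(C_i\,[w_i^{p_i}]_{A_{p_i/\mathfrak p_i^-}\cap RH_{(\mathfrak p_i^+/p_i)'}}^{\gamma_i(p_i,q_i)}\big)\|f_i\|_{L^{p_i}(w_i^{p_i})},\qquad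 (f,f_1,\dots,f_m)\in\mathcal F,$$ where $\frac1p=\sum_{i=1}^m\frac1{p_i}$, $w=\prod_{i=1}^m w_i$, $\mathfrak C_i:=2^{\max\{\frac{\tau_{p_i}}{p_i},\frac{\tau_{p_i}'}{q_i}\}}$, and $C_i$ depends only on $n,p_i,q_i,\mathfrak p_i^-,\mathfrak p_i^+$. Moreover, for the same exponents and weights, and for all exponents $r_i\in(\mathfrak p_i^-,\mathfrak p_i^+)$, $i=1,\dots,m$, $$\Big\|\Big(\sum_k|f^k|^r\Big)^{\frac1r}\Big\|_{L^p(w^p)}\le\prod_{i=1}^m\mathfrak C_i'\,\Phi_i\big(C_i'\,[w_i^{p_i}]_{A_{p_i/\mathfrak p_i^-}\cap RH_{(\mathfrak p_i^+/p_i)'}}^{\gamma_i(p_i,r_i)\gamma_i(r_i,q_i)}\big)\Big\|\Big(\sum_k|f_i^k|^{r_i}\Big)^{\frac1{r_i}}\Big\|_{L^{p_i}(w_i^{p_i})}$$ for all $\{(f^k,f_1^k,\dots,f_m^k)\}_k\subset\mathcal F$, where $\frac1r=\sum_{i=1}^m\frac1{r_i}$, $\mathfrak C_i':=2^{\max\{\frac{\tau_{p_i}}{p_i},\frac{\tau'_{p_i}}{r_i}\}+\max\{\frac{\tau_{r_i}}{r_i},\frac{\tau'_{r_i}}{q_i}\}}$, and $C_i'$ depends only on $n,p_i,q_i,r_i,\mathfrak p_i^-,\mathfrak p_i^+$.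
   Context: A weight on $\mathbb R^n$ is a measurable function $w$ with $0<w<\infty$ a.e.; $\|f\|_{L^p(w)}=(\int|f|^pw\,dx)^{1/p}$. $s'$ denotes the conjugate exponent, $\frac1s+\frac1{s'}=1$ (with $1'=\infty$, $\infty'=1$, and $\infty/p=\infty$). $\fint_Q$ denotes the average over $Q$; suprema are over all cubes $Q\subset\mathbb R^n$. $[w]_{A_p}=\sup_Q(\fint_Qw)(\fint_Qw^{1-p'})^{p-1}$ for $1<p<\infty$; $[w]_{A_1}=\sup_Q(\fint_Qw)\,\mathrm{ess\,sup}_Qw^{-1}$; $A_p$ is the class of weights with $[w]_{A_p}<\infty$. For $1<s\le\infty$, $[w]_{RH_s}=\sup_Q(\fint_Qw^s)^{1/s}(\fint_Qw)^{-1}$ (with $(\fint_Q w^s)^{1/s}$ read as $\mathrm{ess\,sup}_Qw$ if $s=\infty$), and $RH_s$ is the class of weights with finite constant; $RH_1:=\bigcup_{1<s\le\infty}RH_s=A_\infty=\bigcup_{p\ge1}A_p$. For $1\le\mathfrak p_-<\mathfrak p_+\le\infty$ and finite $p\in[\mathfrak p_-,\mathfrak p_+]$ put $\tau_p:=\big(\frac{\mathfrak p_+}{p}\big)'\big(\frac p{\mathfrak p_-}-1\big)+1$ (for $p<\mathfrak p_+$) and $$[w^p]_{A_{p/\mathfrak p_-}\cap RH_{(\mathfrak p_+/p)'}}:=\begin{cases}[w^{p(\mathfrak p_+/p)'}]_{A_{\tau_p}},&p<\mathfrak p_+,\\ \max\{[w^p]_{A_{p/\mathfrak p_-}},[w^p]_{RH_{(\mathfrak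 p_+/p)'}}\},&p=\mathfrak p_+.\end{cases}$$ For each index $i$, $\tau_{p_i},\tau_{q_i},\tau_{r_i}$ are computed with $\mathfrak p_\pm=\mathfrak p_i^\pm$, and $\tau'_{p_i}$ is the conjugate exponent of $\tau_{p_i}$. For $p_i,q_i\in[\mathfrak p_i^-,\mathfrak p_i^+]$, $$\gamma_i(p_i,q_i):=\begin{cases}\max\{1,\frac{\tau_{q_i}-1}{\tau_{p_i}-1}\},&q_i<\mathfrak p_i^+,\\ \frac{q_i}{\tau_{p_i}-1}\big(\frac1{\mathfrak p_i^-}-\frac1{\mathfrak p_i^+}\big),&q_i=\mathfrak p_i^+.\end{cases}$$ *)

(* Defs.v *)
From HB Require Import structures.
From mathcomp Require Import all_boot all_order all_algebra.
From mathcomp Require Import all_classical all_reals all_analysis.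
From mathcomp Require Import measurable_realfun.

Set Implicit Arguments.
Unset Strict Implicit.
Unset Printing Implicit Defensive.

Import Order.TTheory GRing.Theory Num.Theory.
Import numFieldNormedType.Exports.

Local Open Scope classical_set_scope.
Local Open Scope ring_scope.
Local Open Scope ereal_scope.

Section lebesgue_measure_Rn.
Context {R : realType}.
Local Notation RT := (measurableTypeR R).

Let tcons n (xy : RT * n.-tuple RT) : n.+1.-tuple RT := [tuple of xy.1 :: xy.2].

(* Iterated product of the one-dimensional Lebesgue measure; n-tuples carry
   the product, i.e. Borel, sigma-algebra. *)
Fixpoint borel_lebesgue (n : nat) : set (n.-tuple RT) -> \bar R :=
  match n with
  | 0%N => \d_[tuple]
  | n'.+1 => pushforward ((@lebesgue_measure R) \x (@borel_lebesgue n'))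
      (fun xy : RT * n'.-tuple RT => [tuple of xy.1 :: xy.2])
  end.

Let measurable_tcons n : measurable_fun [set: RT * n.-tuple RT] (@tcons n).
Proof. by apply: measurable_cons. Qed.

Let borel_lebesgue_sigma_finite_measure n :
  {m : {sigma_finite_measure set (n.-tuple RT) -> \bar R} |
   m = @borel_lebesgue n :> (set _ -> _)}.
Proof.
elim: n => [|n [m mE]] /=.
  by exists (\d_[tuple] : {finite_measure set (0.-tuple RT) -> \bar R}).
pose m1 : set (n.+1.-tuple RT) -> \bar R :=
  pushforward ((@lebesgue_measure R) \x m) (@tcons n).
have mpre A : measurable A -> measurable (@tcons n @^-1` A).
  by move=> mA; rewrite -[X in measurable X]setTI; exact: measurable_tcons.
have m10 : m1 set0 = 0 by rewrite /m1 /pushforward preimage_set0 measure0.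
have m1ge0 A : 0 <= m1 A by rewrite /m1 /pushforward measure_ge0.
have m1s : semi_sigma_additive m1.
  move=> F mF tF mUF; rewrite /m1 /pushforward preimage_bigcup.
  apply: measure_semi_sigma_additive.
  - by move=> k; exact: mpre.
  - apply/trivIsetP => /= i j _ _ ij; rewrite -preimage_setI.
    by move/trivIsetP : tF => /(_ _ _ _ _ ij) ->//; rewrite preimage_set0.
  - by rewrite -preimage_bigcup; exact: mpre.
have m1f : sigma_finite setT m1.
  have /sigma_finiteP[F [TF ndF Foo]] := sigma_finiteT (@lebesgue_measure R).
  have /sigma_finiteP[G [TG ndG Goo]] := sigma_finiteT m.
  have mth : measurable_fun [set: n.+1.-tuple RT] (@thead n RT).
    exact: measurable_tnth.
  have mbh := @measurable_behead _ RT n.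
  exists (fun k => (@thead n RT @^-1` F k) `&`
    ((fun t : n.+1.-tuple RT => [tuple of behead t]) @^-1` G k)).
    apply/esym; rewrite -subTset => t _ /=.
    have [i _ Fi] : (\bigcup_k F k) (thead t) by rewrite -TF.
    have [j _ Gj] : (\bigcup_k G k) [tuple of behead t] by rewrite -TG.
    exists (maxn i j) => //; split => /=.
    - by move: Fi; apply/subsetPset/ndF/leq_maxl.
    - by move: Gj; apply/subsetPset/ndG/leq_maxr.
  move=> k; have [mF Fk] := Foo k; have [mG Gk] := Goo k; split.
    apply: measurableI.
    - by rewrite -[X in measurable X]setTI; exact: mth.
    - by rewrite -[X in measurable X]setTI; exact: mbh.
  rewrite /m1 /pushforward (_ : _ @^-1` _ = F k `*` G k).
    by rewrite product_measure1E// lte_mul_pinfty// ge0_fin_numE.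
  apply/seteqP; split => -[x t] /=;
   by rewrite theadE (_ : [tuple of _] = t)//; apply: val_inj.
pose M := HB.pack_for {measure set (n.+1.-tuple RT) -> \bar R} m1
  (isMeasure.Build _ _ _ m1 m10 m1ge0 m1s).
pose S := HB.pack_for {sigma_finite_measure set (n.+1.-tuple RT) -> \bar R} m1
  (isMeasure.Build _ _ _ m1 m10 m1ge0 m1s)
  (Measure_isSigmaFinite.Build _ _ _ M m1f).
by exists S; rewrite -mE.
Qed.

Let borel_lebesgue0 n : @borel_lebesgue n set0 = 0.
Proof.
by have [m <-] := borel_lebesgue_sigma_finite_measure n; rewrite measure0.
Qed.

Let borel_lebesgue_ge0 n A : 0 <= @borel_lebesgue n A.
Proof.
by have [m <-] := borel_lebesgue_sigma_finite_measure n; exact: measure_ge0.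
Qed.

Let borel_lebesgue_sigma_additive n : semi_sigma_additive (@borel_lebesgue n).
Proof.
have [m <-] := borel_lebesgue_sigma_finite_measure n.
exact: measure_semi_sigma_additive.
Qed.

HB.instance Definition _ n := isMeasure.Build _ _ _ (@borel_lebesgue n)
  (@borel_lebesgue0 n) (@borel_lebesgue_ge0 n) (@borel_lebesgue_sigma_additive n).

Let borel_lebesgue_sigma_finite n : sigma_finite setT (@borel_lebesgue n).
Proof.
by have [m <-] := borel_lebesgue_sigma_finite_measure n; exact: sigma_finiteT.
Qed.

HB.instance Definition _ n := Measure_isSigmaFinite.Build _ _ _
  (@borel_lebesgue n) (@borel_lebesgue_sigma_finite n).

End lebesgue_measure_Rn.

(* R^n with the sigma-algebra of all Lebesgue measurable sets: the sets that are
   Caratheodory measurable for the outer measure induced by borel_lebesgue. *)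
Definition Rn (R : realType) (n : nat) :=
  caratheodory_type ((@borel_lebesgue R n)^*)%mu.

HB.instance Definition _ (R : realType) (n : nat) := Measurable.on (Rn R n).

Definition lebesgue_Rn {R : realType} {n : nat} : set (Rn R n) -> \bar R :=
  @completed_measure_extension _ _ _ (@borel_lebesgue R n).

HB.instance Definition _ (R : realType) (n : nat) :=
  Measure.on (@lebesgue_Rn R n).

HB.instance Definition _ (R : realType) (n : nat) :=
  Measure_isSigmaFinite.Build _ _ _ (@lebesgue_Rn R n)
    (completed_measure_extension_sigma_finite
      (sigma_finiteT (@borel_lebesgue R n))).

Section cubes.
Context {R : realType} {n : nat}.
Implicit Type Q : set (Rn R n).

(* Half-open with sides parallel to the axes; the faces are Lebesgue null, so
   including or excluding them changes no average and no essential supremum. *)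
Definition cube (a : 'I_n -> R) (l : R) : set (Rn R n) :=
  [set x | forall i : 'I_n, (a i <= tnth x i < a i + l)%R].

Definition cubes : set (set (Rn R n)) :=
  [set Q | exists a l, (0 < l)%R /\ Q = cube a l].

Definition avg Q (g : Rn R n -> \bar R) : \bar R :=
  (lebesgue_Rn Q)^-1 * \int[lebesgue_Rn]_(x in Q) g x.

Definition ess_sup_on Q (g : Rn R n -> \bar R) : \bar R :=
  ereal_inf [set y | \forall x \ae lebesgue_Rn, Q x -> g x <= y].

End cubes.

Lemma measurable_cube_borel (R : realType) n (a : 'I_n -> R) (l : R) :
  measurable (@cube R n a l : set (n.-tuple (measurableTypeR R))).
Proof.
rewrite (_ : cube a l = \bigcap_(i in [set: 'I_n])
  ((fun x : n.-tuple (measurableTypeR R) => tnth x i) @^-1` `[a i, (a i + l)%R[)).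
  apply: fin_bigcap_measurable => // i _.
  rewrite -[X in measurable X]setTI.
  by apply: (@measurable_tnth _ (measurableTypeR R) n i) => //; exact: measurable_itv.
apply/seteqP; split => x /=.
- by move=> xQ i _ /=; rewrite in_itv/=; exact: xQ.
- by move=> xQ i; have := xQ i I; rewrite /= in_itv.
Qed.

Lemma borel_cube (R : realType) n (a : 'I_n -> R) (l : R) : (0 <= l)%R ->
  borel_lebesgue (@cube R n a l : set (n.-tuple (measurableTypeR R))) = (l ^+ n)%:E.
Proof.
move=> l0; elim: n a => [|n IH] a /=.
  by rewrite expr0 diracE mem_set// => -[].
rewrite /pushforward (_ : _ @^-1` _ =
   `[a ord0, (a ord0 + l)%R[ `*` cube (fun i => a (lift ord0 i)) l).
  rewrite product_measure1E//; last exact: measurable_cube_borel.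
  rewrite [X in _ * X]IH.
  have := lebesgue_measure_itv `[a ord0, (a ord0 + l)%R[ => /= ->.
  rewrite lte_fin ltrDl exprS EFinM; congr (_ * _).
  case: ltP => [_|l00]; first by rewrite -EFinD addrAC subrr add0r.
  by congr EFin; apply/eqP; rewrite eq_le l0.
apply/seteqP; split => [[x t] H|[x t] [/=]].
  split => /=; first by have := H ord0; rewrite in_itv.
  by move=> i; have := H (lift ord0 i); rewrite /= tnthS.
rewrite in_itv/= => x0 tQ i /=.
by have [j ->|->] := unliftP ord0 i; rewrite ?tnthS//; exact: tQ.
Qed.

Lemma lebesgue_cube (R : realType) n (a : 'I_n -> R) (l : R) : (0 <= l)%R ->
  lebesgue_Rn (cube a l) = (l ^+ n)%:E.
Proof.
move=> l0; rewrite -(borel_cube a l0) /lebesgue_Rn/=.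
rewrite /completed_measure_extension measurable_mu_extE//.
exact: measurable_cube_borel.
Qed.

Section weights.
Context {R : realType} {n : nat}.
Implicit Types (w f : Rn R n -> \bar R) (p q pm : R) (s pp : \bar R).

Definition weight w :=
  measurable_fun [set: Rn R n] w /\
  {ae lebesgue_Rn, forall x, 0 < w x < +oo}.

Definition powf w p : Rn R n -> \bar R := fun x => w x `^ p.

(* The norm of f in L^p(w), so w is the density itself: wnorm p (powf w p) is
   the norm of L^p(w^p). *)
Definition wnorm p w f : \bar R :=
  (\int[lebesgue_Rn]_x (`|f x| `^ p * w x)) `^ p^-1.

Definition A_const p w : \bar R :=
  if p == 1%R then
    ereal_sup [set avg Q w * ess_sup_on Q (fun x => (w x)^-1) | Q in cubes]
  else
    let p' := fine (hoelder_conjugate p%:E) in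
    ereal_sup [set avg Q w * avg Q (powf w (1 - p')) `^ (p - 1) | Q in cubes].

Definition in_A p w := weight w /\ A_const p w < +oo.

Definition power_avg s (Q : set (Rn R n)) w : \bar R :=
  if s is r%:E then avg Q (powf w r) `^ r^-1 else ess_sup_on Q w.

Definition RH_const s w : \bar R :=
  ereal_sup [set power_avg s Q w * (avg Q w)^-1 | Q in cubes].

(* With extended reals a weight of infinite average would get ratio
   oo * oo^-1 = 0, so finiteness of the averages is required explicitly. *)
Definition in_RH_gt1 s w :=
  [/\ weight w, forall Q, cubes Q -> avg Q w < +oo & RH_const s w < +oo].

Definition in_RH s w :=
  if s == 1 then exists t, 1 < t /\ in_RH_gt1 t w else in_RH_gt1 s w.

End weights.

Section limited_range.
Context {R : realType}.
Implicit Types (p q pm : R) (pp : \bar R).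

(* The exponent (pp / p)', where pp / p = +oo if pp = +oo. *)
Definition rh_exp pp p : \bar R := hoelder_conjugate (pp / p%:E).

Definition tau pm pp p : R := (fine (rh_exp pp p) * (p / pm - 1) + 1)%R.

Definition tau' pm pp p : R := fine (hoelder_conjugate (tau pm pp p)%:E).

Definition gamma pm pp p q : R :=
  if q%:E < pp then Num.max 1%R ((tau pm pp q - 1) / (tau pm pp p - 1))%R
  else (q / (tau pm pp p - 1) * (pm^-1 - (fine pp)^-1))%R.

(* w ^ p belongs to A_{p / pm} and to RH_{(pp / p)'}. *)
Definition in_ARH n pm pp p (w : Rn R n -> \bar R) :=
  in_A (p / pm)%R (powf w p) /\ in_RH (rh_exp pp p) (powf w p).

(* The constant of w ^ p in that class; a function of w and p since the first
   case involves w ^ (p (pp / p)'). *)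
Definition ARH_const n pm pp p (w : Rn R n -> \bar R) : \bar R :=
  if p%:E < pp then A_const (tau pm pp p) (powf w (p * fine (rh_exp pp p))%R)
  else maxe (A_const (p / pm)%R (powf w p)) (RH_const (rh_exp pp p) (powf w p)).

Definition harm m (q : 'I_m -> R) : R := ((\sum_(i < m) (q i)^-1)^-1)%R.

Definition prodw n m (w : 'I_m -> Rn R n -> \bar R) : Rn R n -> \bar R :=
  fun x => \prod_(i < m) w i x.

(* (\sum_k |f_k| ^ r) ^ (1/r), over a finite or infinite set K of indices. *)
Definition lr_norm n (K : pred nat) (r : R) (f : nat -> Rn R n -> \bar R) :
    Rn R n -> \bar R :=
  fun x => (\sum_(k <oo | K k) `|f k x| `^ r) `^ r^-1.

End limited_range.

(* Main.v *)
(** The slots are treated one at a time. Put [x_q = 1/p_- - 1/q] and [y_q = 1/q - 1/p_+].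
   Membership of [w^q] in [A_(q/p_-)] and [RH_((p_+/q)')] amounts to
   [mean (w^(1/y_q)) * mean (w^(-1/x_q))^(x_q/y_q) <= K] on all cubes (plus a qualitative
   reverse Hoelder condition if [p_+ = oo]); this description is invariant under
   [w -> 1/w], [x <-> y], so that lowering an exponent is raising it for [1/w].

   To raise the exponent from [p] to [q] in a slot, freeze the other slots and set
   [W = w^(1/y_p)], which is in [A_tau] with [tau = 1 + x_p/y_p]. The Rubio de Francia
   algorithm in [L^tau(W)], with Buckley's bound for the maximal operator (Lerner's proof
   on shifted grids), dominates [((f_1 w)^p / W)^(1/tau)] by some [H] in [A_1] with
   constant [O(K^(1/(tau-1)))]. With [G = H^tau W] the weight [v = w G^(1/q-1/p)] is
   admissible at [q] with constant [O(K^gamma)]; the hypothesis at [v] and Hoelder's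
   inequality give the bound at [w], with the factor [(int G / int g_0)^|1/p-1/q|], where
   [G >= g_0 = (f_1 w)^p]. When the exponent is lowered, [g_0] is instead made from
   truncations of [f w]. The sharp [int G <= 2^tau int g_0] comes from convexity:
   the algorithm is an average of iterates with weights [2^(-k-1)].

   For sequences, extrapolate first from [q] to [r]; at [r] the estimate passes to [l^r]
   sums by Hoelder's inequality for series; then extrapolate from [r] to [p]. *)
Require Import Defs.
From HB Require Import structures.
From mathcomp Require Import all_boot all_order all_algebra.
From mathcomp Require Import all_classical all_reals all_analysis.
From mathcomp Require Import measurable_realfun.
From mathcomp Require Import ring lra zify.

Set Implicit Arguments.
Unset Strict Implicit.
Unset Printing Implicit Defensive.

Import Order.TTheory GRing.Theory Num.Theory.
Import numFieldNormedType.Exports.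

Local Open Scope classical_set_scope.
Local Open Scope ring_scope.
Local Open Scope ereal_scope.

(** The obstacle is the case [p_+ = oo]. There the reverse Hoelder class is RH_1, and membership
    only says that some RH_t with [t > 1] holds, with no constant attached. Such a [t] must be
    handed on to the new weight without entering [C_i]. When the exponent is raised, the reverse
    Hoelder exponent of [W] is enough. When it is lowered, the new weight contains a positive power
    of [H], so [H] needs a reverse Hoelder exponent too: the algorithm is run at an exponent
    slightly below [tau], which puts some [H^e] with [e > 1] in A_1, so near [tau] that the losses
    are absolute factors.

    The exponent [gamma] arises as follows. The new constant is [K c^a] with [c] of order
    [K^(y_p/x_p)] and [a = (x_p + y_p)(1/y_q - 1/y_p)], and [1 + a y_p/x_p] equals
    [(tau_q - 1)/(tau_p - 1)]. For [1/w] the constant is [K^(y_p/x_p)] and the A_1 constant is of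
    order [K]; returning to [w], the total power is 1.

    Truncation is needed when the exponent is lowered because the norm to be bounded is not known to
    be finite. *)

Section poweR_extra.
Context {R : realType}.
Implicit Types (x y : \bar R) (r : R).

Lemma le_poweR x y r : (0 <= r)%R -> 0 <= x -> x <= y -> x `^ r <= y `^ r.
Proof.
move=> r0 x0 xy; apply: gt0_ler_poweR => //; rewrite in_itv/= leey andbT//.
exact: le_trans xy.
Qed.

Lemma poweRK x r : 0 <= x -> (0 < r)%R -> (x `^ r) `^ r^-1 = x.
Proof. by move=> x0 r0; rewrite -poweRrM divff ?gt_eqF// poweRe1. Qed.

Lemma poweRVK x r : 0 <= x -> (0 < r)%R -> (x `^ r^-1) `^ r = x.
Proof. by move=> x0 r0; rewrite -poweRrM mulVf ?gt_eqF// poweRe1. Qed.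

Lemma le_poweRP x y r : (0 < r)%R -> 0 <= x -> 0 <= y ->
  x `^ r <= y -> x <= y `^ r^-1.
Proof.
move=> r0 x0 y0 xy; rewrite -[leLHS](poweRK x0 r0); apply: le_poweR => //.
  by rewrite invr_ge0 ltW.
exact: poweR_ge0.
Qed.

Lemma powRK (a r : R) : (0 <= a)%R -> (0 < r)%R -> ((a `^ r) `^ r^-1 = a)%R.
Proof. by move=> a0 r0; rewrite -powRrM divff ?gt_eqF// powRr1. Qed.

Lemma powRVK (a r : R) : (0 <= a)%R -> (0 < r)%R -> ((a `^ r^-1) `^ r = a)%R.
Proof. by move=> a0 r0; rewrite -powRrM mulVf ?gt_eqF// powRr1. Qed.

Lemma powRVinv (a r : R) : (0 <= a)%R -> (a^-1 `^ r = (a `^ r)^-1)%R.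
Proof. by move=> a0; rewrite -powR_inv1// powRAC powR_inv1// powR_ge0. Qed.

End poweR_extra.

Section measurable_extra.
Context d (T : measurableType d) (R : realType).
Implicit Types (D : set T).

Lemma measurable_fun_poweR D (f : T -> \bar R) r : measurable_fun D f ->
  measurable_fun D (fun x => f x `^ r).
Proof. by move=> mf; apply: (measurableT_comp (measurable_poweR _)). Qed.

Lemma measurable_fun_powR D (f : T -> R) r : measurable_fun D f ->
  measurable_fun D (fun x => f x `^ r)%R.
Proof. by move=> mf; apply: (measurableT_comp (measurable_powR _)). Qed.

Lemma measurable_fun_EFin D (f : T -> R) : measurable_fun D f ->
  measurable_fun D (fun x => (f x)%:E).
Proof. by move=> mf; exact/measurable_EFinP. Qed.

Lemma measurable_fun_invr D (f : T -> R) : (forall x, (0 < f x)%R) ->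
  measurable_fun D f -> measurable_fun D (fun x => (f x)^-1)%R.
Proof.
move=> f0 mf; rewrite (_ : (fun x => (f x)^-1) = fun x => f x `^ (-1))%R.
  exact: measurable_fun_powR.
by apply/funext => x; rewrite powR_inv1// ltW.
Qed.

End measurable_extra.

(** The weighted inequality of means applied to [a / A] and [b / B]. Once integrated, with [A] and
    [B] the integrals of [a] and [b], the right-hand side becomes exactly [A ^ l * B ^ (1 - l)],
    which is Hoelder's inequality. *)
Lemma young_geom (R : realType) (a b : \bar R) (A B l : R) :
  0 <= a -> 0 <= b -> (0 < A)%R -> (0 < B)%R -> (0 < l < 1)%R ->
  a `^ l * b `^ (1 - l) <=
  (A `^ l * B `^ (1 - l))%:E * ((l / A)%:E * a + ((1 - l) / B)%:E * b).
Proof.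
move=> a0 b0 A0 B0 /andP[l0 l1].
have l1' : (0 < 1 - l)%R by rewrite subr_gt0.
have AB0 : (0 < A `^ l * B `^ (1 - l))%R by rewrite mulr_gt0// powR_gt0.
case: a a0 => [r r0|_|//]; last first.
  rewrite [X in _%:E * (X + _)]gt0_muley ?lte_fin ?divr_gt0// addye.
    by rewrite [leRHS]gt0_muley ?lte_fin// leey.
  by rewrite gt_eqF// (lt_le_trans (ltNyr 0%R))// mule_ge0// lee_fin divr_ge0// ltW.
case: b b0 => [s s0|_|//]; last first.
  rewrite [X in _%:E * (_ + X)]gt0_muley ?lte_fin ?divr_gt0// addey//.
  by rewrite [leRHS]gt0_muley ?lte_fin// leey.
rewrite lee_fin in r0; rewrite lee_fin in s0.
rewrite /= lee_fin.
have x0 : (0 <= r / A)%R by rewrite divr_ge0// ltW.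
have y0 : (0 <= s / B)%R by rewrite divr_ge0// ltW.
have := @conjugate_powR _ ((r / A) `^ l)%R ((s / B) `^ (1 - l))%R l^-1%R (1 - l)^-1%R
  (powR_ge0 _ _) (powR_ge0 _ _).
rewrite !invr_gt0 !invrK => /(_ l0 l1').
rewrite -!powRrM !divff ?gt_eqF// !powRr1// => /(_ _)/wrap[]; first by lra.
rewrite !powRM ?invr_ge0//; [|exact: ltW|exact: ltW].
rewrite -!powR_inv1; [|exact: ltW|exact: ltW].
have E (t u : R) : (0 < t -> t `^ u * (t `^ (-1)) `^ u = 1)%R.
  move=> t0; rewrite -powRrM -powRD ?(gt_eqF t0) ?implybT//.
  by rewrite mulN1r subrr powRr0.
move=> /(ler_wpM2l (ltW AB0)) H.
apply: le_trans (le_trans H _) => {H}.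
  rewrite le_eqVlt; apply/orP; left; apply/eqP.
  transitivity ((r `^ l * s `^ (1 - l)) * (A `^ l * A `^ (-1) `^ l) *
      (B `^ (1 - l) * B `^ (-1) `^ (1 - l)))%R; last first.
    move: (r `^ l)%R (s `^ (1 - l))%R (A `^ l)%R (A `^ (-1) `^ l)%R => a1 a2 a3 a4.
    by move: (B `^ _)%R ((B `^ (-1)) `^ (1 - l))%R => a5 a6; ring.
  by rewrite !E// !mulr1.
rewrite le_eqVlt; apply/orP; left; apply/eqP.
by congr (_ * (_ + _))%R; rewrite mulrAC [RHS]mulrAC; congr (_ * _)%R; rewrite mulrC.
Qed.

(** * Hoelder and Jensen inequalities *)

Section hoelder.
Context d (T : measurableType d) (R : realType).
Variable mu : {measure set T -> \bar R}.

(** Weights [l] and [1 - l] replace conjugate exponents, so that the end cases [l = 0] and [l = 1]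
    are included, and the functions may take the value [+oo]. The bound [young_geom] needs integrals
    that are positive and finite; the other cases are split off. *)
Lemma hoelder_geom (D : set T) (a b : T -> \bar R) (l : R) :
  measurable D -> measurable_fun D a -> measurable_fun D b ->
  (forall x, 0 <= a x) -> (forall x, 0 <= b x) -> (0 <= l <= 1)%R ->
  \int[mu]_(x in D) (a x `^ l * b x `^ (1 - l)) <=
  (\int[mu]_(x in D) a x) `^ l * (\int[mu]_(x in D) b x) `^ (1 - l).
Proof.
move=> mD ma mb a0 b0 /andP[].
rewrite le_eqVlt => /predU1P[<- _|l0].
  under eq_integral do rewrite poweRe0 mul1e subr0 poweRe1//.
  by rewrite poweRe0 mul1e subr0 poweRe1// integral_ge0.
rewrite le_eqVlt => /predU1P[->|l1].
  under eq_integral do rewrite subrr poweRe0 mule1 poweRe1//.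
  by rewrite subrr poweRe0 mule1 poweRe1// integral_ge0.
have l1' : (0 < 1 - l)%R by rewrite subr_gt0.
have mP (c : T -> \bar R) r : measurable_fun D c -> measurable_fun D (fun x => c x `^ r).
  by move=> mc; apply: (measurableT_comp (measurable_poweR _)).
have mab : measurable_fun D (fun x => a x `^ l * b x `^ (1 - l)).
  by apply: emeasurable_funM; exact: mP.
(* A vanishing integral forces its function, hence the product, to vanish almost everywhere; this
   also settles right-hand sides of the form [0 * +oo]. *)
have zero (s : R) (c : T -> \bar R) : measurable_fun D c -> (forall x, 0 <= c x) ->
    (0 < s)%R -> \int[mu]_(x in D) c x = 0 ->
    (forall x, c x = 0 -> a x `^ l * b x `^ (1 - l) = 0) ->
    \int[mu]_(x in D) (a x `^ l * b x `^ (1 - l)) = 0.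
  move=> mc c0 s0 ic H.
  have : \int[mu]_(x in D) `|c x| = 0.
    by rewrite -ic; apply: eq_integral => x _; rewrite gee0_abs.
  move/(ae_eq_integral_abs mu mD mc) => cae.
  rewrite (@ge0_ae_eq_integral _ _ _ mu D _ (cst 0))//.
  - by rewrite integral0.
  - by move=> x _; rewrite mule_ge0// poweR_ge0.
  - by apply: filterS cae => x /[apply] /H.
have [A0|A0] := eqVneq (\int[mu]_(x in D) a x) 0.
  rewrite (zero l a)// ?A0 ?poweR0r ?mul0e ?gt_eqF// => x ->.
  by rewrite poweR0r ?mul0e// gt_eqF.
have [B0|B0] := eqVneq (\int[mu]_(x in D) b x) 0.
  rewrite (zero (1 - l)%R b)// ?B0 ?poweR0r ?mule0 ?gt_eqF// => x ->.
  by rewrite poweR0r ?mule0// gt_eqF.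
have Ag : 0 < \int[mu]_(x in D) a x by rewrite lt0e A0 integral_ge0.
have Bg : 0 < \int[mu]_(x in D) b x by rewrite lt0e B0 integral_ge0.
move: Ag Bg; case EA : (\int[mu]_(x in D) a x) => [A| |]//; last first.
  by move=> _ B0'; rewrite poweRyr ?gt_eqF// gt0_mulye ?leey// poweR_gt0.
case EB : (\int[mu]_(x in D) b x) => [B| |]//; last first.
  move=> A0' _; rewrite poweRyr ?(gt_eqF l1')// gt0_muley ?leey//.
  by rewrite poweR_gt0.
rewrite !lte_fin => A0' B0'.
apply: (@le_trans _ _ (\int[mu]_(x in D)
    ((A `^ l * B `^ (1 - l))%:E * ((l / A)%:E * a x + ((1 - l) / B)%:E * b x)))).
  apply: ge0_le_integral => //.
  - by move=> x _; rewrite mule_ge0// poweR_ge0.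
  - apply: emeasurable_funM => //.
    by apply: emeasurable_funD; exact: emeasurable_funM.
  - by move=> x _; apply: young_geom => //; rewrite l0.
have lA : (0 <= l / A)%R by rewrite divr_ge0// ltW.
have lB : (0 <= (1 - l) / B)%R by rewrite divr_ge0// ltW.
rewrite ge0_integralZl//; first last.
- by rewrite lee_fin mulr_ge0// powR_ge0.
- by move=> x _; rewrite adde_ge0// mule_ge0.
- by apply: emeasurable_funD; exact: emeasurable_funM.
rewrite ge0_integralD//; first last.
- exact: emeasurable_funM.
- by move=> x _; rewrite mule_ge0.
- exact: emeasurable_funM.
- by move=> x _; rewrite mule_ge0.
rewrite !ge0_integralZl// EA EB /= lee_fin.
by rewrite -!mulrA !mulVf ?gt_eqF// !mulr1 subrKC mulr1 lexx.
Qed.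

End hoelder.

(** * Weighted averages over the cells of a countable partition *)

Section conditional_average.
Context d (T : measurableType d) (R : realType).
Variable mu : {measure set T -> \bar R}.
Variable w : T -> R.
Hypothesis mw : measurable_fun [set: T] w.
Hypothesis w0 : forall x, (0 < w x)%R.

(** The average for the measure [w dmu]. Besides [w = 1], it is used with Muckenhoupt weights in the
    maximal inequality and, over the counting measure, with the weights of a geometric series. *)
Definition wavg (D : set T) (f : T -> \bar R) : \bar R :=
  (\int[mu]_(x in D) (w x)%:E)^-1 * \int[mu]_(x in D) (f x * (w x)%:E).

Lemma wavg_ge0 D f : (forall x, 0 <= f x) -> 0 <= wavg D f.
Proof.
move=> f0; apply: mule_ge0; first rewrite inve_ge0.
  by apply: integral_ge0 => x _; rewrite lee_fin ltW.
by apply: integral_ge0 => x _; rewrite mule_ge0// lee_fin ltW.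
Qed.

Let mE D : measurable_fun D (EFin \o w).
Proof. by apply/measurable_EFinP; exact: measurable_funTS. Qed.

(** Jensen's inequality from Hoelder's with [l = 1 / p], since [f * w = (f ^ p * w) ^ (1/p) * w ^ (1
    - 1/p)]. *)
Lemma wavg_powR (D : set T) (f : T -> \bar R) (p : R) :
  measurable D -> measurable_fun D f -> (forall x, 0 <= f x) -> (1 <= p)%R ->
  0 < \int[mu]_(x in D) (w x)%:E < +oo ->
  wavg D f `^ p <= wavg D (fun x => f x `^ p).
Proof.
move=> mD mf f0 p1 /andP[]; rewrite /wavg.
case EW : (\int[mu]_(x in D) (w x)%:E) => [W| |]//; rewrite lte_fin => W0 _.
have p0 : (0 < p)%R by exact: lt_le_trans p1.
have pV : (0 <= p^-1 <= 1)%R by rewrite invr_ge0 (ltW p0)/= invf_le1.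
have If0 q : 0 <= \int[mu]_(x in D) (f x `^ q * (w x)%:E).
  by apply: integral_ge0 => x _; rewrite mule_ge0 ?poweR_ge0// lee_fin ltW.
have If1 : 0 <= \int[mu]_(x in D) (f x * (w x)%:E).
  by apply: integral_ge0 => x _; rewrite mule_ge0// lee_fin ltW.
have mfp : measurable_fun D (fun x => f x `^ p).
  by apply: (measurableT_comp (measurable_poweR _)).
have fw0 x : 0 <= f x `^ p * (w x)%:E.
  by rewrite mule_ge0 ?poweR_ge0// lee_fin ltW.
have ew0 x : 0 <= (EFin \o w) x by rewrite lee_fin ltW.
have := @hoelder_geom _ _ _ mu D (fun x => f x `^ p * (w x)%:E) (EFin \o w) p^-1
  mD (emeasurable_funM mfp (@mE D)) (@mE D) fw0 ew0 pV.
rewrite [X in X <= _](_ : _ = \int[mu]_(x in D) (f x * (w x)%:E)); last first.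
  apply: eq_integral => x _ /=.
  rewrite poweRM ?poweR_ge0// ?lee_fin ?(ltW (w0 x))// -poweRrM divff ?gt_eqF//.
  rewrite poweRe1// -muleA; congr (_ * _).
  by rewrite /= -EFinM -powRD ?subrKC ?powRr1 ?(ltW (w0 x))// oner_eq0.
rewrite EW => H.
have Wi : (0 <= (W%:E)^-1) by rewrite inve_ge0 lee_fin ltW.
have WE : (W%:E)^-1 = W^-1%R%:E by rewrite inver gt_eqF.
rewrite poweRM//.
apply: le_trans (lee_wpmul2l (poweR_ge0 _ _) (gt0_ler_poweR (ltW p0) _ _ H)) _.
- by rewrite in_itv/= If1 leey.
- by rewrite in_itv/= leey andbT mule_ge0 ?poweR_ge0// lee_fin powR_ge0.
rewrite poweRM ?poweR_ge0// -!poweRrM mulVf ?gt_eqF// poweRe1//.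
rewrite muleCA muleC le_eqVlt; apply/orP; left; apply/eqP.
congr (_ * _); rewrite WE /= -EFinM; congr EFin.
rewrite mulrBl mul1r mulVf ?gt_eqF// -powR_inv1 ?(ltW W0)// -powRrM -powRD.
  by congr (_ `^ _)%R; lra.
by rewrite (gt_eqF W0) implybT.
Qed.

Section label.
Variable p : T -> nat.
Hypothesis mp : forall m, measurable [set x | p x = m].

(** A countable partition is encoded by a label [p] with values in [nat], its cells being the level
    sets. Measurability for the sigma-algebra of the partition is then constancy on cells. *)
Definition label_const (G : T -> \bar R) := forall x y, p x = p y -> G x = G y.

Lemma measurable_label_const G : label_const G -> measurable_fun [set: T] G.
Proof.
move=> cG _ B mB; rewrite setTI.
rewrite (_ : _ @^-1` _ = \bigcup_m ([set x | p x = m] `&` G @^-1` B)).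
  apply: bigcupT_measurable => m.
  have [[x0 [x0m Bx0]]|H] := pselect (exists x, p x = m /\ B (G x)).
    rewrite (_ : _ `&` _ = [set x | p x = m])//.
    apply/seteqP; split => [x []//|x /= xm]; split => //=.
    by rewrite (cG x x0)// xm.
  rewrite (_ : _ `&` _ = set0)//; apply/seteqP; split => // x [/= xm Bx].
  by apply: H; exists x.
by apply/seteqP; split => [x /= Bx|x [m _ []]//]; exists (p x).
Qed.

Lemma integral_label (F : T -> \bar R) : measurable_fun [set: T] F ->
  (forall x, 0 <= F x) ->
  \int[mu]_x F x = \sum_(m <oo) \int[mu]_(x in [set x | p x = m]) F x.
Proof.
move=> mF F0; rewrite -ge0_integral_bigcup//.
- by congr (integral _ _ _); apply/seteqP; split => // x _; exists (p x).
- by apply: measurable_funTS.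
- by move=> i j _ _ [x [/= <- <-]].
Qed.

Hypothesis cell_fin :
  forall x, 0 < \int[mu]_(y in [set y | p y = p x]) (w y)%:E < +oo.

Definition condavg (f : T -> \bar R) x := wavg [set y | p y = p x] f.

Lemma condavg_const f : label_const (condavg f).
Proof. by move=> x y xy; rewrite /condavg xy. Qed.

Lemma condavg_ge0 f x : (forall x, 0 <= f x) -> 0 <= condavg f x.
Proof. by move=> f0; exact: wavg_ge0. Qed.

Lemma measurable_condavg f : measurable_fun [set: T] (condavg f).
Proof. exact/measurable_label_const/condavg_const. Qed.

(** The defining property of a conditional expectation. On a cell both [G] and the average are
    constant, and the mass of the cell cancels because it is positive and finite. *)
Lemma integral_condavg (G f : T -> \bar R) : label_const G ->
  (forall x, 0 <= G x) -> measurable_fun [set: T] f -> (forall x, 0 <= f x) ->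
  \int[mu]_x (G x * condavg f x * (w x)%:E) =
  \int[mu]_x (G x * f x * (w x)%:E).
Proof.
move=> cG G0 mf f0; have mG := measurable_label_const cG.
have w0' x : 0 <= (w x)%:E by rewrite lee_fin ltW.
rewrite integral_label; last 2 first.
- by do 2?[apply: emeasurable_funM => //]; exact: measurable_condavg.
- by move=> x; apply: mule_ge0 => //; apply: mule_ge0 => //; exact: condavg_ge0.
rewrite [RHS]integral_label; last 2 first.
- by do 2?[apply: emeasurable_funM => //].
- by move=> x; rewrite !mule_ge0.
apply: eq_eseriesr => m _.
have [[x0 x0m]|H] := pselect (exists x, p x = m); last first.
  rewrite (_ : [set x | _] = set0) ?integral_set0//.
  by apply/seteqP; split => // x xm; apply: H; exists x.
under eq_integral => x /set_mem xm.
  rewrite (cG x x0) ?(condavg_const f (_ : p x = p x0)) ?x0m//.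
  over.
under [RHS]eq_integral => x /set_mem xm.
  rewrite (cG x x0) ?x0m// -muleA.
  over.
rewrite ge0_integralZl//; last by apply: mule_ge0 => //; exact: condavg_ge0.
rewrite ge0_integralZl//; last 2 first.
- by apply: emeasurable_funM => //; exact: measurable_funTS.
- by move=> x _; exact: mule_ge0.
rewrite -muleA; congr (_ * _); rewrite /condavg /wavg x0m.
have := cell_fin x0; rewrite x0m.
case: (\int[mu]_(y in _) (w y)%:E) => [W| |] /andP[]//.
rewrite lte_fin => W0 _.
by rewrite inver gt_eqF// muleAC -EFinM mulVf ?mul1e// gt_eqF.
Qed.

End label.

End conditional_average.

(** One step of Doob's inequality, for a running maximum that passes from [a] to [max a s]. If the
    maximum changes, the claim is Young's inequality for [a ^ (p - 1) * s]; the factor [p / (p - 1)]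
    is the constant of the maximal inequality. *)
Lemma max_powR_le (R : realType) (p a s : R) : (1 < p)%R -> (0 <= a)%R -> (0 <= s)%R ->
  (Num.max a s `^ p <= a `^ p +
     p / (p - 1) * ((Num.max a s `^ (p - 1) - a `^ (p - 1)) * s))%R.
Proof.
move=> p1 a0 s0; have p10 : (0 < p - 1)%R by rewrite subr_gt0.
have p0 : (0 < p)%R by lra.
have [sa|/ltW as_] := leP s a; first by rewrite subrr mul0r mulr0 addr0.
rewrite mulrBl [(s `^ _ * s)%R]mulrC mulr_powRB1//.
have := @conjugate_powR _ (a `^ (p - 1))%R s (p / (p - 1))%R p
  (powR_ge0 _ _) s0.
rewrite divr_gt0// -powRrM mulrCA divff ?gt_eqF// mulr1 => /(_ isT p0)/(_ _)/wrap[].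
  by field; rewrite !gt_eqF.
move: (a `^ p)%R (s `^ p)%R (a `^ (p - 1) * s)%R => A S X.
rewrite invf_div => H.
have : (p / (p - 1) * X <= p / (p - 1) * (A * ((p - 1) / p) + S / p))%R.
  by rewrite ler_wpM2l// divr_ge0// ltW.
rewrite [X in (_ <= X)%R](_ : _ = A + S / (p - 1))%R; last first.
  by field; rewrite !gt_eqF.
rewrite mulrBr (_ : p / (p - 1) * S = S + S / (p - 1))%R; first by lra.
by field; rewrite gt_eqF.
Qed.

(** * Doob's maximal inequality *)

Section doob.
Context d (T : measurableType d) (R : realType).
Variable mu : {measure set T -> \bar R}.
Variable w : T -> R.
Hypothesis mw : measurable_fun [set: T] w.
Hypothesis w0 : forall x, (0 < w x)%R.
Variable lab : nat -> T -> nat.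
Hypothesis mlab : forall j m, measurable [set x | lab j x = m].
Hypothesis lab_refine : forall i j x y, (i <= j)%N ->
  lab j x = lab j y -> lab i x = lab i y.
Hypothesis cell_fin : forall j x,
  0 < \int[mu]_(y in [set y | lab j y = lab j x]) (w y)%:E < +oo.

(** The recursion starts from 0, so [maxcond f J] involves only the labels of index below [J] and is
    constant on the cells of [lab J]. *)
Fixpoint maxcond (f : T -> \bar R) (J : nat) (x : T) : \bar R :=
  if J is J'.+1 then maxe (maxcond f J' x) (condavg mu w (lab J') f x) else 0.

Lemma maxcond_ge0 f J x : (forall x, 0 <= f x) -> 0 <= maxcond f J x.
Proof. by move=> f0; elim: J => //= J IH; rewrite le_max IH. Qed.

Lemma measurable_maxcond f J : measurable_fun [set: T] (maxcond f J).
Proof.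
elim: J => [|J IH /=]; first exact: measurable_cst.
by apply: measurable_maxe => //; exact: measurable_condavg.
Qed.

(** Summing [max_powR_le] over the successive maxima bounds the integral of [m ^ p] by [p / (p - 1)]
    times that of [m ^ (p - 1) * f]; Hoelder's inequality and a division then give the claim. The
    constant is independent of the density [w], and the bound for Muckenhoupt weights rests on
    this. *)
Lemma doob_maximal (f : T -> \bar R) (p : R) J :
  measurable_fun [set: T] f -> (forall x, 0 <= f x) -> (1 < p)%R ->
  \int[mu]_x (maxcond f J x `^ p * (w x)%:E) <=
  ((p / (p - 1)) `^ p)%:E * \int[mu]_x (f x `^ p * (w x)%:E).
Proof.
move=> mf f0 p1.
have p10 : (0 < p - 1)%R by rewrite subr_gt0.
have p0 : (0 < p)%R by lra.
have q0 : (0 < p / (p - 1))%R by rewrite divr_gt0.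
have w0' x : 0 <= (w x)%:E by rewrite lee_fin ltW.
have mw' : measurable_fun [set: T] (EFin \o w) by exact/measurable_EFinP.
have mfp : measurable_fun [set: T] (fun x => f x `^ p).
  by apply: (measurableT_comp (measurable_poweR _)).
have fpw0 x : 0 <= f x `^ p * (w x)%:E by exact: mule_ge0 (poweR_ge0 _ _) _.
have [->|] := eqVneq (\int[mu]_x (f x `^ p * (w x)%:E)) +oo.
  by rewrite gt0_muley ?leey// lte_fin powR_gt0.
have : 0 <= \int[mu]_x (f x `^ p * (w x)%:E) by exact: integral_ge0.
case EA : (\int[mu]_x (f x `^ p * (w x)%:E)) => [A| |]// A0 _.
have mcell j x : measurable [set y | lab j y = lab j x] by exact: mlab.
pose c j := condavg mu w (lab j) f.
have c0 j x : 0 <= c j x by exact: condavg_ge0.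
have mc j : measurable_fun [set: T] (c j) by exact: measurable_condavg.
have cp j x : c j x `^ p <= condavg mu w (lab j) (fun x => f x `^ p) x.
  by apply: wavg_powR => //; [exact: measurable_funTS|exact: ltW].
have int_cp j : \int[mu]_x (c j x `^ p * (w x)%:E) <= A%:E.
  apply: (@le_trans _ _ (\int[mu]_x
      (1 * condavg mu w (lab j) (fun x => f x `^ p) x * (w x)%:E))).
    apply: ge0_le_integral => //.
    - by move=> x _; exact: mule_ge0 (poweR_ge0 _ _) _.
    - apply: emeasurable_funM => //.
      by apply: (measurableT_comp (measurable_poweR _)).
    - apply: emeasurable_funM => //; apply: emeasurable_funM => //.
      exact: measurable_condavg.
    - by move=> x _; rewrite mul1e; apply: lee_wpmul2r.
  rewrite (@integral_condavg _ _ _ mu w mw w0 _ (mlab j) _ (fun=> 1)) ?EA//.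
  - by under eq_integral do rewrite mul1e; rewrite EA.
  - by move=> x; exact: poweR_ge0.
have cfin j x : c j x \is a fin_num.
  rewrite ge0_fin_numE//; apply: (@lty_poweRy _ _ p); first by rewrite gt_eqF.
  apply: le_lt_trans (cp j x) _; rewrite /condavg /wavg.
  have /andP[] := cell_fin j x.
  case: (\int[mu]_(y in _) (w y)%:E) => [W| |]//= W0 _.
  rewrite inver gt_eqF//; apply: lte_mul_pinfty => //.
    by rewrite lee_fin invr_ge0 ltW.
  apply: (@le_lt_trans _ _ A%:E); last by rewrite ltry.
  rewrite -EA; apply: ge0_subset_integral => //.
  by apply: emeasurable_funM.
have mc0 i x : 0 <= maxcond f i x by exact: maxcond_ge0.
have mcfin i x : maxcond f i x \is a fin_num.
  by elim: i => [//|i IH /=]; rewrite /maxe; case: ifP => // _; exact: cfin.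
pose m i x := fine (maxcond f i x).
have mE i x : maxcond f i x = (m i x)%:E by rewrite fineK.
have m0 i x : (0 <= m i x)%R by rewrite fine_ge0.
have mmax i x : m i.+1 x = Num.max (m i x) (fine (c i x)).
  by apply: EFin_inj; rewrite -mE /= EFin_max -mE fineK.
have mm i : measurable_fun [set: T] (m i).
  apply/measurable_EFinP; rewrite (_ : _ \o _ = maxcond f i); last first.
    by apply/funext => x /=; rewrite mE.
  exact: measurable_maxcond.
have mpw (g : T -> R) r : measurable_fun [set: T] g ->
    measurable_fun [set: T] (fun x => (g x `^ r)%:E).
  move=> mg; apply/measurable_EFinP.
  by apply: (measurableT_comp (measurable_powR _)).
have mconst i j : (i <= j)%N -> label_const (lab j) (maxcond f i.+1).
  elim: i j => [|i IH] j ij x y xy /=.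
    by rewrite (@condavg_const _ _ _ mu w (lab 0) f x y (lab_refine ij xy)).
  rewrite (@condavg_const _ _ _ mu w (lab i.+1) f x y (lab_refine ij xy)).
  by have /= -> := IH _ (ltnW ij) _ _ xy.
have mconst' i : label_const (lab i) (maxcond f i).
  by case: i => [x y//|i]; exact: mconst.
under eq_integral do rewrite mE.
pose Z i := \int[mu]_x ((m i x `^ p)%:E * (w x)%:E).
pose Y i := \int[mu]_x ((m i x `^ (p - 1))%:E * f x * (w x)%:E).
have fin_Z i : Z i < +oo.
  elim: i => [|i IH].
    rewrite /Z; under eq_integral do rewrite /m /= powR0 ?gt_eqF// mul0e.
    by rewrite integral0.
  apply: (@le_lt_trans _ _ (Z i + \int[mu]_x (c i x `^ p * (w x)%:E))).
    rewrite -ge0_integralD//; first last.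
    - apply: emeasurable_funM => //.
      by apply: (measurableT_comp (measurable_poweR _)).
    - by move=> x _; exact: mule_ge0 (poweR_ge0 _ _) _.
    - by apply: emeasurable_funM => //; exact: mpw.
    - by move=> x _; rewrite mule_ge0// lee_fin powR_ge0.
    apply: ge0_le_integral => //.
    - by move=> x _; rewrite mule_ge0// lee_fin powR_ge0.
    - by apply: emeasurable_funM => //; exact: mpw.
    - apply: emeasurable_funD; apply: emeasurable_funM => //; first exact: mpw.
      by apply: (measurableT_comp (measurable_poweR _)).
    - move=> x _; rewrite -ge0_muleDl ?lee_fin ?powR_ge0//; last exact: poweR_ge0.
      apply: lee_wpmul2r => //; rewrite -(fineK (cfin i x)) /= -EFinD lee_fin mmax.
      by case: (leP (m i x)) => _; rewrite (lerDr, lerDl) powR_ge0.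
  by rewrite lte_add_pinfty// (le_lt_trans (int_cp i))// ltry.
have ZY i : Z i <= (p / (p - 1))%:E * Y i.
  elim: i => [|i IH].
    rewrite /Z; under eq_integral do rewrite /m /= powR0 ?gt_eqF// mul0e.
    rewrite integral0 mule_ge0 ?lee_fin ?(ltW q0)//.
    apply: integral_ge0 => x _; rewrite mule_ge0// mule_ge0//.
    by rewrite lee_fin powR_ge0.
  (* The increment [phi] is constant on the cells of [lab i], so in an integral against it the
     average [c i] may be replaced by [f]. *)
  pose phi x : \bar R := (m i.+1 x `^ (p - 1) - m i x `^ (p - 1))%:E.
  have phi0 x : 0 <= phi x.
    rewrite lee_fin subr_ge0 ge0_ler_powR ?(ltW p10) ?nnegrE//.
    by rewrite mmax le_max lexx.
  have mphi : measurable_fun [set: T] phi.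
    by apply/measurable_EFinP; apply: measurable_funB;
      apply: (measurableT_comp (measurable_powR _)).
  have phic : label_const (lab i) phi.
    by move=> x y xy; rewrite /phi /m (mconst i i _ x y)// (mconst' i x y).
  have phif0 x : 0 <= phi x * f x * (w x)%:E by rewrite !mule_ge0.
  have mphif : measurable_fun [set: T] (fun x => phi x * f x * (w x)%:E).
    by do 2!apply: emeasurable_funM => //.
  have phic0 x : 0 <= phi x * c i x * (w x)%:E.
    by apply: mule_ge0 => //; exact: mule_ge0.
  have mphic : measurable_fun [set: T] (fun x => phi x * c i x * (w x)%:E).
    by do 2!apply: emeasurable_funM => //.
  have mp0 j x : 0 <= (m j x `^ (p - 1))%:E * f x * (w x)%:E.
    by rewrite !mule_ge0// lee_fin powR_ge0.
  have mmp j : measurable_fun [set: T] (fun x => (m j x `^ (p - 1))%:E * f x * (w x)%:E).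
    by do 2!apply: emeasurable_funM => //; exact: mpw.
  have -> : Y i.+1 = Y i + \int[mu]_x (phi x * f x * (w x)%:E).
    rewrite -ge0_integralD//; apply: eq_integral => x _.
    rewrite -ge0_muleDl ?mule_ge0// ?lee_fin ?powR_ge0//.
    rewrite -ge0_muleDl//; last by rewrite lee_fin powR_ge0.
    by rewrite -EFinD subrKC.
  rewrite ge0_muleDr//; last 2 first.
  - exact: integral_ge0.
  - exact: integral_ge0.
  apply: le_trans (leeD2r _ IH).
  rewrite -(@integral_condavg _ _ _ mu w mw w0 _ (mlab i))//.
  rewrite -ge0_integralZl//; last by rewrite lee_fin ltW.
  rewrite -ge0_integralD//; first last.
  - by apply: emeasurable_funM.
  - by move=> x _; apply: mule_ge0 => //; rewrite lee_fin ltW.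
  - by apply: emeasurable_funM => //; exact: mpw.
  - by move=> x _; rewrite mule_ge0// lee_fin powR_ge0.
  apply: ge0_le_integral => //.
  - by move=> x _; rewrite mule_ge0// lee_fin powR_ge0.
  - by apply: emeasurable_funM => //; exact: mpw.
  - apply: emeasurable_funD; first by apply: emeasurable_funM => //; exact: mpw.
    by apply: emeasurable_funM.
  - move=> x _; rewrite -/(c i) -(fineK (cfin i x)) mmax /phi mmax.
    rewrite /= lee_fin mulrA -mulrDl ler_wpM2r ?(ltW (w0 x))//.
    by apply: max_powR_le => //; rewrite fine_ge0.
have Z0 : 0 <= Z J.
  by apply: integral_ge0 => x _; rewrite mule_ge0// lee_fin powR_ge0.
have YH : Y J <= A%:E `^ p^-1 * Z J `^ (1 - p^-1).
  have pV : (0 <= p^-1 <= 1)%R by rewrite invr_ge0 (ltW p0)/= invf_le1// ltW.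
  have ma : measurable_fun [set: T] (fun x => f x `^ p * (w x)%:E).
    exact: emeasurable_funM.
  have mb : measurable_fun [set: T] (fun x => (m J x `^ p)%:E * (w x)%:E).
    by apply: emeasurable_funM => //; exact: mpw.
  have b0 x : 0 <= (m J x `^ p)%:E * (w x)%:E.
    by rewrite mule_ge0// lee_fin powR_ge0.
  have := hoelder_geom mu measurableT ma mb fpw0 b0 pV.
  rewrite EA -/(Z J) => /(le_trans _); apply.
  rewrite le_eqVlt; apply/orP; left; apply/eqP.
  apply: eq_integral => x _; rewrite !poweRM ?lee_fin ?powR_ge0 ?poweR_ge0 ?(ltW (w0 x))//.
  rewrite -poweRrM divff ?gt_eqF// poweRe1//= -powRrM.
  rewrite (_ : p * (1 - p^-1) = p - 1)%R; last by rewrite mulrBr mulr1 divff ?gt_eqF.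
  rewrite [in LHS]muleC [RHS]muleACA -EFinM -powRD ?subrKC ?powRr1 ?(ltW (w0 x))//.
    by rewrite muleC [f x * _]muleC.
  by rewrite oner_eq0.
move: (ZY J) YH Z0 (fin_Z J); rewrite -/(Z J).
case: (Z J) => [z| |]//; rewrite lee_fin => H1 H2 z0 _.
have : z%:E <= (p / (p - 1) * (A `^ p^-1 * z `^ (1 - p^-1)))%:E.
  by apply: le_trans H1 _; rewrite [leRHS]EFinM lee_wpmul2l// lee_fin ltW.
rewrite !lee_fin in A0 * => zle.
have [->|zN0] := eqVneq z 0%R; first by rewrite mulr_ge0// powR_ge0.
have zp : (0 < z)%R by rewrite lt_neqAle eq_sym zN0.
have : (z `^ p^-1 <= p / (p - 1) * A `^ p^-1)%R.
  have z1 : (0 < z `^ (1 - p^-1))%R by exact: powR_gt0.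
  rewrite -(ler_pM2r z1) -powRD ?zN0 ?implybT// subrKC powRr1//.
  by rewrite -[leRHS]mulrA.
have C0 : (0 <= p / (p - 1) * A `^ p^-1)%R by rewrite mulr_ge0 ?(ltW q0)// powR_ge0.
move/(ge0_ler_powR (ltW p0)); rewrite !nnegrE => /(_ (powR_ge0 _ _) C0).
rewrite -powRrM mulVf ?gt_eqF// powRr1// => /le_trans; apply.
by rewrite powRM ?powR_ge0 ?(ltW q0)// -powRrM mulVf ?gt_eqF// powRr1.
Qed.

End doob.

(** * Auxiliary integral estimates *)

Lemma integral_sup_powR_le d (T : measurableType d) (R : realType)
    (mu : {measure set T -> \bar R}) (w : T -> R) (a : nat -> T -> \bar R)
    (p : R) (B : \bar R) :
  measurable_fun [set: T] w -> (forall x, (0 < w x)%R) ->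
  (forall j, measurable_fun [set: T] (a j)) -> (forall j x, 0 <= a j x) ->
  (forall x, {homo a ^~ x : i j / (i <= j)%N >-> i <= j}) -> (0 < p)%R ->
  (forall j, \int[mu]_x (a j x `^ p * (w x)%:E) <= B) ->
  \int[mu]_x (ereal_sup (range (a ^~ x)) `^ p * (w x)%:E) <= B.
Proof.
move=> mw w0 ma a0 nda p0 aB.
have mw' : measurable_fun [set: T] (EFin \o w) by exact/measurable_EFinP.
have w0' x : 0 <= (w x)%:E by rewrite lee_fin ltW.
have mpow g : measurable_fun [set: T] g ->
    measurable_fun [set: T] (fun x => g x `^ p * (w x)%:E).
  move=> mg; apply: emeasurable_funM => //.
  by apply: (measurableT_comp (measurable_poweR _)).
pose g j x := a j x `^ p * (w x)%:E.
have ndg x : {homo g ^~ x : i j / (i <= j)%N >-> i <= j}.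
  move=> i j ij; apply: lee_wpmul2r => //; apply: le_poweR => //.
  - exact: ltW.
  - exact: nda.
have g0 j x : 0 <= g j x by apply: mule_ge0 => //; exact: poweR_ge0.
have msup : measurable_fun [set: T] (fun x => ereal_sup (range (a ^~ x))).
  apply: (emeasurable_fun_cvg a) => // x _.
  exact: ereal_nondecreasing_cvgn (nda x).
have supge0 x : 0 <= ereal_sup (range (a ^~ x)).
  by apply: le_trans (a0 0%N x) _; apply: ereal_sup_ubound; exists 0%N.
apply: (@le_trans _ _ (\int[mu]_x limn (g ^~ x))).
  apply: ge0_le_integral => //.
  - by move=> x _; apply: mule_ge0 => //; exact: poweR_ge0.
  - exact: mpow.
  - apply: (emeasurable_fun_cvg g) => [j|x _]; first exact: mpow.
    exact: ereal_nondecreasing_is_cvgn (ndg x).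
  - move=> x _; have /cvg_lim -> // := ereal_nondecreasing_cvgn (ndg x).
    set b := ereal_sup (range (g ^~ x)).
    have gb j : g j x <= b by apply: ereal_sup_ubound; exists j.
    have b0 : 0 <= b by exact: le_trans (g0 0%N x) (gb 0%N).
    (* Inverting the power term by term moves it outside the supremum. *)
    have aw j : a j x `^ p <= b * (w x)^-1%:E.
      rewrite -(@lee_pmul2r _ (w x)%:E) ?lte_fin//.
      by rewrite -muleA -EFinM mulVf ?gt_eqF// mule1; exact: gb.
    have wi0 : 0 <= (w x)^-1%:E by rewrite lee_fin invr_ge0 ltW.
    have : ereal_sup (range (a ^~ x)) <= (b * (w x)^-1%:E) `^ p^-1.
      apply: ge_ereal_sup => _ [j _ <-].
      by apply: le_poweRP => //; exact: mule_ge0.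
    move/(gt0_ler_poweR (ltW p0)); rewrite !in_itv/= supge0 poweR_ge0 !leey.
    move=> /(_ isT isT); rewrite -poweRrM mulVf ?gt_eqF// poweRe1 ?mule_ge0//.
    rewrite -(@lee_pmul2r _ (w x)%:E) ?lte_fin//.
    by rewrite -muleA -EFinM mulVf ?gt_eqF// mule1.
rewrite monotone_convergence//; last by move=> j; exact: mpow.
apply: lime_le; last exact: nearW.
apply: ereal_nondecreasing_is_cvgn => i j ij; apply: ge0_le_integral => //.
- exact: mpow.
- exact: mpow.
- by move=> x _; exact: ndg.
Qed.

Lemma integral_gt0 d (T : measurableType d) (R : realType)
    (mu : {measure set T -> \bar R}) (D : set T) (g : T -> R) :
  measurable D -> measurable_fun D g -> (forall x, (0 < g x)%R) -> 0 < mu D ->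
  0 < \int[mu]_(x in D) (g x)%:E.
Proof.
move=> mD mg g0 muD; rewrite lt0e integral_ge0 ?andbT; last first.
  by move=> x _; rewrite lee_fin ltW.
apply/eqP => ig.
have : \int[mu]_(x in D) `|(g x)%:E| = 0.
  by rewrite -ig; apply: eq_integral => x _; rewrite gee0_abs// lee_fin ltW.
have mg' : measurable_fun D (EFin \o g) by exact/measurable_EFinP.
move/(ae_eq_integral_abs mu mD mg') => [N [mN N0 DN]].
have : mu D <= mu N.
  apply: le_measure; rewrite ?inE// => x Dx; apply: DN => /= /(_ Dx)/eqP.
  by rewrite eqe gt_eqF.
by rewrite N0 leNgt muD.
Qed.

Lemma le_integral_cst d (T : measurableType d) (R : realType)
    (mu : {measure set T -> \bar R}) (D : set T) (g : T -> \bar R) (c : \bar R) :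
  measurable D -> measurable_fun D g -> 0 <= c -> (forall x, D x -> c <= g x) ->
  mu D * c <= \int[mu]_(x in D) g x.
Proof.
move=> mD mg c0 cg; rewrite muleC -integral_cst//.
exact: ge0_le_integral.
Qed.

Lemma le_integral_powR_scale d (T : measurableType d) (R : realType)
    (mu : {measure set T -> \bar R}) (a b : T -> \bar R) (w : T -> R) (c r q : R) :
  measurable_fun [set: T] a -> measurable_fun [set: T] b ->
  measurable_fun [set: T] w -> (forall x, 0 <= b x) -> (forall x, (0 < w x)%R) ->
  (0 <= c)%R -> (0 <= q)%R -> (forall x, a x `^ r <= c%:E * b x) ->
  \int[mu]_x (a x `^ (r * q) * (w x)%:E) <=
  (c `^ q)%:E * \int[mu]_x (b x `^ q * (w x)%:E).
Proof.
move=> ma mb mw b0 w0 c0 q0 ab.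
have mw' : measurable_fun [set: T] (EFin \o w) by exact/measurable_EFinP.
have w0' x : 0 <= (w x)%:E by rewrite lee_fin ltW.
have bq0 x : 0 <= b x `^ q * (w x)%:E by apply: mule_ge0 => //; exact: poweR_ge0.
have mbq : measurable_fun [set: T] (fun x => b x `^ q * (w x)%:E).
  by apply: emeasurable_funM => //; exact: measurable_fun_poweR.
rewrite -ge0_integralZl//; last by rewrite lee_fin powR_ge0.
apply: ge0_le_integral => //.
- by move=> x _; apply: mule_ge0 => //; exact: poweR_ge0.
- by apply: emeasurable_funM => //; exact: measurable_fun_poweR.
- exact: emeasurable_funM.
- move=> x _; rewrite muleA; apply: lee_wpmul2r => //.
  rewrite poweRrM (_ : (c `^ q)%:E * _ = (c%:E * b x) `^ q).
    by apply: le_poweR => //; exact: poweR_ge0.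
  by rewrite poweRM.
Qed.

(** After multiplication by a large [4 ^ N0] the number exceeds 1, and the least power of 4 above it
    is within a factor 4. *)
Lemma ex_exprz4 (R : realType) (z : R) : (0 < z)%R ->
  exists k : int, (z <= 4 ^ (- k) <= 4 * z)%R.
Proof.
move=> z0.
have ex (y : R) : exists j : nat, (y <= 4 ^+ j)%R.
  exists (Num.truncn y).+1; apply: ltW; apply: lt_le_trans (truncnS_gt y) _.
  by rewrite -natrX ler_nat ltnW// ltn_expl.
have [N0 HN0] := ex (2 / z)%R.
have exj : exists j : nat, (z * 4 ^+ N0 <= 4 ^+ j)%R by exact: ex.
case: (ex_minnP exj) => -[|j] jz jmin.
  move: jz; rewrite expr0 => jz.
  suff : (2 <= z * 4 ^+ N0)%R by lra.
  by rewrite mulrC -ler_pdivrMr.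
have pN : (0 < (4 : R) ^+ N0)%R by rewrite exprn_gt0.
have jz' : (4 ^+ j < z * 4 ^+ N0)%R.
  by rewrite ltNge; apply/negP => /jmin; rewrite ltnn.
exists (N0%:Z - j.+1%:Z)%R.
rewrite opprB expfzDr// -invr_expz -!exprnP ler_pdivlMr// jz/=.
rewrite ler_pdivrMr// exprS -mulrA ler_wpM2l//; exact: ltW.
Qed.

(** * Shifted grids and the maximal operator *)

Section grid.
Context {R : realType} {n : nat}.

(** Cells of generation [k] have side [4 ^ (- k)], and [s] selects the axes along which the grid is
    shifted by a third of a side. The base is 4 because [4 / 3 = 1 + 1 / 3]: the shift by [1 / 3]
    reproduces itself modulo integers from one generation to the next, so each shifted family is
    nested. *)
Definition grid_index (s : {ffun 'I_n -> bool}) (k : int) (x : Rn R n) :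
    {ffun 'I_n -> int} :=
  [ffun i => Num.floor (4 ^ k * tnth x i + (s i)%:R / 3)%R].

Definition grid_label s k (x : Rn R n) : nat := pickle (grid_index s k x).

Lemma grid_label_eq s k x y : (grid_label s k y = grid_label s k x) <->
  (forall i, Num.floor (4 ^ k * tnth y i + (s i)%:R / 3)%R =
             Num.floor (4 ^ k * tnth x i + (s i)%:R / 3)%R).
Proof.
split=> [/(pcan_inj (@pickleK _)) /ffunP H i|H]; first by have := H i; rewrite !ffunE.
by congr pickle; apply/ffunP => i; rewrite !ffunE.
Qed.

Lemma grid_cellE s k x : [set y | grid_label s k y = grid_label s k x] =
  cube (fun i => 4 ^ (- k) * ((grid_index s k x i)%:~R - (s i)%:R / 3))%R (4 ^ (- k))%R.
Proof.
have p4 : (0 < (4 : R) ^ (- k))%R by rewrite exprz_gt0.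
have E (t : R) : (t = 4 ^ (- k) * (4 ^ k * t))%R.
  by rewrite mulrA -expfzDr// addNr expr0z mul1r.
have C (t u : R) : (4 ^ (- k) * u <= t < 4 ^ (- k) * u + 4 ^ (- k) <->
    u <= 4 ^ k * t < u + 1)%R.
  have -> : (4 ^ (- k) * u + 4 ^ (- k) = 4 ^ (- k) * (u + 1) :> R)%R.
    by rewrite mulrDr mulr1.
  by rewrite [X in (_ <= X < _)%R]E [X in (X && _)]ler_pM2l// ltr_pM2l.
apply/seteqP; split => y /=.
  move/grid_label_eq => H i; rewrite ffunE -(H i); apply/C.
  have := floor_itv (4 ^ k * tnth y i + (s i)%:R / 3)%R; rewrite intrD.
  by move=> /andP[H1 H2]; apply/andP; split; lra.
move=> H; apply/grid_label_eq => i; apply/eqP; rewrite floor_eq intrD.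
have /C := H i; rewrite ffunE => /andP[H1 H2].
by apply/andP; split; lra.
Qed.

Lemma grid_cell_cube s k x :
  cubes [set y | grid_label s k y = grid_label s k x].
Proof. by rewrite grid_cellE; eexists; eexists; split; last reflexivity; rewrite exprz_gt0. Qed.

Lemma measurable_cube (a : 'I_n -> R) (l : R) : measurable (cube a l).
Proof.
apply: sub_caratheodory; apply: sub_sigma_algebra.
exact: measurable_cube_borel.
Qed.

Lemma measurable_cubes (Q : set (Rn R n)) : cubes Q -> measurable Q.
Proof. by move=> [a [l [_ ->]]]; exact: measurable_cube. Qed.

Lemma lebesgue_cubes (Q : set (Rn R n)) : cubes Q ->
  exists2 r : R, (0 < r)%R & lebesgue_Rn Q = r%:E.
Proof.
move=> [a [l [l0 ->]]]; exists (l ^+ n)%R; first exact: exprn_gt0.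
by rewrite lebesgue_cube// ltW.
Qed.

Lemma measurable_grid_label s k m : measurable [set x | grid_label s k x = m].
Proof.
have [[x <-]|H] := pselect (exists x, grid_label s k x = m).
  exact/measurable_cubes/grid_cell_cube.
by rewrite (_ : mkset _ = set0)//; apply/seteqP; split => // x xm; apply: H; exists x.
Qed.

(** Since [4 * (t + b / 3)] and [4 * t + b / 3] differ by the integer [b], the index of the finer
    cell determines that of the coarser one. *)
Lemma floor_mul4 (b : bool) (t u : R) :
  Num.floor (4 * t + b%:R / 3)%R = Num.floor (4 * u + b%:R / 3)%R ->
  Num.floor (t + b%:R / 3)%R = Num.floor (u + b%:R / 3)%R.
Proof.
have E v : (4 * (v + b%:R / 3) = 4 * v + b%:R / 3 + (b : int)%:~R :> R)%R.
  by case: b => /=; lra.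
set z := Num.floor (4 * u + _)%R => H.
have /andP[z1 z2] := floor_itv (4 * t + b%:R / 3)%R.
have /andP[z3 z4] := floor_itv (4 * u + b%:R / 3)%R.
rewrite -/z in z3 z4; rewrite H in z1 z2.
apply: floor_def; set m := Num.floor (u + _)%R.
have /andP[m1 m2] := floor_itv (u + b%:R / 3)%R; rewrite -/m in m1 m2.
have : ((4 * m)%:~R < (z + 1 + (b : int))%:~R :> R)%R.
  rewrite intrM [in ltRHS]intrD; apply: le_lt_trans (_ : _ <= 4 * (u + b%:R / 3))%R _.
    by rewrite ler_pM2l.
  by rewrite E ltrD2r.
have : ((z + (b : int))%:~R < (4 * (m + 1))%:~R :> R)%R.
  rewrite intrM [in ltLHS]intrD; apply: le_lt_trans (_ : _ <= 4 * (u + b%:R / 3))%R _.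
    by rewrite E lerD2r.
  by rewrite ltr_pM2l.
rewrite !ltr_int => H1 H2.
have H1' : ((z + 1 + (b : int))%:~R <= (4 * (m + 1))%:~R :> R)%R by rewrite ler_int; lia.
have H2' : ((4 * m)%:~R <= (z + (b : int))%:~R :> R)%R by rewrite ler_int; lia.
have p4 : (0 < 4 :> R)%R by [].
apply/andP; split.
  rewrite -(ler_pM2l p4) E; apply: le_trans (_ : _ <= (z + (b : int))%:~R)%R _.
    by apply: le_trans H2'; rewrite intrM.
  by rewrite intrD lerD2r.
rewrite -(ltr_pM2l p4) E; apply: lt_le_trans (_ : _ < (z + 1 + (b : int))%:~R)%R _.
  by rewrite [ltRHS]intrD ltrD2r.
by apply: le_trans H1' _; rewrite intrM.
Qed.

Lemma grid_label_refine s (k : int) i j x y : (i <= j)%N ->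
  grid_label s (k + j%:Z) x = grid_label s (k + j%:Z) y ->
  grid_label s (k + i%:Z) x = grid_label s (k + i%:Z) y.
Proof.
move=> /subnK <-; elim: (j - i)%N => [//|{}j IH] H; apply: IH.
apply/grid_label_eq => a; apply: floor_mul4.
have /grid_label_eq/(_ a) := H.
by rewrite addSn intS (addrC 1%R) addrA expfzDr// expr1z -!mulrA !(mulrCA _ 4%R).
Qed.

(** The one-third trick. The generation is such that the side of the cube is at most a third of that
    of a cell; an interval of this length cannot cross endpoints of both the grid and its shift. The
    factor 12 is 3 times the ratio 4 of consecutive sides. *)
Lemma grid_cover (a : 'I_n -> R) (l : R) : (0 < l)%R ->
  exists s k, (4 ^ (- k) <= 12 * l)%R /\
    forall x y, cube a l x -> cube a l y -> grid_label s k y = grid_label s k x.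
Proof.
move=> l0; have [k /andP[k1 k2]] := @ex_exprz4 _ (3 * l)%R ltac:(lra).
have p4 : (0 < (4 : R) ^ k)%R by rewrite exprz_gt0.
pose u i := (4 ^ k * a i)%R.
(* The shift is used on the axes where the corner lies in the last third of its cell, the only case
   in which the interval may cross the right endpoint. *)
pose s := [ffun i => (2 / 3 < u i - (Num.floor (u i))%:~R)%R] : {ffun 'I_n -> bool}.
exists s, k; split; first by lra.
suff H x : cube a l x -> forall i, Num.floor (4 ^ k * tnth x i + (s i)%:R / 3)%R =
    (Num.floor (u i) + (s i : int))%R.
  by move=> x y /H Hx /H Hy; apply/grid_label_eq => i; rewrite Hx Hy.
move=> xQ i; have /andP[x1 x2] := xQ i.
have y1 : (u i <= 4 ^ k * tnth x i)%R by rewrite ler_pM2l.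
have y2 : (4 ^ k * tnth x i < u i + 1 / 3)%R.
  have : (4 ^ k * tnth x i < 4 ^ k * (a i + l))%R by rewrite ltr_pM2l.
  rewrite mulrDr => /lt_le_trans; apply; rewrite lerD2l.
  have : (4 ^ k * (3 * l) <= 4 ^ k * 4 ^ (- k))%R by rewrite ler_pM2l.
  by rewrite -expfzDr// subrr expr0z; lra.
have /andP[] := floor_itv (u i); rewrite intrD => f1 f2.
apply: floor_def; rewrite !intrD ffunE.
by have [] := ltP (2 / 3)%R (u i - (Num.floor (u i))%:~R)%R => /= H; apply/andP; split; lra.
Qed.

End grid.

Section lebesgue_Rn_lemmas.
Context {R : realType} {n : nat}.
Local Notation T := (Rn R n).
Local Notation mu := (@lebesgue_Rn R n).
Implicit Types (f : T -> \bar R) (Q : set T).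

Lemma avg_wavg Q f : measurable Q -> avg Q f = wavg mu (cst 1%R) Q f.
Proof.
move=> mQ; rewrite /avg /wavg; congr (_^-1 * _).
  by rewrite -[LHS]mul1e -(integral_cst mu mQ).
by apply: eq_integral => x _; rewrite mule1.
Qed.

Lemma integral_cubes_fin Q f : cubes Q -> (forall x, 0 <= f x) ->
  avg Q f < +oo -> \int[mu]_(x in Q) f x < +oo.
Proof.
move=> cQ f0; have [r r0 E] := lebesgue_cubes cQ.
rewrite /avg E inver gt_eqF//.
have : 0 <= \int[mu]_(x in Q) f x by exact: integral_ge0.
case: (\int[mu]_(x in Q) f x) => [s _ _|_|//]; first by rewrite ltry.
by rewrite gt0_muley// lte_fin invr_gt0.
Qed.

(** Large centred cubes exhaust the space, so some cube around [x] carries part of the integral.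
    This makes the maximal function strictly positive at every point. *)
Lemma integral_setT_cubes f : measurable_fun [set: T] f ->
  (forall x, 0 <= f x) -> 0 < \int[mu]_x f x ->
  forall x, exists2 Q, cubes Q & Q x /\ 0 < \int[mu]_(y in Q) f y.
Proof.
move=> mf f0 If x.
pose Q j : set T := cube (fun=> - j.+1%:R)%R (2 * j.+1%:R)%R.
have cQ j : cubes (Q j) by exists (fun=> - j.+1%:R)%R, (2 * j.+1%:R)%R.
have ndQ : nondecreasing_seq Q.
  move=> i j ij; apply/subsetPset => y yQ a; have /andP[y1 y2] := yQ a.
  have : (i.+1%:R <= j.+1%:R :> R)%R by rewrite ler_nat.
  by move=> H; apply/andP; split; lra.
have exQ y : exists j, Q j y.
  pose N := (\max_(a < n) (Num.truncn `|tnth y a|).+1)%N.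
  exists N => a.
  have : (`|tnth y a| < N.+1%:R)%R.
    apply: lt_le_trans (truncnS_gt _) _; rewrite ler_nat ltnW// ltnS.
    by rewrite (leq_bigmax (F := fun a => (Num.truncn `|tnth y a|).+1)).
  by rewrite ltr_norml => /andP[y1 y2]; apply/andP; split; lra.
have bigQ : \bigcup_j Q j = [set: T].
  by apply/seteqP; split => // y _; have [j] := exQ y; exists j.
apply: contrapT => H.
have [j0 xj0] := exQ x.
have Z j : \int[mu]_(y in Q j) f y = 0.
  apply/eqP; rewrite eq_le integral_ge0// andbT leNgt; apply/negP => Ij.
  apply: H; exists (Q (maxn j j0)); first exact: cQ.
  split; first by move/subsetPset : (ndQ j0 _ (leq_maxr j j0)); exact.
  apply: lt_le_trans Ij _; apply: ge0_subset_integral => //.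
  - exact/measurable_cubes/cQ.
  - exact/measurable_cubes/cQ.
  - exact: measurable_funTS.
  - by move/subsetPset : (ndQ j _ (leq_maxl j j0)).
have : \int[mu]_(y in Q j) f y @[j --> \oo] --> \int[mu]_(y in \bigcup_j Q j) f y.
  apply: ge0_nondecreasing_set_cvg_integral => //.
  - by move=> j; exact/measurable_cubes/cQ.
  - by move=> j; exact: measurable_funTS.
rewrite bigQ (_ : (fun j => _) = cst 0); last exact/funext.
by move=> /cvg_lim; rewrite lim_cst// => I0; move: If; rewrite -I0// ltxx.
Qed.

End lebesgue_Rn_lemmas.

Section grid_maximal.
Context {R : realType} {n : nat}.
Local Notation T := (Rn R n).
Local Notation mu := (@lebesgue_Rn R n).
Implicit Types (f : T -> \bar R) (Q : set T) (s : {ffun 'I_n -> bool}).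

Definition loc_integrable (w : T -> R) := forall Q, cubes Q ->
  avg Q (EFin \o w) < +oo.

Lemma cubes_integral_gt0_fin (w : T -> R) Q : measurable_fun [set: T] w ->
  (forall x, (0 < w x)%R) -> loc_integrable w -> cubes Q ->
  0 < \int[mu]_(y in Q) (w y)%:E < +oo.
Proof.
move=> mw w0 wloc cQ; apply/andP; split; last first.
  by apply: integral_cubes_fin => //; [move=> x; rewrite lee_fin ltW|exact: wloc].
apply: integral_gt0 => //; first exact: measurable_cubes.
  exact: measurable_funTS.
by have [r r0 E] := lebesgue_cubes cQ; rewrite [X in _ < X]E lte_fin.
Qed.

Section weighted.
Variable w : T -> R.
Hypothesis mw : measurable_fun [set: T] w.
Hypothesis w0 : forall x, (0 < w x)%R.
Hypothesis wloc : loc_integrable w.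

(** The supremum runs over all integers [k], with no coarsest generation. Doob's inequality is
    applied to the generations from [-N] to [N], which [lab] numbers from the coarsest on, and [N]
    tends to infinity. *)
Definition gridmax s f x : \bar R :=
  ereal_sup [set condavg mu w (grid_label s k) f x | k in [set: int]].

Lemma gridmax_ub s f k x : condavg mu w (grid_label s k) f x <= gridmax s f x.
Proof. by apply: ereal_sup_ubound; exists k. Qed.

Lemma gridmax_ge0 s f x : (forall x, 0 <= f x) -> 0 <= gridmax s f x.
Proof.
by move=> f0; apply: le_trans (gridmax_ub s f 0 x); exact: condavg_ge0.
Qed.

Let lab s (N j : nat) := grid_label s (- N%:Z + j%:Z)%R : T -> nat.
Let gmax s f N x := maxcond mu w (lab s N) f N.*2.+1 x.

Let gmax_ub s f N (k : int) x : (- N%:Z <= k <= N%:Z)%R ->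
  condavg mu w (grid_label s k) f x <= gmax s f N x.
Proof.
move=> kN; have [j jN ->] : exists2 j, (j < N.*2.+1)%N & k = (- N%:Z + j%:Z)%R.
  by exists (absz (k + N%:Z)%R); lia.
rewrite /gmax; elim: (N.*2.+1)%N jN => // J IH; rewrite ltnS leq_eqVlt /=.
move=> /predU1P[->|/IH H]; rewrite le_max; apply/orP; first by right; exact: lexx.
by left; exact: H.
Qed.

Let gmax_le s f N x (B : \bar R) : 0 <= B ->
  (forall k, (- N%:Z <= k <= N%:Z)%R -> condavg mu w (grid_label s k) f x <= B) ->
  gmax s f N x <= B.
Proof.
move=> B0 H; rewrite /gmax.
suff : forall J, (J <= N.*2.+1)%N -> maxcond mu w (lab s N) f J x <= B by exact.
elim=> [//|J IH JN] /=; rewrite ge_max IH ?(ltnW JN)//=; apply: H.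
by lia.
Qed.

Lemma gridmaxE s f x : (forall x, 0 <= f x) ->
  gridmax s f x = ereal_sup (range (fun N => gmax s f N x)).
Proof.
move=> f0; apply/eqP; rewrite eq_le; apply/andP; split; apply: ge_ereal_sup.
  move=> _ [k _ <-]; apply: le_trans (_ : _ <= gmax s f `|k|%N x) _.
    by apply: gmax_ub; lia.
  by apply: ereal_sup_ubound; exists `|k|%N.
move=> _ [N _ <-]; apply: gmax_le; first exact: gridmax_ge0.
by move=> k _; exact: gridmax_ub.
Qed.

Let measurable_gmax s f N : measurable_fun [set: T] (gmax s f N).
Proof. by apply: measurable_maxcond => j m; exact: measurable_grid_label. Qed.

Let gmax_ge0 s f N x : (forall x, 0 <= f x) -> 0 <= gmax s f N x.
Proof. by move=> f0; exact: maxcond_ge0. Qed.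

Let nd_gmax s f x : (forall x, 0 <= f x) ->
  {homo (fun N => gmax s f N x) : i j / (i <= j)%N >-> i <= j}.
Proof.
move=> f0 i j ij; apply: gmax_le; first exact: gmax_ge0.
by move=> k ki; apply: gmax_ub; lia.
Qed.

Lemma measurable_gridmax s f : (forall x, 0 <= f x) ->
  measurable_fun [set: T] (gridmax s f).
Proof.
move=> f0; apply: (emeasurable_fun_cvg (gmax s f)) => [N|x _].
  exact: measurable_gmax.
by rewrite gridmaxE//; apply: ereal_nondecreasing_cvgn; exact: nd_gmax.
Qed.

Lemma gridmax_bound s f (p : R) : measurable_fun [set: T] f ->
  (forall x, 0 <= f x) -> (1 < p)%R ->
  \int[mu]_x (gridmax s f x `^ p * (w x)%:E) <=
  ((p / (p - 1)) `^ p)%:E * \int[mu]_x (f x `^ p * (w x)%:E).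
Proof.
move=> mf f0 p1; under eq_integral do rewrite gridmaxE//.
apply: integral_sup_powR_le => //.
- by move=> N x; exact: gmax_ge0.
- by move=> x; exact: nd_gmax.
- by rewrite (lt_trans ltr01).
- move=> N; apply: doob_maximal => //.
  + by move=> j m; exact: measurable_grid_label.
  + by move=> i j x y; exact: grid_label_refine.
  + by move=> j x; apply: cubes_integral_gt0_fin => //; exact: grid_cell_cube.
Qed.

End weighted.

(* Lerner's proof: with [sg = W^(-1/(p-1))], each average of [f] is at most
   [K^(1/(p-1))] times an average over the same cell, for the measure [W dx], of
   [(M_sg (f / sg))^(p-1) / W], raised to [1/(p-1)]; conclude by Doob's inequality
   for the measures [W dx] and [sg dx]. *)
Lemma gridmax_buckley s (W : T -> R) (p K : R) f :
  measurable_fun [set: T] W -> (forall x, (0 < W x)%R) -> (1 < p)%R ->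
  loc_integrable W -> loc_integrable (fun x => W x `^ (- (p - 1)^-1))%R ->
  (0 <= K)%R ->
  (forall Q, cubes Q -> avg Q (EFin \o W) *
     avg Q (EFin \o (fun x => W x `^ (- (p - 1)^-1))%R) `^ (p - 1) <= K%:E) ->
  measurable_fun [set: T] f -> (forall x, 0 <= f x) ->
  \int[mu]_x (gridmax (cst 1%R) s f x `^ p * (W x)%:E) <=
  (((p / (p - 1)) * p `^ (p - 1)^-1 * K `^ (p - 1)^-1) `^ p)%:E *
    \int[mu]_x (f x `^ p * (W x)%:E).
Proof.
move=> mW W0 p1 Wloc; set sg := (fun x : T => W x `^ _)%R => sloc K0 KA mf f0.
have p10 : (0 < p - 1)%R by rewrite subr_gt0.
have p0 : (0 < p)%R by lra.
have s0 x : (0 < sg x)%R by exact: powR_gt0.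
have ms : measurable_fun [set: T] sg.
  by apply: (measurableT_comp (measurable_powR _)).
have mEW : measurable_fun [set: T] (EFin \o W) by exact/measurable_EFinP.
have mEs : measurable_fun [set: T] (EFin \o sg) by exact/measurable_EFinP.
pose g x := f x * (sg x)^-1%:E.
have si0 x : 0 <= (sg x)^-1%:E by rewrite lee_fin invr_ge0 ltW.
have Wi0 x : 0 <= (W x)^-1%:E by rewrite lee_fin invr_ge0 ltW.
have g0 x : 0 <= g x by rewrite mule_ge0.
have minv (h : T -> R) : (forall x, 0 < h x)%R -> measurable_fun [set: T] h ->
    measurable_fun [set: T] (fun x => (h x)^-1%:E).
  by move=> h0 mh; apply: measurable_fun_EFin; exact: measurable_fun_invr.
have mg : measurable_fun [set: T] g by exact: emeasurable_funM mf (minv _ s0 ms).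
pose G x := gridmax sg s g x.
have G0 x : 0 <= G x by exact: gridmax_ge0.
have mG : measurable_fun [set: T] G by exact: measurable_gridmax.
pose phi x := G x `^ (p - 1) * (W x)^-1%:E.
have phi0 x : 0 <= phi x by apply: mule_ge0 => //; exact: poweR_ge0.
have mphi : measurable_fun [set: T] phi.
  apply: emeasurable_funM; last exact: minv.
  by apply: (measurableT_comp (measurable_poweR _)).
(* With [A], [B] the integrals of [W] and [sg] over the cell [Q], the hypothesis bounds
   [(avg f) ^ (p - 1)] by [K * (|Q| / A) * (int f / B) ^ (p - 1)]. Here [int f / B] is an average of
   [f / sg] for [sg dx], hence at most [G] on the whole cell. *)
have key x : gridmax (cst 1%R) s f x `^ (p - 1) <= K%:E * gridmax W s phi x.
  have M0 : 0 <= K%:E * gridmax W s phi x by rewrite mule_ge0 ?lee_fin// gridmax_ge0.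
  suff : gridmax (cst 1%R) s f x <= (K%:E * gridmax W s phi x) `^ (p - 1)^-1.
    move/(gt0_ler_poweR (ltW p10)); rewrite !in_itv/= gridmax_ge0// poweR_ge0 !leey.
    by move=> /(_ isT isT); rewrite -poweRrM mulVf ?gt_eqF// poweRe1.
  apply: ge_ereal_sup => _ [k _ <-].
  have c0 : 0 <= condavg mu (cst 1%R) (grid_label s k) f x by exact: condavg_ge0.
  apply: le_poweRP => //.
  have kp : 0 <= K%:E by rewrite lee_fin.
  apply: le_trans (lee_wpmul2l kp (gridmax_ub W s phi k x)).
  rewrite /condavg; set Q := [set y | _].
  have cQ : cubes Q by exact: grid_cell_cube.
  have mQ := measurable_cubes cQ.
  have [r r0 Er] := lebesgue_cubes cQ.
  have := cubes_integral_gt0_fin mW W0 Wloc cQ.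
  have := cubes_integral_gt0_fin ms s0 sloc cQ.
  have := KA Q cQ; rewrite -(avg_wavg _ mQ) /avg /wavg Er inver gt_eqF//=.
  case EB : (\int[mu]_(y in Q) (sg y)%:E) => [B| |] + /andP[]//.
  rewrite lte_fin => + B0 _.
  case: (\int[mu]_(y in Q) (W y)%:E) => [A| |] + /andP[]//.
  rewrite lte_fin => + A0 _.
  move=> KAB'; have KAB : (r^-1 * A * (r^-1 * B) `^ (p - 1) <= K)%R by exact: KAB'.
  rewrite inver gt_eqF//.
  have E1 y : Q y -> (B^-1)%:E * \int[mu]_(z in Q) f z <= G y.
    move=> Qy; apply: le_trans (gridmax_ub sg s g k y).
    have QE : [set z | grid_label s k z = grid_label s k y] = Q.
      by rewrite /Q Qy.
    rewrite /condavg QE /wavg EB inver gt_eqF//; apply: lee_wpmul2l.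
      by rewrite lee_fin invr_ge0 ltW.
    rewrite le_eqVlt; apply/orP; left; apply/eqP; apply: eq_integral => z _.
    by rewrite /g -muleA -EFinM mulVf ?mule1// gt_eqF.
  set F := \int[mu]_(z in Q) f z in E1 *.
  have F0 : 0 <= F by exact: integral_ge0.
  have E2 : (r%:E * ((B^-1)%:E * F) `^ (p - 1)) <= \int[mu]_(z in Q) (phi z * (W z)%:E).
    rewrite -Er; apply: le_integral_cst; [exact: mQ| | |].
    - apply: emeasurable_funM; first exact: measurable_funTS mphi.
      exact: measurable_funTS mEW.
    - exact: poweR_ge0.
    - move=> z Qz; rewrite /phi -muleA -EFinM mulVf ?gt_eqF// mule1.
      apply: le_poweR; [exact: ltW| |exact: E1].
      by apply: mule_ge0; rewrite // lee_fin invr_ge0 ltW.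
  have kA : 0 <= K%:E * (A^-1)%:E by rewrite mule_ge0// lee_fin invr_ge0 ltW.
  rewrite muleA; apply: le_trans (lee_wpmul2l kA E2).
  rewrite !poweRM ?lee_fin ?invr_ge0 ?(ltW r0) ?(ltW B0)// !muleA.
  apply: lee_wpmul2r; first exact: poweR_ge0.
  rewrite /= lee_fin.
  have q1 : (0 < B `^ (p - 1))%R by exact: powR_gt0.
  have := KAB; rewrite powRM ?invr_ge0 ?(ltW r0) ?(ltW B0)//.
  have -> : ((B^-1) `^ (p - 1) = (B `^ (p - 1))^-1)%R.
    by rewrite powRVinv// ltW.
  move: ((r^-1) `^ (p - 1))%R (B `^ (p - 1))%R q1 => a b b0 H.
  have ri : (0 < A^-1 * r / b)%R by rewrite !mulr_gt0 ?invr_gt0.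
  have := ler_wpM2r (ltW ri) H.
  rewrite (_ : r^-1 * A * (a * b) * (A^-1 * r / b) = a)%R; last first.
    by field; rewrite !gt_eqF.
  by rewrite !mulrA.
(* The conjugate exponent links the two measures: by [Wp'] and [sgp], [phi ^ p' * W] is
   [G ^ p * sg], and [g ^ p * sg] is [f ^ p * W]. *)
pose p' := (p / (p - 1))%R.
have p'1 : (1 < p')%R by rewrite /p' ltr_pdivlMr// mul1r; lra.
have p'0 : (0 < p')%R by lra.
have pp' : ((p - 1) * p' = p)%R by rewrite /p' mulrCA divff ?mulr1// gt_eqF.
have Wp' x : ((W x)^-1 `^ p' * W x = sg x)%R.
  have W0' : (0 <= W x)%R by exact: ltW.
  rewrite -powR_inv1// -powRrM -[X in (_ * X)%R]powRr1// -powRD; last first.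
    by rewrite (gt_eqF (W0 x)) implybT.
  by rewrite /sg; congr (_ `^ _)%R; rewrite /p'; field; rewrite gt_eqF.
have sgp x : ((sg x)^-1 `^ p * sg x = W x)%R.
  have W0' : (0 <= W x)%R by exact: ltW.
  have s0' : (0 <= sg x)%R by exact: ltW.
  rewrite -powR_inv1// -powRrM -[X in (_ * X)%R]powRr1// -powRD; last first.
    by rewrite (gt_eqF (s0 x)) implybT.
  rewrite /sg -powRrM -[RHS]powRr1//; congr (_ `^ _)%R.
  by field; rewrite gt_eqF.
have mpow q (h : T -> \bar R) (u : T -> R) : measurable_fun [set: T] h ->
    measurable_fun [set: T] u -> measurable_fun [set: T] (fun x => h x `^ q * (u x)%:E).
  move=> mh mu'; apply: emeasurable_funM; last exact/measurable_EFinP.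
  by apply: (measurableT_comp (measurable_poweR _)).
have pow0 q (h : T -> \bar R) (u : T -> R) x : (forall x, 0 < u x)%R ->
    0 <= h x `^ q * (u x)%:E.
  by move=> u0; apply: mule_ge0; [exact: poweR_ge0|rewrite lee_fin ltW].
have mM : measurable_fun [set: T] (gridmax (cst 1%R) s f).
  by apply: measurable_gridmax.
have mMW : measurable_fun [set: T] (gridmax W s phi) by exact: measurable_gridmax.
have MW0 x : 0 <= gridmax W s phi x by exact: gridmax_ge0.
have := le_integral_powR_scale mu mM mMW mW MW0 W0 K0 (ltW p'0) key.
rewrite pp' => /le_trans; apply.
have := @gridmax_bound W mW W0 Wloc s phi p' mphi phi0 p'1.
have -> : (p' / (p' - 1) = p)%R by rewrite /p'; field; lra.
under [in leRHS]eq_integral.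
  move=> x _; rewrite poweRM ?poweR_ge0// -poweRrM pp' -muleA -EFinM Wp'; over.
have := @gridmax_bound sg ms s0 sloc s g p mg g0 p1.
rewrite -/p' -/G.
under [in leRHS]eq_integral.
  move=> x _; rewrite poweRM// -muleA -EFinM sgp; over.
move=> H1 H2.
(* The factor [K ^ p'] comes from the pointwise bound, [p ^ p'] from Doob's inequality for [W dx] at
   the exponent [p'], and [p' ^ p] from the one for [sg dx] at the exponent [p]. *)
have c1 : 0 <= (K `^ p')%:E by rewrite lee_fin powR_ge0.
have c2 : 0 <= (p `^ p')%:E by rewrite lee_fin powR_ge0.
apply: le_trans (lee_wpmul2l c1 (le_trans H2 (lee_wpmul2l c2 H1))) _.
rewrite !muleA -!EFinM; apply: lee_wpmul2r; first by apply: integral_ge0 => x _; exact: pow0.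
have ep : ((p - 1)^-1 * p = p')%R by rewrite mulrC.
have a0 := powR_ge0 p (p - 1)^-1; have b0 := powR_ge0 K (p - 1)^-1.
rewrite lee_fin (powRM _ (mulr_ge0 (ltW p'0) a0) b0) (powRM _ (ltW p'0) a0).
rewrite -!powRrM ep.
by move: (p' `^ p)%R (p `^ p')%R (K `^ p')%R => a b c; rewrite [leLHS]mulrC [(c * b)%R]mulrC mulrA.
Qed.

End grid_maximal.

Lemma measurable_bigmaxe d (T : measurableType d) (R : realType) (I : Type)
    (r : seq I) (F : I -> T -> \bar R) :
  (forall i, measurable_fun [set: T] (F i)) ->
  measurable_fun [set: T] (fun x => \big[maxe/0]_(i <- r) F i x).
Proof.
move=> mF; elim: r => [|i r IH].
  by under eq_fun do rewrite big_nil; exact: measurable_cst.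
by under eq_fun do rewrite big_cons; exact: measurable_maxe.
Qed.

Lemma bigmaxe_ge0 (R : realType) (I : Type) (r : seq I) (F : I -> \bar R) :
  0 <= \big[maxe/0]_(i <- r) F i.
Proof.
elim: r => [|i r IH]; first by rewrite big_nil.
by rewrite big_cons le_max IH orbT.
Qed.

Lemma bigmaxe_poweR_le (R : realType) (I : Type) (r : seq I) (F : I -> \bar R)
    (p : R) : (0 < p)%R -> (forall i, 0 <= F i) ->
  (\big[maxe/0]_(i <- r) F i) `^ p <= \sum_(i <- r) F i `^ p.
Proof.
move=> p0 F0; elim: r => [|i r IH]; first by rewrite !big_nil poweR0r// gt_eqF.
have S0 : 0 <= \sum_(i <- r) F i `^ p by apply: sume_ge0 => j _; exact: poweR_ge0.
rewrite !big_cons /maxe; case: ifP => _.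
  by apply: le_trans IH _; rewrite leeDr// poweR_ge0.
by rewrite leeDl.
Qed.

Lemma integral_bigmaxe_poweR_le d (T : measurableType d) (R : realType)
    (mu : {measure set T -> \bar R}) (I : Type) (r : seq I) (F : I -> T -> \bar R)
    (W : T -> R) (p : R) (B : \bar R) :
  (forall i, measurable_fun [set: T] (F i)) -> (forall i x, 0 <= F i x) ->
  measurable_fun [set: T] W -> (forall x, (0 < W x)%R) -> (0 < p)%R ->
  (forall i, \int[mu]_x (F i x `^ p * (W x)%:E) <= B) ->
  \int[mu]_x ((\big[maxe/0]_(i <- r) F i x) `^ p * (W x)%:E) <= \sum_(i <- r) B.
Proof.
move=> mF F0 mW W0 p0 FB.
have W0' x : 0 <= (W x)%:E by rewrite lee_fin ltW.
have mEW : measurable_fun [set: T] (EFin \o W) by exact/measurable_EFinP.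
have mFp i : measurable_fun [set: T] (fun x => F i x `^ p * (W x)%:E).
  exact: emeasurable_funM (measurable_fun_poweR _ (mF i)) mEW.
have Fp0 i x : 0 <= F i x `^ p * (W x)%:E.
  by apply: mule_ge0 => //; exact: poweR_ge0.
apply: (@le_trans _ _ (\int[mu]_x \sum_(i <- r) (F i x `^ p * (W x)%:E))).
  apply: ge0_le_integral; first exact: measurableT.
  - by move=> x _; apply: mule_ge0 => //; exact: poweR_ge0.
  - exact: emeasurable_funM (measurable_fun_poweR _ (measurable_bigmaxe _ mF)) mEW.
  - exact: emeasurable_sum.
  - move=> x _; rewrite -ge0_sume_distrl; last by move=> s _; exact: poweR_ge0.
    by apply: lee_wpmul2r => //; exact: bigmaxe_poweR_le.
by rewrite ge0_integral_sum//; apply: lee_sum => i _; exact: FB.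
Qed.

(** * The Rubio de Francia algorithm *)

Section rubio_de_francia.
Context d (T : measurableType d) (R : realType).
Variable mu : {measure set T -> \bar R}.
Variable M : (T -> \bar R) -> T -> \bar R.
Hypothesis M_ge0 : forall f x, (forall x, 0 <= f x) -> 0 <= M f x.
Hypothesis measurable_M : forall f, (forall x, 0 <= f x) ->
  measurable_fun [set: T] (M f).
Hypothesis M_series : forall (f : nat -> T -> \bar R) x,
  (forall k, measurable_fun [set: T] (f k)) -> (forall k x, 0 <= f k x) ->
  M (fun x => \sum_(k <oo) f k x) x <= \sum_(k <oo) M (f k) x.
Hypothesis M_scale : forall (c : R) f x, (0 <= c)%R ->
  measurable_fun [set: T] f -> (forall x, 0 <= f x) ->
  M (fun x => c%:E * f x) x <= c%:E * M f x.
Variables (W : T -> R) (p N : R).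
Hypothesis mW : measurable_fun [set: T] W.
Hypothesis W0 : forall x, (0 < W x)%R.
Hypothesis p1 : (1 <= p)%R.
Hypothesis N0 : (0 < N)%R.
Hypothesis M_bound : forall f, measurable_fun [set: T] f -> (forall x, 0 <= f x) ->
  \int[mu]_x (M f x `^ p * (W x)%:E) <=
  (N `^ p)%:E * \int[mu]_x (f x `^ p * (W x)%:E).

Let p0 : (0 < p)%R. Proof. exact: lt_le_trans p1. Qed.

Definition half (k : nat) : R := (1 / (2 ^ (k + 1))%:R)%R.

Lemma half_gt0 k : (0 < half k)%R.
Proof. by rewrite /half divr_gt0// ltr0n expn_gt0. Qed.

Lemma half_sum : \sum_(k <oo) (half k)%:E = 1 :> \bar R.
Proof.
have := @cvg_geometric_eseries_half R 1%R 0%N.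
by rewrite expr0 divr1 => /cvg_lim <-.
Qed.

(** Jensen's inequality over the counting measure, with the numbers [half k] as a probability
    density. *)
Lemma half_jensen (a : nat -> \bar R) : (forall k, 0 <= a k) ->
  (\sum_(k <oo) (half k)%:E * a k) `^ p <= \sum_(k <oo) (half k)%:E * a k `^ p.
Proof.
move=> a0.
have h0 k : 0 <= (half k)%:E by rewrite lee_fin ltW// half_gt0.
have cE (b : nat -> \bar R) : (forall k, 0 <= b k) ->
    wavg (@counting _ R) half [set: nat] b = \sum_(k <oo) (half k)%:E * b k.
  move=> b0; rewrite /wavg !ge0_integral_count//; last by move=> k; rewrite mule_ge0.
  rewrite half_sum inver oner_eq0 invr1 mul1e.
  by apply: eq_eseriesr => k _; rewrite muleC.
rewrite -!cE//; last by move=> k; exact: poweR_ge0.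
apply: wavg_powR => //; last by rewrite ge0_integral_count// half_sum ltry lte01.
exact: half_gt0.
Qed.

(** [H] is the series of the iterates of [M] on [h], the [k]-th one divided by [(2 * N) ^ k].
    Applying [M] shifts the series by one place, which costs a factor [2 * N]. The bound on [M h],
    from the term of index 1, serves later to show that [H] is strictly positive. *)
Lemma rdf (h : T -> \bar R) : measurable_fun [set: T] h -> (forall x, 0 <= h x) ->
  exists H : T -> \bar R, [/\ measurable_fun [set: T] H,
    forall x, h x <= H x,
    forall x, M H x <= (2 * N)%:E * H x,
    forall x, M h x <= (2 * N)%:E * H x &
    \int[mu]_x (H x `^ p * (W x)%:E) <=
    (2 `^ p)%:E * \int[mu]_x (h x `^ p * (W x)%:E)].
Proof.
move=> mh h0.
pose m k := iter k M h.
have m0 k x : 0 <= m k x by elim: k x => [//|k IH] x /=; exact: M_ge0.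
have mm k : measurable_fun [set: T] (m k).
  by case: k => [//|k]; apply: measurable_M.
have N2 : (0 < 2 * N)%R by rewrite mulr_gt0.
pose c k : R := ((2 * N) ^- k)%R.
have c0 k : (0 < c k)%R by rewrite invr_gt0 exprn_gt0.
have c0' k : (0 <= c k)%R by exact: ltW.
pose u k x := (c k)%:E * m k x.
have u0 k x : 0 <= u k x by rewrite mule_ge0// lee_fin.
have mu' k : measurable_fun [set: T] (u k) by exact: emeasurable_funM.
pose H x := \sum_(k <oo) u k x.
have H0 x : 0 <= H x by exact: nneseries_ge0.
have uH k x : u k x <= H x.
  apply: le_trans (nneseries_lim_ge k.+1 _) => //.
  by rewrite big_nat_recr//= leeDr// sume_ge0.
have MH x : M H x <= (2 * N)%:E * H x.
  apply: le_trans (M_series x mu' u0) _.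
  have cS k : (c k = 2 * N * c k.+1)%R.
    by rewrite /c exprS invfM mulrA divff ?mul1r// gt_eqF.
  apply: (@le_trans _ _ (\sum_(k <oo) (2 * N)%:E * u k.+1 x)).
    apply: lee_nneseries => [k *|k *]; first exact/M_ge0/u0.
    apply: le_trans (M_scale x (c0' k) (mm k) (m0 k)) _.
    by rewrite /u cS EFinM muleA.
  rewrite nneseriesZl; last by move=> k _; exact: u0.
  apply: lee_wpmul2l; first by rewrite lee_fin ltW.
  apply: lime_le; first by apply: is_cvg_nneseries => k *; exact: u0.
  apply: nearW => k; apply: le_trans (nneseries_lim_ge k.+1 _) => //.
  by rewrite [leRHS]big_nat_recl//= leeDr.
exists H; split => //.
- by apply: ge0_emeasurable_sum => // k x _ _.
- by move=> x; apply: le_trans (uH 0%N x); rewrite /u /c expr0 invr1 mul1e.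
- move=> x; apply: le_trans (lee_wpmul2l _ (uH 1%N x)).
    by rewrite /u /c expr1 muleA -EFinM divff ?mul1e// gt_eqF.
  by rewrite lee_fin ltW.
have W0' x : 0 <= (W x)%:E by rewrite lee_fin ltW.
have mEW : measurable_fun [set: T] (EFin \o W) by exact/measurable_EFinP.
have pow0 f x : 0 <= f x `^ p * (W x)%:E by apply: mule_ge0 => //; exact: poweR_ge0.
have mpow f : measurable_fun [set: T] f ->
    measurable_fun [set: T] (fun x => f x `^ p * (W x)%:E).
  by move=> mf; apply: emeasurable_funM => //; exact: measurable_fun_poweR.
set J := \int[mu]_x (h x `^ p * (W x)%:E).
have J0 : 0 <= J by apply: integral_ge0 => x _; exact: pow0.
have mk k : \int[mu]_x (m k x `^ p * (W x)%:E) <= ((N `^ p) ^+ k)%:E * J.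
  elim: k => [|k IH]; first by rewrite expr0 mul1e.
  apply: le_trans (M_bound (mm k) (m0 k)) _.
  by rewrite exprS EFinM -muleA; apply: lee_wpmul2l => //; rewrite lee_fin powR_ge0.
pose a k x := (N ^- k)%:E * m k x.
have Nk k : (0 <= N ^- k)%R by rewrite invr_ge0 exprn_ge0// ltW.
have a0 k x : 0 <= a k x by rewrite mule_ge0// lee_fin.
have ma k : measurable_fun [set: T] (a k) by exact: emeasurable_funM.
have half0 k : 0 <= (half k)%:E by rewrite lee_fin ltW// half_gt0.
(* Extracting the factor 2 turns the coefficients into the probabilities [half k]; the normalised
   iterates [a k] all have [p]-th power integral at most [J]. *)
have HE x : H x = 2%:E * \sum_(k <oo) (half k)%:E * a k x.
  rewrite -nneseriesZl//; last by move=> k _; rewrite mule_ge0.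
  apply: eq_eseriesr => k _; rewrite /u /a !muleA -!EFinM; congr (_%:E * _).
  by rewrite /c /half exprMn invfM mul1r addn1 natrX exprS invfM !mulrA divff ?mul1r.
have ak k : \int[mu]_x (a k x `^ p * (W x)%:E) <= J.
  have -> : \int[mu]_x (a k x `^ p * (W x)%:E) =
      ((N ^- k) `^ p)%:E * \int[mu]_x (m k x `^ p * (W x)%:E).
    rewrite -ge0_integralZl//; last 2 first.
    - exact: mpow.
    - by rewrite lee_fin powR_ge0.
    by apply: eq_integral => x _; rewrite poweRM ?lee_fin// muleA.
  apply: le_trans (lee_wpmul2l _ (mk k)) _; first by rewrite lee_fin powR_ge0.
  rewrite muleA -EFinM powRVinv ?exprn_ge0 ?(ltW N0)//.
  rewrite -powR_mulrn ?(ltW N0)// powRAC powR_mulrn ?powR_ge0//.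
  by rewrite mulVf ?mul1e// expf_neq0// gt_eqF// powR_gt0.
apply: (@le_trans _ _ (\int[mu]_x ((2 `^ p)%:E *
    \sum_(k <oo) (half k)%:E * (a k x `^ p * (W x)%:E)))).
  have mser : measurable_fun [set: T]
      (fun x => \sum_(k <oo) (half k)%:E * (a k x `^ p * (W x)%:E)).
    apply: ge0_emeasurable_sum => [k x _ _|k _]; first by rewrite mule_ge0.
    by apply: emeasurable_funM => //; exact: mpow.
  apply: ge0_le_integral => //.
  - by apply: mpow; apply: ge0_emeasurable_sum => // k x _ _.
  - exact: emeasurable_funM.
  move=> x _; rewrite HE poweRM//; last by apply: nneseries_ge0 => k _ _; rewrite mule_ge0.
  rewrite -muleA; apply: lee_wpmul2l; first by rewrite lee_fin powR_ge0.
  apply: (@le_trans _ _ ((\sum_(k <oo) (half k)%:E * a k x `^ p) * (W x)%:E)).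
    by apply: lee_wpmul2r => //; exact: half_jensen.
  rewrite muleC -nneseriesZl//; last by move=> k _; apply: mule_ge0 => //; exact: poweR_ge0.
  apply: lee_nneseries => [k *|k *].
    by apply: mule_ge0 => //; apply: mule_ge0 => //; exact: poweR_ge0.
  by rewrite muleCA [(W x)%:E * _]muleC.
rewrite ge0_integralZl//; last 2 first.
- apply: ge0_emeasurable_sum => [k x _ _|k _]; first by rewrite mule_ge0.
  by apply: emeasurable_funM => //; exact: mpow.
- by move=> x _; apply: nneseries_ge0 => k _ _; rewrite mule_ge0.
apply: lee_wpmul2l; first by rewrite lee_fin powR_ge0.
rewrite integral_nneseries//; last 2 first.
- by move=> k; apply: emeasurable_funM => //; exact: mpow.
- by move=> k x _; rewrite mule_ge0.
apply: (@le_trans _ _ (\sum_(k <oo) (half k)%:E * J)).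
  apply: lee_nneseries => [k *|k *].
    by apply: integral_ge0 => x _; rewrite mule_ge0.
  rewrite ge0_integralZl//; last exact: mpow.
  exact: lee_wpmul2l.
have [->|Jy] := eqVneq J +oo; first by rewrite leey.
have Jf : J \is a fin_num by rewrite ge0_fin_numE// ltey.
rewrite -(fineK Jf); under eq_eseriesr do rewrite muleC.
by rewrite nneseriesZl// half_sum mule1.
Qed.

End rubio_de_francia.

Section maximal_operator.
Context {R : realType} {n : nat}.
Local Notation T := (Rn R n).
Local Notation mu := (@lebesgue_Rn R n).
Implicit Types (f : T -> \bar R) (Q : set T).

(** A substitute for the uncentred maximal operator over cubes; its averages are over the cells of
    the [2 ^ n] shifted grids. *)
Definition maxop f x : \bar R :=
  \big[maxe/0]_(s : {ffun 'I_n -> bool}) gridmax (cst 1%R) s f x.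

Lemma maxop_ge0 f x : 0 <= maxop f x.
Proof. exact: bigmaxe_ge0. Qed.

Lemma gridmax_maxop f s x : gridmax (cst 1%R) s f x <= maxop f x.
Proof. by rewrite /maxop le_bigmax. Qed.

Lemma maxop_le f x (B : \bar R) : 0 <= B ->
  (forall s k, condavg mu (cst 1%R) (grid_label s k) f x <= B) -> maxop f x <= B.
Proof.
move=> B0 H; apply/bigmax_leP; split => // s _.
by apply: ge_ereal_sup => _ [k _ <-]; exact: H.
Qed.

Lemma condavg_maxop f s k x :
  condavg mu (cst 1%R) (grid_label s k) f x <= maxop f x.
Proof. exact: le_trans (gridmax_ub _ _ _ _ _) (gridmax_maxop f s x). Qed.

Lemma measurable_maxop f : (forall x, 0 <= f x) -> measurable_fun [set: T] (maxop f).
Proof.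
move=> f0; apply: measurable_bigmaxe => s.
exact: measurable_gridmax.
Qed.

Lemma maxop_series (f : nat -> T -> \bar R) x :
  (forall k, measurable_fun [set: T] (f k)) -> (forall k x, 0 <= f k x) ->
  maxop (fun x => \sum_(k <oo) f k x) x <= \sum_(k <oo) maxop (f k) x.
Proof.
move=> mf f0; apply: maxop_le.
  by apply: nneseries_ge0 => k _ _; exact: maxop_ge0.
move=> s k; pose Q := [set y : T | grid_label s k y = grid_label s k x].
have cQ : cubes Q by exact: grid_cell_cube.
have mQ := measurable_cubes cQ.
have -> : condavg mu (cst 1%R) (grid_label s k) (fun x => \sum_(k <oo) f k x) x =
    \sum_(j <oo) condavg mu (cst 1%R) (grid_label s k) (f j) x.
  rewrite /condavg -/Q -(avg_wavg _ mQ) /avg integral_nneseries//; last first.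
    by move=> j; exact: measurable_funTS.
  have [r r0 E] := lebesgue_cubes cQ; rewrite E inver gt_eqF//.
  rewrite -nneseriesZl; last by move=> j _; exact: integral_ge0.
  by apply: eq_eseriesr => j _; rewrite -(avg_wavg _ mQ) /avg E inver gt_eqF.
apply: lee_nneseries => [j *|j *]; first exact: condavg_ge0.
exact: condavg_maxop.
Qed.

Lemma maxop_scale (c : R) f x : (0 <= c)%R ->
  measurable_fun [set: T] f -> (forall x, 0 <= f x) ->
  maxop (fun x => c%:E * f x) x <= c%:E * maxop f x.
Proof.
move=> c0 mf f0; apply: maxop_le.
  by apply: mule_ge0; [rewrite lee_fin|exact: maxop_ge0].
move=> s k; apply: (@le_trans _ _ (c%:E * condavg mu (cst 1%R) (grid_label s k) f x)).
  rewrite /condavg /wavg muleCA; apply: lee_wpmul2l.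
    by rewrite inve_ge0; apply: integral_ge0.
  under eq_integral do rewrite mule1.
  under [X in _ <= _ * X]eq_integral do rewrite mule1.
  rewrite ge0_integralZl//; last exact: measurable_funTS.
  exact/measurable_cubes/grid_cell_cube.
by apply: lee_wpmul2l; [rewrite lee_fin|exact: condavg_maxop].
Qed.

(** The cube lies in a cell whose side is at most 12 times its own, so the ratio of the measures is
    at most [12 ^ n]. *)
Lemma avg_maxop Q f x : cubes Q -> Q x -> measurable_fun [set: T] f ->
  (forall x, 0 <= f x) -> avg Q f <= (12 ^+ n)%:E * maxop f x.
Proof.
move=> cQ; have := cQ => -[a [l [l0 QE]]] Qx mf f0.
have [s [k [kl H]]] := grid_cover a l0.
apply: (@le_trans _ _ ((12 ^+ n)%:E * condavg mu (cst 1%R) (grid_label s k) f x)).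
  rewrite /condavg; set Q' := [set y | _].
  have cQ' : cubes Q' by exact: grid_cell_cube.
  have sQ : Q `<=` Q' by move=> y; rewrite QE => Qy; apply: H => //; rewrite -QE.
  rewrite -(avg_wavg _ (measurable_cubes cQ')) /avg.
  have p4 : (0 < (4 : R) ^ (- k))%R by rewrite exprz_gt0.
  rewrite {1}QE lebesgue_cube ?(ltW l0)// /Q' grid_cellE lebesgue_cube ?(ltW p4)//.
  rewrite -grid_cellE -/Q' !inver !gt_eqF ?exprn_gt0// muleA -EFinM.
  apply: lee_pmul.
  - by rewrite lee_fin invr_ge0 exprn_ge0// ltW.
  - exact: integral_ge0.
  - rewrite lee_fin ler_pdivlMr ?exprn_gt0// mulrC ler_pdivrMr ?exprn_gt0//.
    by rewrite -exprMn lerXn2r ?nnegrE ?mulr_ge0 ?(ltW p4) ?(ltW l0).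
  - apply: ge0_subset_integral => //; [exact: measurable_cubes|exact: measurable_cubes|].
    exact: measurable_funTS.
by apply: lee_wpmul2l; [rewrite lee_fin exprn_ge0|exact: condavg_maxop].
Qed.

Definition buckley_const (p : R) : R := (2 ^+ n * (p / (p - 1) * p `^ (p - 1)^-1))%R.

Lemma maxop_buckley (W : T -> R) (p K : R) f :
  measurable_fun [set: T] W -> (forall x, (0 < W x)%R) -> (1 < p)%R ->
  loc_integrable W -> loc_integrable (fun x => W x `^ (- (p - 1)^-1))%R ->
  (0 <= K)%R ->
  (forall Q, cubes Q -> avg Q (EFin \o W) *
     avg Q (EFin \o (fun x => W x `^ (- (p - 1)^-1))%R) `^ (p - 1) <= K%:E) ->
  measurable_fun [set: T] f -> (forall x, 0 <= f x) ->
  \int[mu]_x (maxop f x `^ p * (W x)%:E) <=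
  ((buckley_const p * K `^ (p - 1)^-1) `^ p)%:E *
    \int[mu]_x (f x `^ p * (W x)%:E).
Proof.
move=> mW W0 p1 Wloc sloc K0 KA mf f0.
have p0 : (0 < p)%R by lra.
have W0' x : 0 <= (W x)%:E by rewrite lee_fin ltW.
pose M s := gridmax (cst 1%R) s f.
have M0 s x : 0 <= M s x by exact: gridmax_ge0.
have mM s : measurable_fun [set: T] (M s).
  exact: measurable_gridmax.
set J := \int[mu]_x (f x `^ p * (W x)%:E).
have J0 : 0 <= J.
  by apply: integral_ge0 => x _; apply: mule_ge0 => //; exact: poweR_ge0.
pose c := (p / (p - 1) * p `^ (p - 1)^-1 * K `^ (p - 1)^-1)%R.
have c0 : (0 <= c)%R.
  by rewrite /c !mulr_ge0 ?powR_ge0 ?invr_ge0 ?subr_ge0 ?(ltW p0) ?(ltW p1).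
apply: (@le_trans _ _ (\sum_(s : {ffun 'I_n -> bool}) ((c `^ p)%:E * J))).
  apply: integral_bigmaxe_poweR_le => // s.
  exact: gridmax_buckley.
rewrite -ge0_sume_distrl; last by move=> s _; rewrite lee_fin powR_ge0.
apply: lee_wpmul2r => //.
rewrite sumEFin sumr_const card_ffun card_bool card_ord lee_fin.
rewrite /buckley_const -mulrA -/c powRM ?exprn_ge0// -[leLHS]mulr_natl natrX.
apply: ler_wpM2r; first exact: powR_ge0.
(* The number [2 ^ n] of grids is absorbed into the base, as [2 ^ n <= (2 ^ n) ^ p]. *)
by apply: le1r_powR; [rewrite exprn_ege1// ler1n|exact: ltW].
Qed.

End maximal_operator.

(** * Weights and averages *)

Section means.
Context d (T : measurableType d) (R : realType).
Variable mu : {measure set T -> \bar R}.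
Variable Qs : set (set T).
Hypothesis measurable_Qs : forall Q, Qs Q -> measurable Q.
Hypothesis mu_Qs : forall Q, Qs Q -> exists2 r : R, (0 < r)%R & mu Q = r%:E.
Implicit Types (Q : set T) (g : T -> R).

Definition mavg Q (f : T -> \bar R) : \bar R := (mu Q)^-1 * \int[mu]_(x in Q) f x.

(** A real number, so that products and powers of averages are computed in [R]. It carries
    information only when the average is finite, and is therefore used together with [loc_int]. *)
Definition mean Q g : R := fine (mavg Q (EFin \o g)).

Definition loc_int g := forall Q, Qs Q -> mavg Q (EFin \o g) < +oo.

Definition pos_meas g := measurable_fun [set: T] g /\ (forall x, (0 < g x)%R).

Lemma pos_meas_powR g r : pos_meas g -> pos_meas (fun x => g x `^ r)%R.
Proof.
by move=> [mg g0]; split=> [|x]; [exact: measurable_fun_powR|exact: powR_gt0].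
Qed.

Lemma pos_measM f g : pos_meas f -> pos_meas g -> pos_meas (fun x => f x * g x)%R.
Proof.
move=> [mf f0] [mg g0]; split=> [|x]; last exact: mulr_gt0.
exact: measurable_funM.
Qed.

Lemma mavg_ge0 Q f : (forall x, 0 <= f x) -> 0 <= mavg Q f.
Proof. by move=> f0; apply: mule_ge0; [rewrite inve_ge0|exact: integral_ge0]. Qed.

Lemma le_mavg_ae Q (f g : T -> \bar R) : Qs Q -> measurable_fun Q f -> measurable_fun Q g ->
  (forall x, 0 <= f x) -> (forall x, 0 <= g x) ->
  {ae mu, forall x, Q x -> f x <= g x} -> mavg Q f <= mavg Q g.
Proof.
move=> qQ mf mg f0 g0 fg; apply: lee_wpmul2l; first by rewrite inve_ge0.
by apply: ae_ge0_le_integral => //; exact: measurable_Qs.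
Qed.

Lemma mavg_cst Q (c : R) : Qs Q -> mavg Q (cst c%:E) = c%:E.
Proof.
move=> qQ; have [r r0 E] := mu_Qs qQ; rewrite /mavg integral_cst; last exact: measurable_Qs.
by rewrite E inver gt_eqF// -EFinM mulrCA mulVf ?mulr1// gt_eqF.
Qed.

Lemma mavg_scale Q (c : R) f : Qs Q -> measurable_fun Q f -> (forall x, 0 <= f x) ->
  (0 <= c)%R -> mavg Q (fun x => c%:E * f x) = c%:E * mavg Q f.
Proof.
move=> qQ mf f0 c0; rewrite /mavg ge0_integralZl//; last exact: measurable_Qs.
by rewrite muleCA.
Qed.

Lemma mavg_geom Q (a b : T -> \bar R) (l : R) : Qs Q ->
  measurable_fun Q a -> measurable_fun Q b ->
  (forall x, 0 <= a x) -> (forall x, 0 <= b x) -> (0 <= l <= 1)%R ->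
  mavg Q (fun x => a x `^ l * b x `^ (1 - l)) <= mavg Q a `^ l * mavg Q b `^ (1 - l).
Proof.
move=> qQ ma mb a0 b0 l01; have [r r0 E] := mu_Qs qQ; rewrite /mavg E inver gt_eqF//.
have r1 : 0 <= r^-1%:E by rewrite lee_fin invr_ge0 ltW.
rewrite !poweRM//; [|exact: integral_ge0|exact: integral_ge0].
rewrite muleACA !poweR_EFin -EFinM -powRD; last by rewrite subrKC oner_eq0.
rewrite subrKC powRr1 ?invr_ge0 ?(ltW r0)//; apply: lee_wpmul2l => //.
by apply: hoelder_geom => //; exact: measurable_Qs.
Qed.

Lemma pos_meas_EFin g : pos_meas g -> measurable_fun [set: T] (EFin \o g).
Proof. by move=> [mg _]; exact/measurable_EFinP. Qed.

Lemma pos_meas_ge0 g x : pos_meas g -> 0 <= (EFin \o g) x.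
Proof. by move=> [_ g0]; rewrite lee_fin ltW. Qed.

Lemma meanE Q g : Qs Q -> pos_meas g -> loc_int g ->
  mavg Q (EFin \o g) = (mean Q g)%:E.
Proof.
move=> qQ pg ig; rewrite fineK// ge0_fin_numE; first exact: ig.
by apply: mavg_ge0 => x; exact: pos_meas_ge0.
Qed.

Lemma mavg_gt0 Q g : Qs Q -> pos_meas g -> 0 < mavg Q (EFin \o g).
Proof.
move=> qQ [mg g0]; have [r r0 E] := mu_Qs qQ; rewrite /mavg E inver gt_eqF//.
rewrite mule_gt0 ?lte_fin ?invr_gt0//; apply: integral_gt0 => //.
- exact: measurable_Qs.
- exact: measurable_funTS.
- by rewrite E lte_fin.
Qed.

Lemma mean_gt0 Q g : Qs Q -> pos_meas g -> loc_int g -> (0 < mean Q g)%R.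
Proof. by move=> qQ pg ig; rewrite -lte_fin -meanE//; exact: mavg_gt0. Qed.

Lemma mavg_le_cst Q g (c : R) : Qs Q -> pos_meas g ->
  {ae mu, forall x, Q x -> (g x <= c)%R} -> (0 <= c)%R -> mavg Q (EFin \o g) <= c%:E.
Proof.
move=> qQ pg gc c0; rewrite -(mavg_cst c qQ); apply: le_mavg_ae => //.
- exact: measurable_funTS (pos_meas_EFin pg).
- by move=> x; exact: pos_meas_ge0.
Qed.

Section geometric.
Variables (a b : T -> R) (l : R).
Hypothesis pa : pos_meas a.
Hypothesis pb : pos_meas b.
Hypothesis l01 : (0 <= l <= 1)%R.

Let mavg_geomR Q : Qs Q -> mavg Q (EFin \o (fun x => a x `^ l * b x `^ (1 - l))%R) <=
  mavg Q (EFin \o a) `^ l * mavg Q (EFin \o b) `^ (1 - l).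
Proof.
move=> qQ.
have ma := measurable_funTS (pos_meas_EFin pa) : measurable_fun Q (EFin \o a).
have mb := measurable_funTS (pos_meas_EFin pb) : measurable_fun Q (EFin \o b).
exact: (@mavg_geom Q (EFin \o a) (EFin \o b) l qQ ma mb (fun x => pos_meas_ge0 x pa)
  (fun x => pos_meas_ge0 x pb) l01).
Qed.

Hypothesis ia : loc_int a.
Hypothesis ib : loc_int b.

Lemma loc_int_geom : loc_int (fun x => a x `^ l * b x `^ (1 - l))%R.
Proof.
move=> Q qQ; apply: le_lt_trans (mavg_geomR qQ) _.
by rewrite !meanE// !poweR_EFin -EFinM ltry.
Qed.

Lemma mean_geom Q : Qs Q -> (mean Q (fun x => a x `^ l * b x `^ (1 - l)) <=
  mean Q a `^ l * mean Q b `^ (1 - l))%R.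
Proof.
move=> qQ; have := mavg_geomR qQ; rewrite !meanE//; last exact: loc_int_geom.
by apply: pos_measM; exact: pos_meas_powR.
Qed.

End geometric.

Lemma pos_meas_cst1 : pos_meas (fun=> 1%R).
Proof. by split. Qed.

Lemma mean_cst1 Q : Qs Q -> mean Q (fun=> 1%R) = 1%R.
Proof.
move=> qQ; rewrite /mean (_ : EFin \o _ = cst 1%:E)//.
by rewrite mavg_cst.
Qed.

Lemma loc_int_cst1 : loc_int (fun=> 1%R).
Proof. by move=> Q qQ; rewrite (_ : EFin \o _ = cst 1%:E)// mavg_cst// ltry. Qed.

Section power.
Variables (a : T -> R) (l : R).
Hypothesis pa : pos_meas a.
Hypothesis ia : loc_int a.
Hypothesis l01 : (0 <= l <= 1)%R.

Let E : (fun x => a x `^ l * 1 `^ (1 - l))%R = (fun x => a x `^ l)%R.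
Proof. by apply/funext => x; rewrite powR1 mulr1. Qed.

Lemma loc_int_powR : loc_int (fun x => a x `^ l)%R.
Proof. by have := loc_int_geom pa pos_meas_cst1 l01 ia loc_int_cst1; rewrite E. Qed.

Lemma mean_powR Q : Qs Q -> (mean Q (fun x => a x `^ l) <= mean Q a `^ l)%R.
Proof.
move=> qQ; have := mean_geom pa pos_meas_cst1 l01 ia loc_int_cst1 qQ.
by rewrite E mean_cst1// powR1 mulr1.
Qed.

End power.

(* Hoelder applied to [1 = V^l (V^(-1/r))^(1-l)] with [l = 1/(1+r)]. *)
Lemma mean_dual_ge1 (V : T -> R) (r : R) Q : Qs Q -> pos_meas V -> loc_int V ->
  (0 < r)%R -> loc_int (fun x => V x `^ (- r^-1))%R ->
  (1 <= mean Q V * mean Q (fun x => V x `^ (- r^-1)) `^ r)%R.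
Proof.
move=> qQ pV iV r0 iVr.
have pVr : pos_meas (fun x => V x `^ (- r^-1))%R by exact: pos_meas_powR.
have r1 : (0 < 1 + r)%R by lra.
pose l := (1 + r)^-1%R.
have l01 : (0 <= l <= 1)%R by rewrite invr_ge0 (ltW r1) invf_le1// lerDl ltW.
have := mean_geom pV pVr l01 iV iVr qQ.
rewrite (_ : (fun x => _) = fun=> 1%R); last first.
  apply/funext => x; rewrite -powRrM -powRD; last by rewrite (gt_eqF (pV.2 x)) implybT.
  rewrite (_ : (l + _)%R = 0%R) ?powRr0// /l; field.
  by rewrite !gt_eqF.
rewrite mean_cst1//.
have m1 := mean_gt0 qQ pV iV; have m2 := mean_gt0 qQ pVr iVr.
have lr : (0 <= 1 + r)%R by exact: ltW.
rewrite /l; move: (mean Q (fun x => _ `^ _)%R) m2 => B B0.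
move: (mean Q V) m1 => A A0.
have AB0 : (0 <= A `^ (1 + r)^-1 * B `^ (1 - (1 + r)^-1))%R.
  by rewrite mulr_ge0 ?powR_ge0.
move/(ge0_ler_powR lr); rewrite !nnegrE => /(_ ler01 AB0).
rewrite powR1 (powRM _ (powR_ge0 _ _) (powR_ge0 _ _)) powRVK ?(ltW A0)// -powRrM.
by rewrite (_ : (1 - (1 + r)^-1) * (1 + r) = r)%R//; field; rewrite gt_eqF.
Qed.

End means.

Lemma powR_geom (R : realType) (A B t l : R) :
  ((A `^ t) `^ l * (B `^ t) `^ (1 - l) = (A `^ l * B `^ (1 - l)) `^ t)%R.
Proof.
by rewrite (powRM _ (powR_ge0 _ _) (powR_ge0 _ _)) -!powRrM ![(t * _)%R]mulrC.
Qed.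

Lemma poweR_geom (R : realType) (A B t l : R) :
  (A `^ t)%:E `^ l * (B `^ t)%:E `^ (1 - l) = ((A `^ l * B `^ (1 - l)) `^ t)%:E.
Proof. by rewrite -powR_geom EFinM. Qed.

(** * Off-diagonal weights *)

Section off_diagonal.
Context d (T : measurableType d) (R : realType).
Variable mu : {measure set T -> \bar R}.
Variable Qs : set (set T).
Hypothesis measurable_Qs : forall Q, Qs Q -> measurable Q.
Hypothesis mu_Qs : forall Q, Qs Q -> exists2 r : R, (0 < r)%R & mu Q = r%:E.
Local Notation mean := (mean mu).
Local Notation loc_int := (loc_int mu Qs).

Definition A1 (H : T -> R) (c : R) := forall Q, Qs Q ->
  {ae mu, forall x, Q x -> (mean Q H <= c * H x)%R}.

(** The root is removed and the average on the left stays extended, so that the condition contains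
    the local integrability of [U ^ t]. *)
Definition RH (U : T -> R) (t C : R) := forall Q, Qs Q ->
  mavg mu Q (fun x => (U x `^ t)%:E) <= ((C * mean Q U) `^ t)%:E.

Variables (x y xq yq : R).
Hypothesis x0 : (0 < x)%R.
Hypothesis y0 : (0 < y)%R.
Hypothesis yq0 : (0 < yq)%R.
Hypothesis xxq : (x < xq)%R.
Hypothesis sumq : (xq + yq = x + y)%R.

Variables (W H : T -> R) (c K : R).
Let sg := (fun z => W z `^ (- (y / x)))%R.
Hypothesis pW : pos_meas W.
Hypothesis pH : pos_meas H.
Hypothesis iW : loc_int W.
Hypothesis is_ : loc_int sg.
Hypothesis iH : loc_int H.
Hypothesis c0 : (0 < c)%R.
Hypothesis K0 : (0 < K)%R.
Hypothesis HA1 : A1 H c.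
Hypothesis WK : forall Q, Qs Q -> (mean Q W * mean Q sg `^ (x / y) <= K)%R.

(** If [W = w ^ (1/y)] and [v = w * G ^ (x - xq)] with [G = H ^ ((x + y) / y) * W], then
    [v ^ (1/yq)] is [U] and [v ^ (-1/xq)] is [V]. Thus [a] is the power of [H] by which [W] is
    divided, and [l] the proportion in which [V] interpolates between [sg] and [H]. *)
Let a := ((x + y) * (yq^-1 - y^-1))%R.
Let l := (x * yq / (y * xq))%R.
Let U := (fun z => W z * H z `^ (- a))%R.
Let V := (fun z => sg z `^ l * H z `^ (1 - l))%R.

Let xq0 : (0 < xq)%R. Proof. exact: lt_trans xxq. Qed.

Let yqy : (yq < y)%R. Proof. by move: sumq xxq; lra. Qed.

Let a0 : (0 < a)%R.
Proof.
by apply: mulr_gt0; [exact: addr_gt0|rewrite subr_gt0 ltf_pV2].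
Qed.

Let l01 : (0 <= l <= 1)%R.
Proof.
apply/andP; split; first by rewrite divr_ge0// mulr_ge0// ltW.
rewrite ler_pdivrMr ?mulr_gt0// mul1r [(y * _)%R]mulrC.
by apply: ler_pM; exact: ltW.
Qed.

Let al : (a * (yq / xq) = 1 - l)%R.
Proof.
have xqE : (xq = x + y - yq)%R by rewrite -sumq addrK.
have := xq0; rewrite /a /l xqE => xq0'; field.
by rewrite !gt_eqF.
Qed.

Let lxy : (l * (xq / yq) = x / y)%R.
Proof. by rewrite /l; field; rewrite !gt_eqF. Qed.

Let la : ((1 - l) * (xq / yq) = a)%R.
Proof. by rewrite -al; field; rewrite !gt_eqF. Qed.

Let psg : pos_meas sg. Proof. exact: pos_meas_powR. Qed.
Let pU : pos_meas U. Proof. exact: pos_measM pW (pos_meas_powR _ pH). Qed.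
Let pV : pos_meas V.
Proof. exact: pos_measM (pos_meas_powR _ psg) (pos_meas_powR _ pH). Qed.

Let VU : V = (fun z => U z `^ (- (yq / xq)))%R.
Proof.
apply/funext => z; have w0 := pW.2 z; have h0 := pH.2 z.
rewrite /U powRM ?powR_ge0 ?(ltW w0)// -powRrM mulrNN al /V /sg -powRrM.
congr (_ `^ _ * _)%R; rewrite /l; field.
by rewrite !gt_eqF.
Qed.

Let UV : U = (fun z => V z `^ (- (xq / yq)))%R.
Proof.
apply/funext => z; rewrite VU -powRrM mulrNN (_ : (_ * _)%R = 1%R).
  by rewrite powRr1// ltW// pU.2.
by field; rewrite !gt_eqF.
Qed.

Let h Q := mean Q H.
Let h0 Q : Qs Q -> (0 < h Q)%R. Proof. by move=> qQ; exact: mean_gt0 pH iH. Qed.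
Let W0 Q : Qs Q -> (0 < mean Q W)%R.
Proof. by move=> qQ; exact: mean_gt0 pW iW. Qed.
Let s0 Q : Qs Q -> (0 < mean Q sg)%R.
Proof. by move=> qQ; exact: mean_gt0 psg is_. Qed.

(** On a cube, the A_1 condition bounds negative powers of [H] by the same power of its mean, up to
    a constant; this is how [H ^ (- a)] leaves the averages below. *)
Let H_inv Q (b : R) : Qs Q -> (0 <= b)%R ->
  {ae mu, forall x, Q x -> (H x `^ (- b) <= (c / h Q) `^ b)%R}.
Proof.
move=> qQ b0; apply: filterS (HA1 qQ) => z /[apply] Hz.
have Hz0 := pH.2 z; have hq := h0 qQ.
rewrite powRN -powRVinv ?(ltW Hz0)//; apply: ge0_ler_powR => //.
- by rewrite nnegrE invr_ge0 ltW.
- by rewrite nnegrE divr_ge0// ltW.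
- by rewrite ler_pdivlMr// ler_pdivrMl// mulrC.
Qed.

Lemma mavg_UpowR Q (t : R) : Qs Q -> (0 < t)%R ->
  mavg mu Q (fun x => (U x `^ t)%:E) <=
  (((c / h Q) `^ a) `^ t)%:E * mavg mu Q (fun x => (W x `^ t)%:E).
Proof.
move=> qQ t0.
have pWt : pos_meas (fun x => W x `^ t)%R by exact: pos_meas_powR.
have mWt := measurable_funTS (pos_meas_EFin pWt) : measurable_fun Q _.
have Wt0 z : 0 <= (W z `^ t)%:E by rewrite lee_fin powR_ge0.
rewrite -(mavg_scale mu measurable_Qs qQ mWt Wt0 (powR_ge0 _ _)).
apply: (le_mavg_ae measurable_Qs) => //.
- exact: measurable_funTS (pos_meas_EFin (pos_meas_powR t pU)).
- exact: emeasurable_funM.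
- by move=> z; rewrite lee_fin powR_ge0.
- by move=> z; rewrite mule_ge0// lee_fin powR_ge0.
apply: filterS (H_inv qQ (ltW a0)) => z /[apply] Hz.
rewrite -EFinM lee_fin /U powRM ?powR_ge0 ?(ltW (pW.2 z))// mulrC.
apply: ler_wpM2r; first exact: powR_ge0.
by apply: ge0_ler_powR; rewrite ?nnegrE ?powR_ge0 ?(ltW t0).
Qed.

Let mavgU Q : Qs Q -> mavg mu Q (EFin \o U) <= ((c / h Q) `^ a * mean Q W)%:E.
Proof.
move=> qQ; have := mavg_UpowR qQ ltr01; rewrite EFinM -(meanE qQ pW iW).
rewrite powRr1 ?powR_ge0//.
have E (g : T -> R) : pos_meas g -> mavg mu Q (fun x => (g x `^ 1)%:E) = mavg mu Q (EFin \o g).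
  move=> pg; congr (_ * _); apply: eq_integral => z _ /=.
  by rewrite powRr1// ltW// pg.2.
by rewrite !E.
Qed.

Lemma loc_int_U : loc_int U.
Proof. by move=> Q qQ; apply: le_lt_trans (mavgU qQ) _; rewrite ltry. Qed.

Lemma mean_U Q : Qs Q -> (mean Q U <= (c / h Q) `^ a * mean Q W)%R.
Proof. by move=> qQ; have := mavgU qQ; rewrite (meanE qQ pU loc_int_U). Qed.

Lemma loc_int_V : loc_int V.
Proof. exact: (loc_int_geom measurable_Qs mu_Qs). Qed.

Lemma mean_V Q : Qs Q -> (mean Q V <= mean Q sg `^ l * h Q `^ (1 - l))%R.
Proof. by move=> qQ; exact: (mean_geom measurable_Qs mu_Qs). Qed.

Let U0 Q : Qs Q -> (0 < mean Q U)%R.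
Proof. by move=> qQ; exact: mean_gt0 pU loc_int_U. Qed.
Let V0 Q : Qs Q -> (0 < mean Q V)%R.
Proof. by move=> qQ; exact: mean_gt0 pV loc_int_V. Qed.

Let xqyq : (0 < xq / yq)%R. Proof. exact: divr_gt0. Qed.
Let yqxq : (0 < yq / xq)%R. Proof. exact: divr_gt0. Qed.

Let mean_V_pow Q : Qs Q ->
  (mean Q V `^ (xq / yq) <= mean Q sg `^ (x / y) * h Q `^ a)%R.
Proof.
move=> qQ; rewrite -lxy -la (powRrM _ l) (powRrM _ (1 - l)).
rewrite -powRM ?powR_ge0//; apply: ge0_ler_powR; rewrite ?nnegrE.
- exact: ltW.
- exact/ltW/V0.
- by rewrite mulr_ge0 ?powR_ge0.
- exact: mean_V.
Qed.

Let ch Q : Qs Q -> ((c / h Q) `^ a * h Q `^ a = c `^ a)%R.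
Proof.
move=> qQ; have hq := h0 qQ.
rewrite -powRM ?divr_ge0 ?(ltW hq) ?(ltW c0)//.
by rewrite mulfVK// gt_eqF.
Qed.

(** The mean of [U] gains [(c / h) ^ a] and that of [V], raised to [xq / yq], gains [h ^ a], where
    [h] is the mean of [H]; the powers of [h] cancel. *)
Lemma mean_UV Q : Qs Q -> (mean Q U * mean Q V `^ (xq / yq) <= K * c `^ a)%R.
Proof.
move=> qQ.
apply: (@le_trans _ _ (((c / h Q) `^ a * mean Q W) *
    (mean Q sg `^ (x / y) * h Q `^ a)))%R.
  apply: ler_pM; [exact/ltW/U0|exact: powR_ge0|exact: mean_U|exact: mean_V_pow].
rewrite -(ch qQ).
have hh0 := mulr_ge0 (powR_ge0 (c / h Q) a) (powR_ge0 (h Q) a).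
apply: le_trans (ler_wpM2r hh0 (WK qQ)).
move: (mean Q W) (mean Q sg `^ _)%R (h Q `^ a)%R ((c / h Q) `^ a)%R => A B C D.
by rewrite le_eqVlt; apply/orP; left; apply/eqP; ring.
Qed.

(** An upper bound for [H ^ (- a)] passes from [U] to [W]. Returning to [U] needs a lower bound for
    its mean: the trivial inequality [mean_dual_ge1] between [U] and its dual [V], combined with the
    condition on [W]. *)
Lemma RH_U t C : (1 <= t)%R -> (0 <= C)%R -> RH W t C -> RH U t (C * c `^ a * K)%R.
Proof.
move=> t1 C0 hW Q qQ.
have t0 : (0 < t)%R by lra.
apply: le_trans (mavg_UpowR qQ t0) _.
have c1 : 0 <= (((c / h Q) `^ a) `^ t)%:E by rewrite lee_fin powR_ge0.
apply: le_trans (lee_wpmul2l c1 (hW Q qQ)) _.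
have mw := W0 qQ; have hq := h0 qQ; have uq := U0 qQ.
rewrite -EFinM lee_fin -powRM ?powR_ge0 ?mulr_ge0 ?(ltW mw)//.
apply: ge0_ler_powR; rewrite ?nnegrE ?(ltW t0) ?mulr_ge0 ?powR_ge0 ?(ltW mw) ?(ltW K0) ?(ltW uq)//.
have D1 : (1 <= mean Q U * (mean Q sg `^ (x / y) * h Q `^ a))%R.
  have := mean_dual_ge1 measurable_Qs mu_Qs qQ pU loc_int_U xqyq.
  rewrite invf_div -VU => /(_ loc_int_V)/le_trans; apply.
  by apply: ler_wpM2l; [exact: ltW|exact: mean_V_pow].
rewrite mulrCA -!mulrA; apply: ler_wpM2l => //.
rewrite -(ch qQ) -[leRHS]mulrA; apply: ler_wpM2l; first exact: powR_ge0.
apply: (@le_trans _ _ (mean Q W * (mean Q U * (mean Q sg `^ (x / y) * h Q `^ a))))%R.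
  by rewrite ler_peMr// ltW.
rewrite (_ : (_ * _)%R = (mean Q W * mean Q sg `^ (x / y) * (h Q `^ a * mean Q U))%R).
  rewrite [leRHS]mulrCA; apply: ler_wpM2r; last exact: WK.
  by rewrite mulr_ge0 ?powR_ge0// ltW.
by move: (mean Q W) (mean Q U) (_ `^ _)%R (h Q `^ a)%R => A B C1 D; ring.
Qed.

(** Hoelder's inequality combines the reverse Hoelder conditions of [sg] and [H] at one common
    exponent [t]. The lower bound for the mean of [V] is again duality, through [mean_U]. *)
Lemma RH_V t C C' : (1 <= t)%R -> (0 <= C)%R -> (0 <= C')%R -> RH sg t C -> RH H t C' ->
  RH V t (C `^ l * C' `^ (1 - l) * (K `^ (yq / xq) * c `^ (1 - l)))%R.
Proof.
move=> t1 C0 C'0 hs hH Q qQ.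
have t0 : (0 < t)%R by lra.
have mw := W0 qQ; have hq := h0 qQ; have vq := V0 qQ; have sq := s0 qQ.
have uq := U0 qQ.
have -> : (fun x => (V x `^ t)%:E) =
    (fun x => (sg x `^ t)%:E `^ l * (H x `^ t)%:E `^ (1 - l)).
  apply/funext => z; rewrite /V (powRM _ (powR_ge0 _ _) (powR_ge0 _ _)).
  by rewrite !poweR_EFin -EFinM -!powRrM ![(t * _)%R]mulrC.
have mst := measurable_funTS (pos_meas_EFin (pos_meas_powR t psg)) : measurable_fun Q _.
have mht := measurable_funTS (pos_meas_EFin (pos_meas_powR t pH)) : measurable_fun Q _.
have st0 z : 0 <= (sg z `^ t)%:E by rewrite lee_fin powR_ge0.
have ht0 z : 0 <= (H z `^ t)%:E by rewrite lee_fin powR_ge0.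
have l0 : (0 <= l)%R by have /andP[] := l01.
have l1 : (0 <= 1 - l)%R by have /andP[_] := l01; rewrite subr_ge0.
apply: le_trans (mavg_geom measurable_Qs mu_Qs qQ mst mht st0 ht0 l01) _.
apply: (@le_trans _ _ (((C * mean Q sg) `^ t)%:E `^ l * ((C' * h Q) `^ t)%:E `^ (1 - l))).
  apply: lee_pmul; rewrite ?poweR_ge0//.
  - by apply: le_poweR => //; [exact: mavg_ge0|exact: hs].
  - by apply: le_poweR => //; [exact: mavg_ge0|exact: hH].
rewrite (poweR_geom (C * mean Q sg) (C' * h Q) t l) lee_fin.
apply: ge0_ler_powR; rewrite ?nnegrE ?(ltW t0) ?mulr_ge0 ?powR_ge0 ?(ltW vq)//.
have D1 : (1 <= mean Q V * (K `^ (yq / xq) * mean Q sg `^ (- l) * (c / h Q) `^ (1 - l)))%R.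
  have := mean_dual_ge1 measurable_Qs mu_Qs qQ pV loc_int_V yqxq.
  rewrite invf_div -UV => /(_ loc_int_U)/le_trans; apply.
  rewrite (ler_pM2l vq).
  apply: (@le_trans _ _ ((K * mean Q sg `^ (- (x / y)) * (c / h Q) `^ a) `^ (yq / xq)))%R.
    have kk : (0 <= K * mean Q sg `^ (- (x / y)) * (c / h Q) `^ a)%R.
      by rewrite !mulr_ge0 ?powR_ge0// ltW.
    apply: (ge0_ler_powR (ltW yqxq) (ltW uq) kk).
    apply: le_trans (mean_U qQ) _; rewrite mulrC; apply: ler_wpM2r; first exact: powR_ge0.
    by rewrite powRN ler_pdivlMr ?powR_gt0//; exact: WK.
  have k1 := mulr_ge0 (ltW K0) (powR_ge0 (mean Q sg) (- (x / y))).
  rewrite (powRM _ k1 (powR_ge0 _ _)) (powRM _ (ltW K0) (powR_ge0 _ _)).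
  rewrite -(powRrM (mean Q sg)) -(powRrM (c / h Q)) al.
  rewrite (_ : - (x / y) * (yq / xq) = - l)%R; first exact: lexx.
  by rewrite -lxy; field; rewrite !gt_eqF.
rewrite (powRM _ C0 (ltW sq)) (powRM _ C'0 (ltW hq)) mulrACA -!mulrA.
apply: (ler_wpM2l (powR_ge0 _ _)); apply: (ler_wpM2l (powR_ge0 _ _)).
have sl : (0 < mean Q sg `^ l)%R by exact: powR_gt0.
have hl : (0 < h Q `^ (1 - l))%R by exact: powR_gt0.
have := ler_wpM2r (ltW (mulr_gt0 sl hl)) D1; rewrite mul1r => /le_trans; apply.
have hi : (0 <= (h Q)^-1)%R by rewrite invr_ge0 ltW.
rewrite (powRN (mean Q sg)) (powRM _ (ltW c0) hi) (powRVinv _ (ltW hq)).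
move: (mean Q sg `^ l)%R (h Q `^ (1 - l))%R sl hl => A B A0 B0.
move: (mean Q V) (K `^ _)%R (c `^ _)%R => v k e.
by rewrite le_eqVlt; apply/orP; left; apply/eqP; field; rewrite !gt_eqF.
Qed.

Lemma dual_V : V = (fun z => U z `^ (- (yq / xq)))%R.
Proof. exact: VU. Qed.

End off_diagonal.

(** * Almost everywhere arguments *)

Section ae_lemmas.
Context d (T : measurableType d) (R : realType).
Variable mu : {measure set T -> \bar R}.

Lemma ae_exists (D : set T) (P : T -> Prop) : measurable D -> 0 < mu D ->
  {ae mu, forall x, P x} -> exists2 x, D x & P x.
Proof.
move=> mD muD [N [mN N0 PN]]; apply: contrapT => H.
have : mu D <= mu N.
  by apply: le_measure; rewrite ?inE// => x Dx; apply: PN => Px; apply: H; exists x.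
by rewrite N0 leNgt muD.
Qed.

Lemma integral_fin_ae (f : T -> \bar R) : measurable_fun [set: T] f ->
  (forall x, 0 <= f x) -> \int[mu]_x f x < +oo -> {ae mu, forall x, f x < +oo}.
Proof.
move=> mf f0 If; have : mu.-integrable [set: T] f.
  apply/integrableP; split => //.
  by under eq_integral do rewrite gee0_abs//.
move/(integrable_ae measurableT); apply: filterS => x /(_ I).
by rewrite ge0_fin_numE.
Qed.

Lemma integral_eq0_ae (D : set T) (f : T -> \bar R) : measurable D ->
  measurable_fun D f -> (forall x, 0 <= f x) -> \int[mu]_(x in D) f x = 0 ->
  {ae mu, forall x, D x -> f x = 0}.
Proof.
move=> mD mf f0 If; have : \int[mu]_(x in D) `|f x| = 0.
  by rewrite -If; apply: eq_integral => x _; rewrite gee0_abs.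
by move/(ae_eq_integral_abs mu mD mf).
Qed.

Lemma integral_ae0 (D : set T) (f : T -> \bar R) : measurable D ->
  measurable_fun D f -> (forall x, 0 <= f x) ->
  {ae mu, forall x, D x -> f x = 0} -> \int[mu]_(x in D) f x = 0.
Proof.
move=> mD mf f0 fae; rewrite (@ge0_ae_eq_integral _ _ _ mu D f (cst 0))//.
by rewrite integral0.
Qed.

Lemma integral_powR_gt0 (f : T -> \bar R) (W : T -> R) (p : R) :
  measurable_fun [set: T] f -> (forall x, 0 <= f x) ->
  measurable_fun [set: T] W -> (forall x, (0 < W x)%R) -> (0 < p)%R ->
  0 < \int[mu]_x (f x `^ p * (W x)%:E) -> 0 < \int[mu]_x f x.
Proof.
move=> mf f0 mW W0 p0 If; rewrite lt0e integral_ge0 ?andbT//; apply/eqP => I0.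
have := integral_eq0_ae measurableT mf f0 I0 => fae.
move: If; rewrite integral_ae0 ?ltxx//.
- by apply: emeasurable_funM; [exact: measurable_fun_poweR|exact/measurable_EFinP].
- by move=> x; apply: mule_ge0; [exact: poweR_ge0|rewrite lee_fin ltW].
- by apply: filterS fae => x /(_ I) -> _; rewrite poweR0r ?mul0e// gt_eqF.
Qed.

(** A finite integral makes [He] finite almost everywhere; the value 1 is used where it is infinite,
    which keeps positivity everywhere. *)
Lemma ae_real (He : T -> \bar R) (W : T -> R) (p : R) :
  measurable_fun [set: T] He -> (forall x, 0 < He x) ->
  measurable_fun [set: T] W -> (forall x, (0 < W x)%R) -> (0 < p)%R ->
  \int[mu]_x (He x `^ p * (W x)%:E) < +oo ->
  exists2 H : T -> R, pos_meas H & {ae mu, forall x, (H x)%:E = He x}.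
Proof.
move=> mHe He0 mW W0 p0 fin.
exists (fun x => fine (if He x == +oo then 1 else He x)).
  split; last first.
    move=> x; have := He0 x; case: (He x) => [r| |]//=.
  apply: (measurableT_comp (fine_measurable _ )); first exact: measurableT.
  have -> : (fun x => if He x == +oo then 1 else He x) =
      (fun x => if (fun x => He x == +oo) x then cst 1 x else He x) by [].
  apply: measurable_fun_ifT => //.
  apply: (measurable_fun_bool true).
  rewrite setTI (_ : _ @^-1` _ = He @^-1` [set +oo]); last first.
    by apply/seteqP; split => x /= /eqP.
  by rewrite -[X in measurable X]setTI; apply: mHe => //; exact: emeasurable_set1.
have mHp : measurable_fun [set: T] (fun x => He x `^ p * (W x)%:E).
  by apply: emeasurable_funM; [exact: measurable_fun_poweR|exact/measurable_EFinP].
have Hp0 x : 0 <= He x `^ p * (W x)%:E.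
  by apply: mule_ge0; [exact: poweR_ge0|rewrite lee_fin ltW].
apply: filterS (integral_fin_ae mHp Hp0 fin) => x.
have := He0 x; case: (He x) => [r| |]//=.
by move=> _; rewrite gt_eqF// gt0_mulye ?lte_fin// ltxx.
Qed.

End ae_lemmas.

(** * A_1 weights from the algorithm *)

Section rdf_A1.
Context d (T : measurableType d) (R : realType).
Variable mu : {measure set T -> \bar R}.
Variable Qs : set (set T).
Hypothesis measurable_Qs : forall Q, Qs Q -> measurable Q.
Hypothesis mu_Qs : forall Q, Qs Q -> exists2 r : R, (0 < r)%R & mu Q = r%:E.
Variable M : (T -> \bar R) -> T -> \bar R.
Hypothesis M_ge0 : forall f x, (forall x, 0 <= f x) -> 0 <= M f x.
Hypothesis measurable_M : forall f, (forall x, 0 <= f x) ->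
  measurable_fun [set: T] (M f).
Hypothesis M_series : forall (f : nat -> T -> \bar R) x,
  (forall k, measurable_fun [set: T] (f k)) -> (forall k x, 0 <= f k x) ->
  M (fun x => \sum_(k <oo) f k x) x <= \sum_(k <oo) M (f k) x.
Hypothesis M_scale : forall (c : R) f x, (0 <= c)%R ->
  measurable_fun [set: T] f -> (forall x, 0 <= f x) ->
  M (fun x => c%:E * f x) x <= c%:E * M f x.
Hypothesis M_gt0 : forall f x, measurable_fun [set: T] f -> (forall x, 0 <= f x) ->
  0 < \int[mu]_x f x -> 0 < M f x.
Variable k : R.
Hypothesis k0 : (0 < k)%R.
Hypothesis M_avg : forall Q f x, Qs Q -> Q x -> measurable_fun [set: T] f ->
  (forall x, 0 <= f x) -> mavg mu Q f <= k%:E * M f x.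
Variables (W : T -> R) (p N : R).
Hypothesis pW : pos_meas W.
Hypothesis p1 : (1 <= p)%R.
Hypothesis N0 : (0 < N)%R.
Hypothesis M_bound : forall f, measurable_fun [set: T] f -> (forall x, 0 <= f x) ->
  \int[mu]_x (M f x `^ p * (W x)%:E) <=
  (N `^ p)%:E * \int[mu]_x (f x `^ p * (W x)%:E).

Lemma rdf_A1 (h : T -> \bar R) : measurable_fun [set: T] h -> (forall x, 0 <= h x) ->
  0 < \int[mu]_x (h x `^ p * (W x)%:E) < +oo ->
  exists H : T -> R, [/\ pos_meas H, loc_int mu Qs H,
    {ae mu, forall x, h x <= (H x)%:E},
    A1 mu Qs H (k * (2 * N))%R &
    \int[mu]_x ((H x)%:E `^ p * (W x)%:E) <=
    (2 `^ p)%:E * \int[mu]_x (h x `^ p * (W x)%:E)].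
Proof.
move=> mh h0 /andP[h1 h2]; have p0 : (0 < p)%R by exact: lt_le_trans p1.
have [mW W0] := pW.
have [He [mHe hHe MHe Mh IHe]] :=
  rdf M_ge0 measurable_M M_series M_scale mW W0 p1 N0 M_bound mh h0.
have N2 : (0 < 2 * N)%R by rewrite mulr_gt0.
(* As [h] has a positive integral, [M h > 0] everywhere, and [M h <= 2 * N * He] passes this on to
   [He]. *)
have He0 x : 0 < He x.
  have := M_gt0 x mh h0 (integral_powR_gt0 mh h0 mW W0 p0 h1).
  move=> /lt_le_trans/(_ (Mh x)); rewrite lt0e => /andP[Hx0 _].
  rewrite lt0e (le_trans (h0 x) (hHe x)) andbT.
  by apply: contra Hx0 => /eqP ->; rewrite mule0.
have He0' x : 0 <= He x by exact: ltW.
have fin : \int[mu]_x (He x `^ p * (W x)%:E) < +oo.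
  by apply: le_lt_trans IHe _; apply: lte_mul_pinfty; rewrite ?lee_fin ?powR_ge0.
have [H pH HE] := ae_real mHe He0 mW W0 p0 fin.
exists H.
have avgE Q : Qs Q -> mavg mu Q (EFin \o H) = mavg mu Q He.
  move=> qQ; congr (_ * _); apply: ge0_ae_eq_integral => //.
  - exact: measurable_Qs.
  - exact: measurable_funTS (pos_meas_EFin pH).
  - exact: measurable_funTS.
  - by move=> x _; exact: pos_meas_ge0.
  - by apply: filterS HE => x /= ->.
(* The average over [Q] is at most [k * M He x <= k * (2 * N) * He x], whence the A_1 constant. A
   single point where [H] and [He] agree already gives local integrability. *)
have avgle Q : Qs Q -> {ae mu, forall x, Q x ->
    mavg mu Q (EFin \o H) <= (k * (2 * N) * H x)%:E}.
  move=> qQ; apply: filterS HE => x HxE Qx; rewrite avgE//.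
  apply: le_trans (M_avg qQ Qx mHe He0') _.
  rewrite -mulrA EFinM; apply: lee_wpmul2l; first by rewrite lee_fin ltW.
  by rewrite EFinM HxE; exact: MHe.
have iH : loc_int mu Qs H.
  move=> Q qQ; have [r r0 E] := mu_Qs qQ.
  have muQ : 0 < mu Q by rewrite E lte_fin.
  have [x Qx /(_ Qx) Hx] := ae_exists (measurable_Qs qQ) muQ (avgle Q qQ).
  by apply: le_lt_trans Hx _; rewrite ltry.
split => //.
- by apply: filterS HE => x ->; exact: hHe.
- move=> Q qQ; apply: filterS (avgle Q qQ) => x /[apply].
  by rewrite (meanE qQ pH iH) lee_fin.
- rewrite (@ge0_ae_eq_integral _ _ _ mu _ _ (fun x => He x `^ p * (W x)%:E))//.
  + apply: emeasurable_funM; last exact/measurable_EFinP.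
    exact/measurable_fun_poweR/pos_meas_EFin.
  + by apply: emeasurable_funM; [exact: measurable_fun_poweR|exact/measurable_EFinP].
  + by move=> x _; apply: mule_ge0; [exact: poweR_ge0|rewrite lee_fin ltW].
  + by move=> x _; apply: mule_ge0; [exact: poweR_ge0|rewrite lee_fin ltW].
  + by apply: filterS HE => x Hx _; rewrite Hx.
Qed.

End rdf_A1.

(** * Reverse Hoelder exponents close to 1 *)

Section rh_mono.
Context d (T : measurableType d) (R : realType).
Variable mu : {measure set T -> \bar R}.
Variable Qs : set (set T).
Hypothesis measurable_Qs : forall Q, Qs Q -> measurable Q.
Hypothesis mu_Qs : forall Q, Qs Q -> exists2 r : R, (0 < r)%R & mu Q = r%:E.

Lemma RH_le (U : T -> R) (t t' C : R) : pos_meas U -> loc_int mu Qs U ->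
  (0 < t')%R -> (t' <= t)%R -> (0 <= C)%R -> RH mu Qs U t C -> RH mu Qs U t' C.
Proof.
move=> pU iU t'0 tt' C0 rU Q qQ.
have t0 : (0 < t)%R by exact: lt_le_trans tt'.
pose Ut := (fun x => U x `^ t)%R.
have pUt : pos_meas Ut by exact: pos_meas_powR.
have iUt : loc_int mu Qs Ut.
  by move=> P qP; apply: le_lt_trans (rU P qP) _; rewrite ltry.
have l01 : (0 <= t' / t <= 1)%R.
  by rewrite divr_ge0 ?(ltW t0) ?(ltW t'0)//= ler_pdivrMr// mul1r.
have UE : (fun x => (U x `^ t')%:E) = EFin \o (fun x => Ut x `^ (t' / t))%R.
  by apply/funext => x /=; rewrite /Ut -powRrM mulrCA divff ?mulr1// gt_eqF.
have pUt' : pos_meas (fun x => Ut x `^ (t' / t))%R by exact: pos_meas_powR.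
have iUt' := loc_int_powR measurable_Qs mu_Qs pUt iUt l01.
rewrite UE (meanE qQ pUt' iUt') lee_fin.
apply: le_trans (mean_powR measurable_Qs mu_Qs pUt iUt l01 qQ) _.
have mU := mean_gt0 measurable_Qs mu_Qs qQ pU iU.
have -> : ((C * mean mu Q U) `^ t' = ((C * mean mu Q U) `^ t) `^ (t' / t))%R.
  by rewrite -powRrM mulrCA divff ?mulr1// gt_eqF.
apply: ge0_ler_powR; rewrite ?nnegrE ?powR_ge0//.
- by have /andP[] := l01.
- by apply: ltW; exact: mean_gt0 pUt iUt.
- by rewrite -lee_fin -(meanE qQ pUt iUt); exact: rU.
Qed.

End rh_mono.

Lemma le_powR (R : realType) (r a b : R) : (0 <= r)%R -> (0 <= a)%R -> (a <= b)%R ->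
  (a `^ r <= b `^ r)%R.
Proof.
move=> r0 a0 ab; apply: ge0_ler_powR; rewrite ?nnegrE//; exact: le_trans ab.
Qed.

Lemma powR_ge1 (R : realType) (a b : R) : (1 <= a)%R -> (0 <= b)%R -> (1 <= a `^ b)%R.
Proof.
move=> a1 b0; apply: le_trans (le_powR b0 ler01 a1).
by rewrite powR1.
Qed.

Lemma ex_small_exponent (R : realType) (X b : R) : (1 <= X)%R -> (0 < b)%R ->
  exists2 e : R, (0 < e <= b)%R & (X `^ e <= 2)%R.
Proof.
move=> X1 b0; have X0 : (0 <= X)%R by lra.
pose N := (Num.truncn X).+1.
have XN : (X <= 2 ^+ N)%R.
  apply: ltW; apply: lt_trans (truncnS_gt X) _.
  by rewrite -natrX ltr_nat ltn_expl.
have N0 : (0 < N%:R^-1 :> R)%R by rewrite invr_gt0 ltr0n.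
exists (Num.min b N%:R^-1)%R.
  by rewrite lt_min b0 N0/= ge_min lexx.
apply: (@le_trans _ _ (X `^ N%:R^-1))%R.
  by apply: ler_powR => //; rewrite ge_min lexx orbT.
apply: (@le_trans _ _ ((2 ^+ N) `^ N%:R^-1))%R.
  by apply: ge0_ler_powR; rewrite ?nnegrE ?exprn_ge0 ?(ltW N0).
by rewrite -powR_mulrn// powRK.
Qed.

Section reverse_hoelder_interpolation.
Context d (T : measurableType d) (R : realType).
Variable mu : {measure set T -> \bar R}.
Variable Qs : set (set T).
Hypothesis measurable_Qs : forall Q, Qs Q -> measurable Q.
Hypothesis mu_Qs : forall Q, Qs Q -> exists2 r : R, (0 < r)%R & mu Q = r%:E.

(** Interpolation between the exponents 1 and [t0] with [l = e / (t0 - 1)] gives the factor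
    [C ^ (t0 * l)], which tends to 1 with [e]. Close enough to the exponent 1 the constant 2 thus
    suffices whatever [C] is, which keeps later constants independent of the weight. *)
Lemma RH_interpolate (U : T -> R) (t0 C e : R) : pos_meas U -> loc_int mu Qs U ->
  (1 < t0)%R -> (1 <= C)%R -> RH mu Qs U t0 C -> (0 <= e <= t0 - 1)%R ->
  ((C `^ (t0 / (t0 - 1))) `^ e <= 2)%R -> RH mu Qs U (1 + e) 2.
Proof.
move=> pU iU t01 C1 rU /andP[e0 et0] Ce Q qQ.
have t0' : (0 < t0 - 1)%R by rewrite subr_gt0.
pose l := (e / (t0 - 1))%R.
have l01 : (0 <= l <= 1)%R by rewrite divr_ge0 ?(ltW t0')//= ler_pdivrMr// mul1r.
have pUt : pos_meas (fun x => U x `^ t0)%R by exact: pos_meas_powR.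
have iUt : loc_int mu Qs (fun x => U x `^ t0)%R.
  by move=> P qP; apply: le_lt_trans (rU P qP) _; rewrite ltry.
have UE : (fun x => (U x `^ (1 + e))%:E) =
    EFin \o (fun x => (U x `^ t0) `^ l * U x `^ (1 - l))%R.
  apply/funext => x /=; congr EFin.
  rewrite -powRrM -powRD; last by rewrite (gt_eqF (pU.2 x)) implybT.
  by congr (_ `^ _)%R; rewrite /l; field; rewrite gt_eqF.
have pm : pos_meas (fun x => (U x `^ t0) `^ l * U x `^ (1 - l))%R.
  by apply: pos_measM; [exact: pos_meas_powR pUt|exact: pos_meas_powR pU].
have im := loc_int_geom measurable_Qs mu_Qs pUt pU l01 iUt iU.
rewrite UE (meanE qQ pm im) lee_fin.
apply: le_trans (mean_geom measurable_Qs mu_Qs pUt pU l01 iUt iU qQ) _.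
have mU := mean_gt0 measurable_Qs mu_Qs qQ pU iU.
have mUt := mean_gt0 measurable_Qs mu_Qs qQ pUt iUt.
have C0 : (0 <= C)%R by lra.
have l0 : (0 <= l)%R by have /andP[] := l01.
apply: (@le_trans _ _ (((C * mean mu Q U) `^ t0) `^ l * mean mu Q U `^ (1 - l)))%R.
  apply: ler_wpM2r; first exact: powR_ge0.
  apply: ge0_ler_powR; rewrite ?nnegrE ?powR_ge0//; first exact: ltW.
  by rewrite -lee_fin -(meanE qQ pUt iUt); exact: rU.
rewrite (powRM _ C0 (ltW mU)) (powRM _ (powR_ge0 _ _) (powR_ge0 _ _)).
rewrite -mulrA (powRM _ (ler0n _ 2) (ltW mU)) -[X in (_ * (X * _))%R]powRrM.
rewrite -[(_ * mean mu Q U `^ (1 - l))%R]powRD; last by rewrite (gt_eqF mU) implybT.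
rewrite (_ : t0 * l + (1 - l) = 1 + e)%R; last first.
  by rewrite /l; field; rewrite gt_eqF.
apply: ler_wpM2r; first exact: powR_ge0.
apply: le_trans (_ : _ <= 2)%R _.
  have tl : (t0 * l = t0 / (t0 - 1) * e)%R by rewrite /l mulrAC mulrA.
  by rewrite -(powRrM C) tl (powRrM C).
by apply: le1r_powR; rewrite ?ler1n//; lra.
Qed.

Lemma cst_le_mean (U : T -> R) (m : R) Q : Qs Q -> pos_meas U -> loc_int mu Qs U ->
  (0 <= m)%R -> {ae mu, forall x, Q x -> (m <= U x)%R} -> (m <= mean mu Q U)%R.
Proof.
move=> qQ pU iU m0 mU; rewrite -lee_fin -(meanE qQ pU iU).
rewrite -(mavg_cst measurable_Qs mu_Qs m qQ).
apply: (le_mavg_ae measurable_Qs) => //.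
- exact: measurable_funTS (pos_meas_EFin pU).
- by move=> x; exact: pos_meas_ge0.
Qed.

End reverse_hoelder_interpolation.

(** * Majorants in A_1 *)

Section A1_majorant.
Context d (T : measurableType d) (R : realType).
Variable mu : {measure set T -> \bar R}.
Variable Qs : set (set T).
Hypothesis measurable_Qs : forall Q, Qs Q -> measurable Q.
Hypothesis mu_Qs : forall Q, Qs Q -> exists2 r : R, (0 < r)%R & mu Q = r%:E.
Variable M : (T -> \bar R) -> T -> \bar R.
Hypothesis M_ge0 : forall f x, (forall x, 0 <= f x) -> 0 <= M f x.
Hypothesis measurable_M : forall f, (forall x, 0 <= f x) ->
  measurable_fun [set: T] (M f).
Hypothesis M_series : forall (f : nat -> T -> \bar R) x,
  (forall k, measurable_fun [set: T] (f k)) -> (forall k x, 0 <= f k x) ->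
  M (fun x => \sum_(k <oo) f k x) x <= \sum_(k <oo) M (f k) x.
Hypothesis M_scale : forall (c : R) f x, (0 <= c)%R ->
  measurable_fun [set: T] f -> (forall x, 0 <= f x) ->
  M (fun x => c%:E * f x) x <= c%:E * M f x.
Hypothesis M_gt0 : forall f x, measurable_fun [set: T] f -> (forall x, 0 <= f x) ->
  0 < \int[mu]_x f x -> 0 < M f x.
Variable k : R.
Hypothesis k0 : (0 < k)%R.
Hypothesis M_avg : forall Q f x, Qs Q -> Q x -> measurable_fun [set: T] f ->
  (forall x, 0 <= f x) -> mavg mu Q f <= k%:E * M f x.
Variables B cst : R -> R.
Hypothesis M_buckley : forall (W : T -> R) (p K : R), pos_meas W -> (1 < p)%R ->
  loc_int mu Qs W -> loc_int mu Qs (fun x => W x `^ (- (p - 1)^-1))%R -> (0 <= K)%R ->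
  (forall Q, Qs Q -> (mean mu Q W *
    mean mu Q (fun x => W x `^ (- (p - 1)^-1))%R `^ (p - 1) <= K)%R) ->
  forall f, measurable_fun [set: T] f -> (forall x, 0 <= f x) ->
  \int[mu]_x (M f x `^ p * (W x)%:E) <=
  ((B p * K `^ (p - 1)^-1) `^ p)%:E * \int[mu]_x (f x `^ p * (W x)%:E).
(** The algorithm may run at any exponent [s] between [1 + (t - 1) / 2] and [t], and [cst t] serves
    all of them; the factor 8 absorbs the losses 4 and 2 that arise in [cle]. *)
Hypothesis B_cst : forall t s : R, (1 < s)%R -> (s <= t)%R -> ((t - 1) / 2 <= s - 1)%R ->
  (1 <= k * (2 * B s))%R /\ (k * (2 * B s) * 8 <= cst t)%R.

Variables (W : T -> R) (tau K : R).
Hypothesis tau1 : (1 < tau)%R.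
Let sg := (fun x => W x `^ (- (tau - 1)^-1))%R.
Hypothesis pW : pos_meas W.
Hypothesis iW : loc_int mu Qs W.
Hypothesis is_ : loc_int mu Qs sg.
Hypothesis K1 : (1 <= K)%R.
Hypothesis WK : forall Q, Qs Q -> (mean mu Q W * mean mu Q sg `^ (tau - 1) <= K)%R.

Let tau10 : (0 < tau - 1)%R. Proof. by rewrite subr_gt0. Qed.
Let psg : pos_meas sg. Proof. exact: pos_meas_powR. Qed.
Let K0 : (0 < K)%R. Proof. exact: lt_le_trans K1. Qed.

(* [t = 1] is the plain algorithm; [t > 1] runs it on a slightly smaller
   exponent [s], so that [H^e] with [e = tau / s > 1] is still in A_1. *)
Let majorant_aux (t : R) (h : T -> \bar R) : (1 <= t <= 2)%R ->
  RH mu Qs sg t 2 -> (K `^ ((t - 1) / (tau * (tau - 1))) <= 2)%R ->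
  measurable_fun [set: T] h -> (forall x, 0 <= h x) ->
  0 < \int[mu]_x (h x `^ tau * (W x)%:E) < +oo ->
  exists H : T -> R, [/\ [/\ pos_meas H, loc_int mu Qs H &
    {ae mu, forall x, h x <= (H x)%:E}],
    A1 mu Qs H (cst tau * K `^ (tau - 1)^-1)%R,
    \int[mu]_x ((H x)%:E `^ tau * (W x)%:E) <=
    (2 `^ tau)%:E * \int[mu]_x (h x `^ tau * (W x)%:E) &
    exists e C' : R, [/\ (t * tau = e * (t + tau - 1))%R, (0 <= C')%R & RH mu Qs H e C']].
Proof.
move=> /andP[t1 t2] rs Kt mh h0 /andP[h1 h2].
have t0 : (0 < t)%R by lra.
have tau0 : (0 < tau)%R by have := tau1; lra.
(* With this choice [W ^ (- 1 / (s - 1))] is [sg ^ t], so the reverse Hoelder condition of [sg]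
   yields the Muckenhoupt condition of [W] at the exponent [s], with [K' = 2 ^ (tau - 1) * K]. *)
pose s := (1 + (tau - 1) / t)%R.
have s1E : (s - 1 = (tau - 1) / t)%R by rewrite /s addrAC subrr add0r.
have s1 : (1 < s)%R by rewrite /s ltrDl divr_gt0.
have s10 : (0 < s - 1)%R by lra.
have s0 : (0 < s)%R by lra.
have stau : (s <= tau)%R.
  have : ((tau - 1) / t <= tau - 1)%R by rewrite ler_pdivrMr// ler_peMr// ltW.
  by rewrite /s; lra.
pose e := (tau / s)%R.
have e0 : (0 < e)%R by exact: divr_gt0.
have e1 : (1 <= e)%R by rewrite /e ler_pdivlMr// mul1r.
have ste : (e * s = tau)%R by rewrite /e mulfVK// gt_eqF.
pose sgt := (fun x => sg x `^ t)%R.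
have psgt : pos_meas sgt by exact: pos_meas_powR.
have isgt : loc_int mu Qs sgt.
  by move=> Q qQ; apply: le_lt_trans (rs Q qQ) _; rewrite ltry.
have sgtE : (fun x => W x `^ (- (s - 1)^-1))%R = sgt.
  apply/funext => x; rewrite /sgt /sg -powRrM s1E; congr (_ `^ _)%R.
  by field; rewrite !gt_eqF.
pose K' := (2 `^ (tau - 1) * K)%R.
have K'0 : (0 < K')%R by rewrite mulr_gt0// powR_gt0.
have WK' Q : Qs Q -> (mean mu Q W * mean mu Q sgt `^ (s - 1) <= K')%R.
  move=> qQ; have mW := mean_gt0 measurable_Qs mu_Qs qQ pW iW.
  have ms := mean_gt0 measurable_Qs mu_Qs qQ psg is_.
  have mst := mean_gt0 measurable_Qs mu_Qs qQ psgt isgt.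
  apply: (@le_trans _ _ (mean mu Q W * (2 * mean mu Q sg) `^ (tau - 1)))%R.
    rewrite (ler_pM2l mW).
    rewrite (_ : (2 * mean mu Q sg) `^ (tau - 1) =
      ((2 * mean mu Q sg) `^ t) `^ (s - 1))%R; last first.
      by rewrite -powRrM s1E mulrCA divff ?mulr1// gt_eqF.
    apply: (le_powR (ltW s10) (ltW mst)).
    by rewrite -lee_fin -(meanE qQ psgt isgt); exact: rs.
  rewrite (powRM _ (ler0n _ 2) (ltW ms)) mulrCA /K' ler_pM2l ?powR_gt0//.
  exact: WK.
pose N := (B s * K' `^ (s - 1)^-1)%R.
have s12 : ((tau - 1) / 2 <= s - 1)%R.
  rewrite s1E; apply: (ler_wpM2l (ltW tau10)).
  by rewrite -[leRHS]div1r ler_pdivlMr//; lra.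
have [c1 c2] := B_cst s1 stau s12.
have b0 : (0 < B s)%R.
  have : (0 < k * (2 * B s))%R by exact: lt_le_trans ltr01 c1.
  by rewrite (pmulr_rgt0 _ k0) pmulr_rgt0.
have N0 : (0 < N)%R by rewrite mulr_gt0// powR_gt0.
have he0 x : 0 <= h x `^ e by exact: poweR_ge0.
have mhe : measurable_fun [set: T] (fun x => h x `^ e) by exact: measurable_fun_poweR.
have hes : (fun x => (h x `^ e) `^ s * (W x)%:E) = (fun x => h x `^ tau * (W x)%:E).
  by apply/funext => x; rewrite -poweRrM ste.
have [mW W0] := pW.
have [] := rdf_A1 measurable_Qs mu_Qs M_ge0 measurable_M M_series M_scale M_gt0
  k0 M_avg pW (ltW s1) N0 _ mhe he0.
- apply: M_buckley; [exact: pW|exact: s1|exact: iW| |exact: ltW|].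
    by rewrite sgtE.
  by rewrite sgtE.
- by rewrite hes h1 h2.
move=> Ht [pHt iHt hHt A1Ht IHt].
pose H := (fun x => Ht x `^ e^-1)%R.
have pH : pos_meas H by exact: pos_meas_powR.
have ei01 : (0 <= e^-1 <= 1)%R by rewrite invr_ge0 (ltW e0)/= invf_le1.
have ei0 : (0 <= e^-1)%R by rewrite invr_ge0 ltW.
have iH : loc_int mu Qs H by exact: (loc_int_powR measurable_Qs mu_Qs pHt iHt ei01).
pose c := (k * (2 * N))%R.
have c0 : (0 < c)%R by rewrite mulr_gt0// mulr_gt0.
(* Taking the root of order [e] changes the power of [K] to [u], which exceeds [1 / (tau - 1)] by
   the exponent in [Kt]. The surplus costs a factor 2, and the power of 2 in [K'] costs 4. *)
have cle : (c `^ e^-1 <= cst tau * K `^ (tau - 1)^-1)%R.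
  have Ki0 := powR_ge0 K' (s - 1)^-1; have c10 := le_trans ler01 c1.
  have -> : c = (k * (2 * B s) * K' `^ (s - 1)^-1)%R.
    by rewrite /c /N !mulrA.
  rewrite (powRM _ c10 Ki0) -powRrM.
  have sE : s = ((t + tau - 1) / t)%R by rewrite /s; field; rewrite gt_eqF.
  have tt : (0 < t + tau - 1)%R by have := tau1; lra.
  set u := ((s - 1)^-1 * e^-1)%R.
  have uE : u = ((t + tau - 1) / (tau * (tau - 1)))%R.
    by rewrite /u /e s1E sE; field; rewrite !gt_eqF.
  rewrite /K' (powRM _ (powR_ge0 _ _) (ltW K0)) -powRrM.
  have u1 : (2 `^ ((tau - 1) * u) <= 4 :> R)%R.
    have -> : (4 = 2 `^ 2 :> R)%R by rewrite powR_mulrn// -natrX.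
    apply: ler_powR; first by rewrite ler1n.
    have -> : ((tau - 1) * u = (t + tau - 1) / tau)%R.
      by rewrite uE; field; rewrite !gt_eqF.
    by rewrite ler_pdivrMr//; have := tau1; lra.
  have u2 : (K `^ u <= 2 * K `^ (tau - 1)^-1)%R.
    have -> : u = ((t - 1) / (tau * (tau - 1)) + (tau - 1)^-1)%R.
      by rewrite uE; field; rewrite !gt_eqF.
    rewrite powRD; last by rewrite (gt_eqF K0) implybT.
    by apply: ler_wpM2r => //; exact: powR_ge0.
  have u3 : ((k * (2 * B s)) `^ e^-1 <=
      k * (2 * B s))%R.
    by apply: ler1_powR => //; rewrite invf_le1.
  apply: (@le_trans _ _ ((k * (2 * B s)) *
      (4 * (2 * K `^ (tau - 1)^-1))))%R.
    apply: ler_pM; rewrite ?powR_ge0 ?mulr_ge0 ?powR_ge0//.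
    by apply: ler_pM; rewrite ?powR_ge0.
  apply: le_trans (ler_wpM2r (powR_ge0 K (tau - 1)^-1) c2).
  rewrite le_eqVlt; apply/orP; left; apply/eqP.
  by move: (k * (2 * B s))%R (K `^ (tau - 1)^-1)%R => X1 X2; ring.
exists H; split.
- split => //; apply: filterS hHt => x hx.
  rewrite -(poweRK (h0 x) e0) /H -poweR_EFin; apply: le_poweR => //.
- move=> Q qQ; apply: filterS (A1Ht Q qQ) => x /[apply] Hx.
  apply: le_trans (mean_powR measurable_Qs mu_Qs pHt iHt ei01 qQ) _.
  have mHt := mean_gt0 measurable_Qs mu_Qs qQ pHt iHt.
  apply: (@le_trans _ _ ((c * Ht x) `^ e^-1))%R.
    apply: ge0_ler_powR; rewrite ?nnegrE//; first exact: ltW.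
    by rewrite mulr_ge0// ltW// pHt.2.
  rewrite (powRM _ (ltW c0) (ltW (pHt.2 x))); apply: ler_wpM2r => //.
  exact: powR_ge0.
- have -> : (fun x => (H x)%:E `^ tau * (W x)%:E) = (fun x => (Ht x)%:E `^ s * (W x)%:E).
    apply/funext => x; rewrite /H !poweR_EFin -powRrM -ste mulrA mulVf ?mul1r// gt_eqF//.
  apply: le_trans IHt _; rewrite hes; apply: lee_wpmul2r; first exact: ltW.
  by rewrite lee_fin ler_powR// ler1n.
(* The relation gives [e > 1] exactly when [t > 1], since [t * tau - (t + tau - 1) = (t - 1) * (tau
   - 1)]. As [Ht = H ^ e] satisfies the A_1 condition, its mean is at most a multiple of its
   essential infimum, hence of the power [e] of the mean of [H]. *)
- exists e, (c `^ e^-1)%R; split.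
  + by rewrite /e /s; field; rewrite !gt_eqF//; lra.
  + exact: powR_ge0.
  move=> Q qQ; have mH := mean_gt0 measurable_Qs mu_Qs qQ pH iH.
  have mHt := mean_gt0 measurable_Qs mu_Qs qQ pHt iHt.
  have -> : (fun x => (H x `^ e)%:E) = EFin \o Ht.
    by apply/funext => x /=; rewrite /H powRVK// ltW// pHt.2.
  rewrite (meanE qQ pHt iHt) lee_fin (powRM _ (powR_ge0 _ _) (ltW mH)).
  rewrite powRVK ?(ltW c0)// -ler_pdivrMl//.
  have : ((c^-1 * mean mu Q Ht) `^ e^-1 <= mean mu Q H)%R.
    apply: (cst_le_mean measurable_Qs mu_Qs) => //; first exact: powR_ge0.
    apply: filterS (A1Ht Q qQ) => x /[apply] Hx.
    apply: ge0_ler_powR; rewrite ?nnegrE//.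
    - by rewrite mulr_ge0 ?invr_ge0 ?(ltW c0) ?(ltW mHt).
    - exact: ltW (pHt.2 x).
    - by rewrite ler_pdivrMl.
  move/(ge0_ler_powR (ltW e0)); rewrite !nnegrE => /(_ (powR_ge0 _ _) (ltW mH)).
  by rewrite powRVK// mulr_ge0 ?invr_ge0 ?(ltW c0) ?(ltW mHt).
Qed.

(** If [rh] holds, [t = 1 + e] is taken with [e] small in terms of [K] and of the reverse Hoelder
    data. These data affect [t], hence the exponent and constant of the last clause, but neither
    [cst tau] nor the factor [2 ^ tau]. *)
Lemma A1_majorant (rh : bool) (h : T -> \bar R) :
  (rh -> exists t0 C : R, [/\ (1 < t0)%R, (0 <= C)%R & RH mu Qs sg t0 C]) ->
  measurable_fun [set: T] h -> (forall x, 0 <= h x) ->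
  0 < \int[mu]_x (h x `^ tau * (W x)%:E) < +oo ->
  exists H : T -> R, [/\ [/\ pos_meas H, loc_int mu Qs H &
    {ae mu, forall x, h x <= (H x)%:E}],
    A1 mu Qs H (cst tau * K `^ (tau - 1)^-1)%R,
    \int[mu]_x ((H x)%:E `^ tau * (W x)%:E) <=
    (2 `^ tau)%:E * \int[mu]_x (h x `^ tau * (W x)%:E) &
    rh -> exists e C' : R, [/\ (1 < e)%R, (0 <= C')%R & RH mu Qs H e C']].
Proof.
move=> hrh mh h0 hfin; have tau0 : (0 < tau)%R by have := tau1; lra.
suff [t [t12 trh rt Kt]] : exists t : R, [/\ (1 <= t <= 2)%R, (rh -> 1 < t)%R,
    RH mu Qs sg t 2 & (K `^ ((t - 1) / (tau * (tau - 1))) <= 2)%R].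
  have [H [pH A1H IH [e [C' [et C'0 rH]]]]] := majorant_aux t12 rt Kt mh h0 hfin.
  exists H; split; [exact: pH|exact: A1H|exact: IH|move=> /trh t1].
  exists e, C'; split; [|exact: C'0|exact: rH].
  have tt : (0 < t + tau - 1)%R by have := tau1; lra.
  rewrite -(ltr_pM2r tt) -et mul1r.
  have : (0 < (t - 1) * (tau - 1))%R by rewrite mulr_gt0// subr_gt0.
  by lra.
case: rh hrh => [/(_ isT)[t0 [C [t01 C0 rC]]]|_]; last first.
  exists 1%R; split => //; first by rewrite lexx ler1n.
    move=> Q qQ; have ms := mean_gt0 measurable_Qs mu_Qs qQ psg is_.
    under eq_fun do rewrite powRr1 ?powR_ge0//.
    have := meanE qQ psg is_; rewrite /comp => ->.
    by rewrite lee_fin powRr1 ?mulr_ge0 ?(ltW ms)// ler_peMl ?(ltW ms)// ler1n.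
  by rewrite subrr mul0r powRr0 ler1n.
have t0' : (0 < t0 - 1)%R by rewrite subr_gt0.
pose C1 := Num.max 1%R C.
have C11 : (1 <= C1)%R by rewrite le_max lexx.
have rC1 : RH mu Qs sg t0 C1.
  move=> Q qQ; apply: le_trans (rC Q qQ) _; rewrite lee_fin.
  have ms := mean_gt0 measurable_Qs mu_Qs qQ psg is_.
  have CC1 : (C <= C1)%R by rewrite le_max lexx orbT.
  apply: ge0_ler_powR; rewrite ?nnegrE ?mulr_ge0 ?(ltW ms) ?(le_trans C0 CC1)//; first by lra.
  by rewrite ler_wpM2r// ltW.
(* One small exponent meets both requirements: [X1] governs the reverse Hoelder constant at [1 + e]
   and [X2] the surplus power of [K]. Both are at least 1, so their product dominates each. *)
pose X1 := (C1 `^ (t0 / (t0 - 1)))%R.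
pose X2 := (K `^ (tau * (tau - 1))^-1)%R.
have X11 : (1 <= X1)%R by apply: powR_ge1 => //; rewrite divr_ge0//; lra.
have X21 : (1 <= X2)%R by apply: powR_ge1; rewrite // invr_ge0 mulr_ge0 ?ltW.
have [e /andP[e0 eb] Xe] : exists2 e : R, (0 < e <= Num.min 1 (t0 - 1))%R &
    ((X1 * X2) `^ e <= 2)%R.
  by apply: ex_small_exponent; [rewrite mulr_ege1|rewrite lt_min ltr01].
move: eb; rewrite le_min => /andP[e1 et0].
exists (1 + e)%R; split.
- by apply/andP; split; lra.
- by rewrite ltrDl.
- apply: (RH_interpolate measurable_Qs mu_Qs psg is_ t01 C11 rC1).
    by rewrite (ltW e0).
  apply: le_trans Xe; apply: le_powR; [exact: ltW|exact: powR_ge0|].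
  by apply: ler_peMr; [exact: powR_ge0|exact: X21].
- rewrite addrAC subrr add0r mulrC powRrM.
  apply: le_trans Xe; apply: le_powR; [exact: ltW|exact: powR_ge0|].
  by apply: ler_peMl; [exact: powR_ge0|exact: X11].
Qed.

End A1_majorant.

(** * The majorant on R^n *)

Section maximal_majorant.
Context {R : realType} {n : nat}.
Local Notation T := (Rn R n).
Local Notation mu := (@lebesgue_Rn R n).
Local Notation Qs := (@cubes R n).

Lemma maxop_gt0 (f : T -> \bar R) x : measurable_fun [set: T] f ->
  (forall x, 0 <= f x) -> 0 < \int[mu]_x f x -> 0 < maxop f x.
Proof.
move=> mf f0 If; have [Q cQ [Qx IQ]] := integral_setT_cubes mf f0 If x.
have [r r0 E] := lebesgue_cubes cQ.
have := avg_maxop cQ Qx mf f0; rewrite /avg E inver gt_eqF//.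
have : 0 < (r^-1)%:E * \int[mu]_(x in Q) f x by rewrite mule_gt0// lte_fin invr_gt0.
move=> /lt_le_trans H /H; rewrite lt0e => /andP[M0 _].
rewrite lt0e maxop_ge0 andbT; apply: contra M0 => /eqP ->.
by rewrite mule0.
Qed.

(** The condition [(tau - 1) / 2 <= s - 1] replaces [1 / (s - 1)] by [2 / (tau - 1)] in
    [buckley_const s]. The factor [12 ^ n] is the loss from cubes to cells, 2 comes from the
    algorithm and 8 from lowering its exponent. *)
Definition majorant_const (tau : R) : R :=
  (12 ^+ n * (2 * (2 ^+ n * (2 * tau / (tau - 1) * tau `^ (2 / (tau - 1))))) * 8)%R.

Lemma buckley_const_le (tau s : R) : (1 < s)%R -> (s <= tau)%R ->
  ((tau - 1) / 2 <= s - 1)%R ->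
  (1 <= 12 ^+ n * (2 * @buckley_const R n s) :> R)%R /\
  (12 ^+ n * (2 * @buckley_const R n s) * 8 <= majorant_const tau)%R.
Proof.
move=> s1 st st2; have s10 : (0 < s - 1)%R by lra.
have t10 : (0 < tau - 1)%R by lra.
have s0 : (0 < s)%R by lra.
have e1 : (1 <= (12 : R) ^+ n)%R by rewrite exprn_ege1// ler1n.
have e2 : (1 <= (2 : R) ^+ n)%R by rewrite exprn_ege1// ler1n.
have b1 : (1 <= s / (s - 1))%R by rewrite ler_pdivlMr// mul1r; lra.
have b2 : (1 <= s `^ (s - 1)^-1)%R.
  by apply: powR_ge1; rewrite ?invr_ge0; lra.
have B1 : (1 <= @buckley_const R n s)%R.
  by rewrite /buckley_const; apply: mulr_ege1 => //; exact: mulr_ege1.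
split; first by rewrite mulr_ege1//; lra.
apply: ler_wpM2r; first lra.
apply: ler_wpM2l; first lra.
apply: ler_wpM2l; first lra.
apply: ler_wpM2l; first lra.
apply: ler_pM; [lra|exact: powR_ge0| |].
  rewrite ler_pdivrMr// mulrAC ler_pdivlMr//.
  apply: (@le_trans _ _ (tau * (tau - 1)))%R; first by rewrite ler_wpM2r// ltW.
  by rewrite -[leRHS]mulrA mulrCA ler_wpM2l//; lra.
apply: (@le_trans _ _ (tau `^ (s - 1)^-1))%R.
  by apply: ge0_ler_powR; rewrite ?nnegrE ?invr_ge0//; lra.
apply: ler_powR; first lra.
rewrite -[leLHS]mul1r ler_pdivrMr// mulrAC ler_pdivlMr// mul1r.
by lra.
Qed.

Lemma maxop_buckley_mean (W : T -> R) (p K : R) : pos_meas W -> (1 < p)%R ->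
  loc_int mu Qs W -> loc_int mu Qs (fun x => W x `^ (- (p - 1)^-1))%R -> (0 <= K)%R ->
  (forall Q, Qs Q -> (mean mu Q W *
    mean mu Q (fun x => W x `^ (- (p - 1)^-1))%R `^ (p - 1) <= K)%R) ->
  forall f : T -> \bar R, measurable_fun [set: T] f -> (forall x, 0 <= f x) ->
  \int[mu]_x (maxop f x `^ p * (W x)%:E) <=
  ((@buckley_const R n p * K `^ (p - 1)^-1) `^ p)%:E * \int[mu]_x (f x `^ p * (W x)%:E).
Proof.
move=> pW p1 iW isg K0 WK f mf f0; have [mW W0] := pW.
have psg : pos_meas (fun x => W x `^ (- (p - 1)^-1))%R by exact: pos_meas_powR.
apply: (maxop_buckley mW W0 p1 iW isg K0) => // Q qQ.
have E1 := meanE qQ pW iW; have E2 := meanE qQ psg isg.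
have := WK Q qQ; rewrite -lee_fin EFinM -poweR_EFin -E1 -E2.
exact.
Qed.

Definition A1_majorant_Rn (W : T -> R) (tau K : R) tau1 pW iW isg K1 WK rh h :=
  @A1_majorant _ T R mu Qs measurable_cubes lebesgue_cubes maxop
  (fun f x _ => maxop_ge0 f x) measurable_maxop maxop_series maxop_scale maxop_gt0
  (12 ^+ n)%R ltac:(by rewrite exprn_gt0) (fun Q f x cQ Qx mf f0 => avg_maxop cQ Qx mf f0)
  (@buckley_const R n) majorant_const maxop_buckley_mean buckley_const_le
  W tau K tau1 pW iW isg K1 WK rh h.

End maximal_majorant.

(** * Weights of the extrapolation *)

Section extrapolation_weight.
Context d (T : measurableType d) (R : realType).
Variable mu : {measure set T -> \bar R}.
Variable Qs : set (set T).
Hypothesis measurable_Qs : forall Q, Qs Q -> measurable Q.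
Hypothesis mu_Qs : forall Q, Qs Q -> exists2 r : R, (0 < r)%R & mu Q = r%:E.

(** The union of the classes RH_t over finite [t > 1]. Only existence is recorded, as no final
    estimate may depend on [t] or [C]. *)
Definition RH_some (U : T -> R) :=
  exists t C : R, [/\ (1 < t)%R, (0 <= C)%R & RH mu Qs U t C].

Variable cst : R -> R.
Hypothesis cst1 : forall t : R, (1 < t)%R -> (1 <= cst t)%R.
Hypothesis majorant : forall (W : T -> R) (tau K : R), (1 < tau)%R -> pos_meas W ->
  loc_int mu Qs W -> loc_int mu Qs (fun x => W x `^ (- (tau - 1)^-1))%R -> (1 <= K)%R ->
  (forall Q, Qs Q -> (mean mu Q W *
    mean mu Q (fun x => W x `^ (- (tau - 1)^-1))%R `^ (tau - 1) <= K)%R) ->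
  forall (rh : bool) (h : T -> \bar R),
  (rh -> RH_some (fun x => W x `^ (- (tau - 1)^-1))%R) ->
  measurable_fun [set: T] h -> (forall x, 0 <= h x) ->
  0 < \int[mu]_x (h x `^ tau * (W x)%:E) < +oo ->
  exists H : T -> R, [/\ [/\ pos_meas H, loc_int mu Qs H &
    {ae mu, forall x, h x <= (H x)%:E}],
    A1 mu Qs H (cst tau * K `^ (tau - 1)^-1)%R,
    \int[mu]_x ((H x)%:E `^ tau * (W x)%:E) <=
    (2 `^ tau)%:E * \int[mu]_x (h x `^ tau * (W x)%:E) &
    rh -> RH_some H].

Lemma RH_some_le (U : T -> R) (t0 : R) : pos_meas U -> loc_int mu Qs U ->
  RH_some U -> (1 < t0)%R ->
  exists t C : R, [/\ (1 < t)%R, (t <= t0)%R, (0 <= C)%R & RH mu Qs U t C].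
Proof.
move=> pU iU [t [C [t1 C0 rU]]] t01; exists (Num.min t0 t), C; split => //.
- by rewrite lt_min t01.
- by rewrite ge_min lexx.
- apply: (RH_le measurable_Qs mu_Qs pU iU _ _ C0 rU); last by rewrite ge_min lexx orbT.
  by rewrite lt_min !(lt_trans ltr01).
Qed.

(** The flags [bW] and [bS] say which of [W] and [S] comes with a reverse Hoelder exponent to
    transmit. The first serves the raising of an exponent; the second serves the lowering, where the
    lemma is applied to [1 / w] and [W] and [S] exchange roles. *)
Lemma upper_weight (x y xq yq : R) (w : T -> R) (K : R) (bW bS : bool)
    (g0 : T -> \bar R) :
  (0 < x)%R -> (0 < y)%R -> (0 <= yq)%R -> (x < xq)%R -> (xq + yq = x + y)%R ->
  let W := (fun z => w z `^ y^-1)%R in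
  let S := (fun z => w z `^ (- x^-1))%R in
  pos_meas w -> loc_int mu Qs W -> loc_int mu Qs S -> (1 <= K)%R ->
  (forall Q, Qs Q -> (mean mu Q W * mean mu Q S `^ (x / y) <= K)%R) ->
  (bW -> RH_some W) -> (bS -> RH_some S) ->
  measurable_fun [set: T] g0 -> (forall z, 0 <= g0 z) ->
  0 < \int[mu]_z g0 z < +oo ->
  let c := (cst ((x + y) / y) * K `^ (y / x))%R in
  exists G : T -> R, [/\ pos_meas G, {ae mu, forall z, g0 z <= (G z)%:E},
    \int[mu]_z (G z)%:E <= (2 `^ ((x + y) / y))%:E * \int[mu]_z g0 z &
    let v := (fun z => w z * G z `^ (x - xq))%R in
    let V := (fun z => v z `^ (- xq^-1))%R in
    let U := (fun z => v z `^ yq^-1)%R in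
    [/\ loc_int mu Qs V, bS -> RH_some V,
      (0 < yq)%R -> [/\ loc_int mu Qs U,
        forall Q, Qs Q -> (mean mu Q U * mean mu Q V `^ (xq / yq) <=
          K * c `^ ((x + y) * (yq^-1 - y^-1)))%R & bW -> RH_some U] &
      yq = 0%R -> A1 mu Qs V c]].
Proof.
move=> x0 y0 yq0 xxq sumq W S pw iW iS K1 WK rW rS mg0 g00 /andP[g01 g02] c.
have xy0 : (0 < x + y)%R by exact: addr_gt0.
have xq0 : (0 < xq)%R by exact: lt_trans xxq.
pose tau := ((x + y) / y)%R.
have tau1E : (tau - 1 = x / y)%R by rewrite /tau; field; rewrite gt_eqF.
have tau1 : (1 < tau)%R by rewrite -subr_gt0 tau1E divr_gt0.
have tau0 : (0 < tau)%R by exact: lt_trans tau1.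
have pW : pos_meas W by exact: pos_meas_powR.
have SE : (fun z => W z `^ (- (tau - 1)^-1))%R = S.
  apply/funext => z; rewrite /W /S -powRrM tau1E; congr (_ `^ _)%R.
  by field; rewrite !gt_eqF.
have SE' : (fun z => W z `^ (- (y / x)))%R = S.
  by apply/funext => z; rewrite /W /S -powRrM; congr (_ `^ _)%R; field; rewrite !gt_eqF.
(* Chosen so that [h ^ tau * W = g0]; then [H >= h] gives [G = H ^ tau * W >= g0]. *)
pose h := (fun z => (g0 z * ((W z)^-1)%:E) `^ tau^-1).
have Wi0 z : 0 <= ((W z)^-1)%:E by rewrite lee_fin invr_ge0 ltW// pW.2.
have mWi : measurable_fun [set: T] (fun z => ((W z)^-1)%:E).
  by apply/measurable_EFinP/measurable_fun_invr; case: pW.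
have gW0 z : 0 <= g0 z * ((W z)^-1)%:E by exact: mule_ge0.
have mh : measurable_fun [set: T] h.
  by apply: measurable_fun_poweR; exact: emeasurable_funM.
have h0 z : 0 <= h z by exact: poweR_ge0.
have hE : (fun z => h z `^ tau * (W z)%:E) = g0.
  apply/funext => z; rewrite /h (poweRVK (gW0 z) tau0) -muleA -EFinM mulVf ?mule1//.
  by rewrite gt_eqF// pW.2.
have [] := @majorant W tau K tau1 pW iW _ K1 _ bS h _ mh h0.
- by rewrite SE.
- by rewrite SE tau1E.
- by rewrite SE.
- by rewrite hE g01 g02.
move=> H [[pH iH hH] HA1 IH rH].
have cE : (cst tau * K `^ (tau - 1)^-1)%R = c.
  by rewrite /c tau1E invf_div.
rewrite cE in HA1; rewrite hE in IH.
have c0 : (0 < c)%R.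
  have := cst1 tau1; have := powR_gt0 (y / x) (lt_le_trans ltr01 K1).
  by rewrite /c -/tau => k0 c1; rewrite mulr_gt0//; exact: lt_le_trans c1.
pose G := (fun z => H z `^ tau * W z)%R.
have pG : pos_meas G by apply: pos_measM => //; exact: pos_meas_powR.
exists G; split; [exact: pG| | |].
- apply: filterS hH => z hz; have Wz := pW.2 z.
  have -> : g0 z = h z `^ tau * (W z)%:E by rewrite -[in LHS]hE.
  rewrite /G EFinM; apply: lee_wpmul2r; first by rewrite lee_fin ltW.
  by rewrite -poweR_EFin; apply: le_poweR => //; exact: ltW.
- by apply: le_trans IH; rewrite le_eqVlt; apply/orP; left; apply/eqP.
move=> v V U.
(* The powers of [W] add up to [yq], because [w = W ^ y] and [y + (x - xq) = yq]. *)
have vE z : v z = (W z `^ yq * H z `^ (tau * (x - xq)))%R.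
  rewrite /v /G (powRM _ (powR_ge0 _ _) (powR_ge0 _ _)) -powRrM /W -!powRrM.
  have wz := pw.2 z; rewrite mulrCA mulrC; congr (_ * _)%R.
  rewrite -[X in (X * _)%R](powRr1 (ltW wz)) -powRD; last by rewrite (gt_eqF wz) implybT.
  congr (_ `^ _)%R; have -> : (yq = x + y - xq)%R by rewrite -sumq addrAC subrr add0r.
  by field; rewrite gt_eqF.
(* At [yq = 0], the top of the range, [v] is a negative power of [H] alone and [V = H], so the
   condition on the new weight is the A_1 condition of [H]. *)
have [yq00|yqn0] := eqVneq yq 0%R.
  have xqE : xq = (x + y)%R by rewrite -sumq yq00 addr0.
  have VE : V = H.
    apply/funext => z; have Hz := pH.2 z.
    rewrite /V vE yq00 powRr0 mul1r -powRrM (_ : _ * _ = 1)%R ?powRr1 ?(ltW Hz)//.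
    by rewrite /tau xqE; field; rewrite !gt_eqF.
  have yqF : (0 < yq)%R = false by rewrite yq00 ltxx.
  by rewrite yqF VE; split; [exact: iH|exact: rH|by []|move=> _; exact: HA1].
have yq1 : (0 < yq)%R by rewrite lt0r yqn0.
pose a := ((x + y) * (yq^-1 - y^-1))%R.
have UE : U = (fun z => W z * H z `^ (- a))%R.
  apply/funext => z; have Hz := pH.2 z; have Wz := pW.2 z.
  rewrite /U vE (powRM _ (powR_ge0 _ _) (powR_ge0 _ _)) (powRK (ltW Wz) yq1).
  rewrite -powRrM; congr (_ * _ `^ _)%R.
  rewrite /a /tau; have -> : (xq = x + y - yq)%R by rewrite -sumq addrK.
  by field; rewrite !gt_eqF.
have pU : pos_meas U by rewrite UE; exact: pos_measM pW (pos_meas_powR _ pH).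
have VU : V = (fun z => U z `^ (- (yq / xq)))%R.
  apply/funext => z; rewrite /V /U -powRrM; congr (_ `^ _)%R.
  by field; rewrite !gt_eqF.
have VE : V = (fun z => S z `^ (x * yq / (y * xq)) *
    H z `^ (1 - x * yq / (y * xq)))%R.
  by rewrite VU UE -SE'; rewrite (dual_V x0 y0 yq1 xxq sumq pW pH).
have K0 : (0 < K)%R by exact: lt_le_trans K1.
have WK' Q : Qs Q -> (mean mu Q W *
    mean mu Q (fun z => W z `^ (- (y / x)))%R `^ (x / y) <= K)%R.
  by rewrite SE'; exact: WK.
have iS' : loc_int mu Qs (fun z => W z `^ (- (y / x)))%R by rewrite SE'.
split.
- by rewrite VE -SE'; exact: (loc_int_V measurable_Qs mu_Qs x0 y0 yq1 xxq sumq pW pH iS' iH).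
- move=> b; have [t1 [C1 [t11 C10 rS1]]] := rS b.
  have [t2 [C2 [t21 t2t1 C20 rH2]]] := RH_some_le pH iH (rH b) t11.
  have pS : pos_meas S by exact: pos_meas_powR.
  have rS2 : RH mu Qs (fun z => W z `^ (- (y / x)))%R t2 C1.
    by rewrite SE'; apply: (RH_le measurable_Qs mu_Qs pS iS _ t2t1 C10 rS1);
      exact: lt_trans t21.
  have rV := RH_V measurable_Qs mu_Qs x0 y0 yq1 xxq sumq pW pH iW iS' iH c0 K0 HA1 WK'
    (ltW t21) C10 C20 rS2 rH2.
  exists t2, (C1 `^ (x * yq / (y * xq)) * C2 `^ (1 - x * yq / (y * xq)) *
    (K `^ (yq / xq) * c `^ (1 - x * yq / (y * xq))))%R.
  split; [exact: t21| |by rewrite VE -SE'].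
  by apply: mulr_ge0; apply: mulr_ge0; exact: powR_ge0.
- move=> _; split.
  + by rewrite UE; exact: (loc_int_U measurable_Qs mu_Qs x0 y0 yq1 xxq sumq pW pH iW iH c0 HA1).
  + move=> Q qQ; rewrite VE UE -SE'.
    exact: (mean_UV measurable_Qs mu_Qs x0 y0 yq1 xxq sumq pW pH iW iS' iH c0 HA1 WK' qQ).
  + move=> b; have [t1 [C1 [t11 C10 rS1]]] := rW b.
    have rU := RH_U measurable_Qs mu_Qs x0 y0 yq1 xxq sumq pW pH iW iS' iH c0 K0 HA1 WK'
      (ltW t11) C10 rS1.
    exists t1, (C1 * c `^ a * K)%R; split; [exact: t11| |by rewrite UE].
    by rewrite mulr_ge0 ?(ltW K0)// mulr_ge0// powR_ge0.
- by move=> E; rewrite E ltxx in yq1.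
Qed.

(** Here [x = 1/p_- - 1/p] and [y = 1/p - 1/p_+], and [b] stands for [p_+ = oo]. Apart from the last
    field the form is symmetric under [w -> 1/w], [x <-> y], up to a power of [L]. When a gap
    vanishes, the corresponding mean degenerates into an essential supremum and the condition
    becomes A_1. *)
Record mixed_weight (x y : R) (w : T -> R) (L : R) (b : bool) : Prop := MixedWeight {
  mixed_meas : pos_meas w;
  mixed_y : (0 < y)%R -> loc_int mu Qs (fun z => w z `^ y^-1)%R;
  mixed_x : (0 < x)%R -> loc_int mu Qs (fun z => w z `^ (- x^-1))%R;
  mixed_xy : (0 < x)%R -> (0 < y)%R -> forall Q, Qs Q ->
    (mean mu Q (fun z => w z `^ y^-1)%R *
     mean mu Q (fun z => w z `^ (- x^-1))%R `^ (x / y) <= L)%R;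
  mixed_x0 : x = 0%R -> A1 mu Qs (fun z => w z `^ y^-1)%R L;
  mixed_y0 : y = 0%R -> A1 mu Qs (fun z => w z `^ (- x^-1))%R L;
  mixed_RH : b -> (0 < y)%R -> RH_some (fun z => w z `^ y^-1)%R }.

(** The exponent of the algorithm: [(x + y) / y] is [tau], and [(x + y) / x] is its conjugate, which
    is the [tau] of [1 / w]. *)
Definition mixed_kappa (x y xq : R) : R :=
  if (x < xq)%R then ((x + y) / y)%R else ((x + y) / x)%R.

(** The power of [K] in the constant of the new weight. When the exponent is raised below the top,
    [1 + (y / x) * (x + y) * (1 / yq - 1 / y)] simplifies to [y * xq / (x * yq)]; at the top only
    the A_1 constant, of order [K ^ (y / x)], remains. *)
Definition mixed_exponent (x y xq yq : R) : R :=
  if (xq < x)%R then 1%R else if yq == 0%R then (y / x)%R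
  else (y * xq / (x * yq))%R.

Definition mixed_cst (x y xq yq : R) : R :=
  if (x < xq)%R then
    if yq == 0%R then cst ((x + y) / y)
    else (cst ((x + y) / y) `^ ((x + y) * (yq^-1 - y^-1)))%R
  else if xq == 0%R then cst ((x + y) / x)
  else (cst ((x + y) / x) `^ ((x + y) * (xq^-1 - x^-1) * (xq / yq)))%R.

Lemma powRVN (a r : R) : (0 <= a)%R -> (a^-1 `^ r = a `^ (- r))%R.
Proof. by move=> a0; rewrite powRN powRVinv. Qed.

(** Duality of Muckenhoupt constants, by raising the inequality to the power [t / s]; it transports
    constants between [w] and [1 / w]. *)
Lemma powR_dual_le (a b K s t : R) : (0 < a)%R -> (0 < b)%R -> (0 < s)%R -> (0 < t)%R ->
  (a * b `^ (s / t) <= K)%R -> (b * a `^ (t / s) <= K `^ (t / s))%R.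
Proof.
move=> a0 b0 s0 t0; have ts0 : (0 <= t / s)%R by rewrite divr_ge0// ltW.
move/(le_powR ts0 (mulr_ge0 (ltW a0) (powR_ge0 _ _))).
rewrite (powRM _ (ltW a0) (powR_ge0 _ _)) -powRrM.
rewrite (_ : s / t * (t / s) = 1)%R; last by field; rewrite !gt_eqF.
by rewrite (powRr1 (ltW b0)) mulrC.
Qed.

Lemma extrapolation_weight (x y xq yq : R) (w : T -> R) (K : R) (b : bool)
    (g0 : T -> \bar R) :
  (0 < x)%R -> (0 < y)%R -> (0 <= xq)%R -> (0 <= yq)%R -> xq != x ->
  (xq + yq = x + y)%R -> (1 <= K)%R -> mixed_weight x y w K b ->
  measurable_fun [set: T] g0 -> (forall z, 0 <= g0 z) ->
  0 < \int[mu]_z g0 z < +oo ->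
  exists G : T -> R, [/\ pos_meas G, {ae mu, forall z, g0 z <= (G z)%:E},
    \int[mu]_z (G z)%:E <= (2 `^ mixed_kappa x y xq)%:E * \int[mu]_z g0 z &
    mixed_weight xq yq (fun z => w z * G z `^ (x - xq))%R
      (mixed_cst x y xq yq * K `^ mixed_exponent x y xq yq)%R b].
Proof.
move=> x0 y0 xq0 yq0 xqx sumq K1 [pw iW iS WK _ _ rW] mg0 g00 g0fin.
have K0 : (0 < K)%R by exact: lt_le_trans K1.
have [xxq|xqx'|xE] := ltgtP x xq; last by rewrite xE eqxx in xqx.
- have [G [pG gG IG [iV rV HU HV]]] := upper_weight (bW := b) (bS := false) x0 y0 yq0 xxq sumq pw
    (iW y0) (iS x0) K1 (WK x0 y0) (fun h => rW h y0) (fun h => False_ind _ (notF h))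
    mg0 g00 g0fin.
  have xq1 : (0 < xq)%R by exact: lt_trans xxq.
  have c1 : (0 <= cst ((x + y) / y))%R.
    by apply: le_trans ler01 (cst1 _); rewrite ltr_pdivlMr// mul1r ltrDr.
  exists G; rewrite /mixed_kappa xxq; split; [exact: pG|exact: gG|exact: IG|].
  split.
  + by apply: pos_measM => //; exact: pos_meas_powR.
  + by move=> /HU[].
  + by move=> _; exact: iV.
  + move=> _ yq1 Q qQ; have [_ UV _] := HU yq1; apply: le_trans (UV Q qQ) _.
    rewrite /mixed_cst /mixed_exponent xxq ltNge (ltW xxq)/= gt_eqF//.
    rewrite (powRM _ c1 (powR_ge0 _ _)) -powRrM mulrCA; apply: ler_wpM2l.
      exact: powR_ge0.
    rewrite -[X in (X * _)%R](powRr1 (ltW K0)) -powRD; last by rewrite (gt_eqF K0) implybT.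
    rewrite le_eqVlt; apply/orP; left; apply/eqP; congr (_ `^ _)%R.
    have -> : (xq = x + y - yq)%R by rewrite -sumq addrK.
    by field; rewrite !gt_eqF.
  + by move=> E; rewrite E ltxx in xq1.
  + move=> yqE; have := HV yqE; rewrite /mixed_cst /mixed_exponent xxq ltNge (ltW xxq)/=.
    by rewrite yqE eqxx.
  + by move=> hb /HU[_ _ /(_ hb)].
- have yyq : (y < yq)%R by lra.
  have yq1 : (0 < yq)%R by exact: lt_trans yyq.
  have sumq' : (yq + xq = y + x)%R by rewrite addrC sumq addrC.
  pose w' := (fun z => (w z)^-1)%R.
  have pw' : pos_meas w'.
    split=> [|z]; last by rewrite invr_gt0 pw.2.
    by apply: measurable_fun_invr; case: pw.
  have w'E (r : R) : (fun z => w' z `^ r)%R = (fun z => w z `^ (- r))%R.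
    by apply/funext => z; rewrite /w' powRVN// ltW// pw.2.
  have w'E' (r : R) : (fun z => w' z `^ (- r))%R = (fun z => w z `^ r)%R.
    by rewrite w'E opprK.
  have K1' : (1 <= K `^ (y / x))%R by apply: powR_ge1 => //; rewrite divr_ge0// ltW.
  have WK' Q : Qs Q -> (mean mu Q (fun z => w' z `^ x^-1)%R *
      mean mu Q (fun z => w' z `^ (- y^-1))%R `^ (y / x) <= K `^ (y / x))%R.
    move=> qQ; rewrite w'E w'E'.
    have m1 := mean_gt0 measurable_Qs mu_Qs qQ (pos_meas_powR (y^-1) pw) (iW y0).
    have m2 := mean_gt0 measurable_Qs mu_Qs qQ (pos_meas_powR (- x^-1) pw) (iS x0).
    exact: (powR_dual_le m1 m2 x0 y0 (WK x0 y0 Q qQ)).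
  have [] := @upper_weight y x yq xq w' (K `^ (y / x))%R false b g0 y0 x0 xq0 yyq sumq' pw'
    _ _ K1' WK' (fun h => False_ind _ (notF h)) _ mg0 g00 g0fin.
  + by rewrite w'E; exact: iS.
  + by rewrite w'E'; exact: iW.
  + by rewrite w'E' => hb; exact: rW.
  move=> G [pG gG IG [iV rV HU HV]].
  (* For [1 / w] the Muckenhoupt constant is [K ^ (y / x)], and the A_1 constant of the majorant
     contains its power [x / y], so it is linear in [K]. *)
  have cE : (cst ((y + x) / x) * (K `^ (y / x)) `^ (x / y) = cst ((x + y) / x) * K)%R.
    rewrite -powRrM (_ : y / x * (x / y) = 1)%R; last by field; rewrite !gt_eqF.
    by rewrite (powRr1 (ltW K0)) [(y + x)%R]addrC.
  rewrite cE in HU HV.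
  have vI z : (w' z * G z `^ (y - yq) = (w z * G z `^ (x - xq))^-1)%R.
    by rewrite invfM -powRN; congr (_ * _ `^ _)%R; lra.
  have v0 z : (0 <= w z * G z `^ (x - xq))%R.
    by rewrite mulr_ge0 ?powR_ge0// ltW// pw.2.
  have vE (r : R) : (fun z => (w' z * G z `^ (y - yq)) `^ r)%R =
      (fun z => (w z * G z `^ (x - xq)) `^ (- r))%R.
    by apply/funext => z; rewrite vI powRVN.
  have vE' (r : R) : (fun z => (w' z * G z `^ (y - yq)) `^ (- r))%R =
      (fun z => (w z * G z `^ (x - xq)) `^ r)%R.
    by apply/funext => z; rewrite vI powRVN// opprK.
  rewrite (vE' yq^-1)%R in iV rV HU HV; rewrite (vE xq^-1)%R in HU.
  have c1 : (0 <= cst ((x + y) / x))%R.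
    by apply: le_trans ler01 (cst1 _); rewrite ltr_pdivlMr// mul1r ltrDl.
  have xxqF : (x < xq)%R = false by rewrite ltNge (ltW xqx').
  exists G; rewrite /mixed_kappa xxqF [(x + y)%R]addrC.
  split; [exact: pG|exact: gG|exact: IG|].
  rewrite /mixed_cst /mixed_exponent xxqF xqx' (powRr1 (ltW K0)).
  have pv : pos_meas (fun z => w z * G z `^ (x - xq))%R.
    by apply: pos_measM => //; exact: pos_meas_powR.
  split; [exact: pv|by move=> _; exact: iV|by move=> /HU[]| | |by move=> E; rewrite E ltxx in yq1|].
  + move=> xq1 _ Q qQ; have [iU UV _] := HU xq1.
    have m1 := mean_gt0 measurable_Qs mu_Qs qQ (pos_meas_powR (yq^-1) pv) iV.
    have m2 := mean_gt0 measurable_Qs mu_Qs qQ (pos_meas_powR (- xq^-1) pv) iU.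
    apply: le_trans (powR_dual_le m2 m1 yq1 xq1 (UV Q qQ)) _.
    rewrite (gt_eqF xq1) (powRM _ (powR_ge0 _ _) (powR_ge0 _ _)) -!powRrM.
    rewrite (powRM _ c1 (ltW K0)) mulrCA [(y + x)%R]addrC; apply: ler_wpM2l.
      exact: powR_ge0.
    rewrite -[leRHS](powRr1 (ltW K0)) -powRD; last by rewrite (gt_eqF K0) implybT.
    (* Returning from [1 / w] raises the constant to the power [xq / yq]; the total power of [K] is
       then 1. *)
    rewrite (_ : (y / x * (xq / yq) + (x + y) * (xq^-1 - x^-1) * (xq / yq)) = 1)%R.
      exact: lexx.
    have yqE : (yq = x + y - xq)%R by rewrite -sumq addrAC subrr add0r.
    move: yq1; rewrite yqE => yq1; field.
    by rewrite (gt_eqF yq1) (gt_eqF x0) (gt_eqF xq1).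
  + by move=> xqE; have := HV xqE; rewrite xqE eqxx.
  + by move=> hb _; exact: rV.
Qed.

End extrapolation_weight.

(** * Weight constants on R^n *)

Section weight_constants.
Context {R : realType} {n : nat}.
Local Notation T := (Rn R n).
Local Notation mu := (@lebesgue_Rn R n).
Local Notation Qs := (@cubes R n).
Implicit Types (u : T -> R) (Q : set T).

Lemma avgE Q (g : T -> \bar R) : avg Q g = mavg mu Q g.
Proof. by []. Qed.

Lemma powf_EFin u (r : R) : powf (EFin \o u) r = EFin \o (fun x => u x `^ r)%R.
Proof. by []. Qed.

Lemma hoelder_conjugate_EFin (s : R) : (1 < s)%R ->
  hoelder_conjugate s%:E = (s / (s - 1))%:E.
Proof.
move=> s1; rewrite /hoelder_conjugate/= eqe gt_eqF ?(lt_trans ltr01)//.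
by rewrite inver subr_eq0 gt_eqF.
Qed.

Lemma conjugate_sub (s : R) : (1 < s)%R ->
  (1 - fine (hoelder_conjugate s%:E) = - (s - 1)^-1)%R.
Proof.
move=> s1; rewrite hoelder_conjugate_EFin//=; field.
by rewrite subr_eq0 gt_eqF.
Qed.

Lemma A_constE (s : R) u : (1 < s)%R -> A_const s (EFin \o u) =
  ereal_sup [set mavg mu Q (EFin \o u) *
    mavg mu Q (EFin \o (fun x => u x `^ (- (s - 1)^-1))%R) `^ (s - 1) | Q in Qs].
Proof. by move=> s1; rewrite /A_const (gt_eqF s1) /= (conjugate_sub s1). Qed.

Lemma weight_EFin u : pos_meas u -> weight (EFin \o u).
Proof.
move=> pu; split; first exact: pos_meas_EFin.
by apply: filterE => x /=; rewrite lte_fin ltry pu.2.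
Qed.

Lemma cube_mu Q : Qs Q -> 0 < mu Q.
Proof. by move=> /lebesgue_cubes[r r0 ->]; rewrite lte_fin. Qed.

Lemma cubes_unit : Qs (cube (fun=> 0%R) 1%R).
Proof. by exists (fun=> 0%R), 1%R. Qed.

Section A_const.
Variables (s : R) (u : T -> R).
Hypothesis s1 : (1 < s)%R.
Hypothesis pu : pos_meas u.
Let V := (fun x => u x `^ (- (s - 1)^-1))%R.
Let pV : pos_meas V. Proof. exact: pos_meas_powR. Qed.
Let s10 : (0 < s - 1)%R. Proof. by rewrite subr_gt0. Qed.

(** Both averages are positive because [u] is positive everywhere, and a positive factor times [+oo]
    is [+oo]; a finite supremum therefore forces both to be finite. *)
Lemma A_const_fin : A_const s (EFin \o u) < +oo ->
  [/\ loc_int mu Qs u, loc_int mu Qs V & forall Q, Qs Q ->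
   (mean mu Q u * mean mu Q V `^ (s - 1) <= fine (A_const s (EFin \o u)))%R].
Proof.
rewrite A_constE// -/V; set S := ereal_sup _ => Soo.
have H Q : Qs Q -> mavg mu Q (EFin \o u) * mavg mu Q (EFin \o V) `^ (s - 1) <= S.
  by move=> qQ; apply: ereal_sup_ubound; exists Q.
have up Q : Qs Q -> 0 < mavg mu Q (EFin \o u).
  by move=> qQ; exact: (mavg_gt0 measurable_cubes lebesgue_cubes).
have vp Q : Qs Q -> 0 < mavg mu Q (EFin \o V) `^ (s - 1).
  by move=> qQ; apply: poweR_gt0; exact: (mavg_gt0 measurable_cubes lebesgue_cubes).
have iu : loc_int mu Qs u.
  move=> Q qQ; have := le_lt_trans (H Q qQ) Soo; have := up Q qQ; have := vp Q qQ.
  case: (mavg mu Q (EFin \o u)) => [r| |]// v0 _; rewrite ?ltry//.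
  by rewrite gt0_mulye// ltxx.
have iV : loc_int mu Qs V.
  move=> Q qQ; have := le_lt_trans (H Q qQ) Soo; have := up Q qQ.
  case: (mavg mu Q (EFin \o V)) => [r| |]//; first by rewrite ltry.
  by rewrite poweRyr ?gt_eqF// => u0; rewrite gt0_muley// ltxx.
split => // Q qQ; have := H Q qQ; rewrite (meanE qQ pu iu) (meanE qQ pV iV).
rewrite poweR_EFin -EFinM; move: Soo; case: S H => [r _ _|//|H _]; first by rewrite lee_fin.
by have := H _ qQ; rewrite leeNy_eq => /eqP E; have := mule_gt0 (up Q qQ) (vp Q qQ); rewrite E.
Qed.

Hypothesis iu : loc_int mu Qs u.
Hypothesis iV : loc_int mu Qs V.

Lemma A_const_le (C : R) : (forall Q, Qs Q ->
  (mean mu Q u * mean mu Q V `^ (s - 1) <= C)%R) -> A_const s (EFin \o u) <= C%:E.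
Proof.
move=> H; rewrite A_constE// -/V; apply: ge_ereal_sup => _ [Q qQ <-].
by rewrite (meanE qQ pu iu) (meanE qQ pV iV) poweR_EFin -EFinM lee_fin; exact: H.
Qed.

(** The functions [Phi i] are controlled on [[1, oo)] only, so the weight constants fed to them must
    be at least 1. One cube suffices. *)
Lemma A_const_ge1 : 1 <= A_const s (EFin \o u).
Proof.
rewrite A_constE// -/V; have qQ := cubes_unit; set Q := cube _ _ in qQ.
apply: (@le_trans _ _ (mavg mu Q (EFin \o u) * mavg mu Q (EFin \o V) `^ (s - 1))).
  rewrite (meanE qQ pu iu) (meanE qQ pV iV) poweR_EFin -EFinM lee_fin.
  exact: (mean_dual_ge1 measurable_cubes lebesgue_cubes qQ pu iu s10 iV).
by apply: ereal_sup_ubound; exists Q.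
Qed.

End A_const.

Section A1_const.
Variables (u : T -> R).
Hypothesis pu : pos_meas u.
Hypothesis iu : loc_int mu Qs u.

Lemma A1_const_le (C : R) : (0 <= C)%R -> A1 mu Qs u C -> A_const 1 (EFin \o u) <= C%:E.
Proof.
move=> C0 uC; rewrite /A_const eqxx; apply: ge_ereal_sup => _ [Q qQ <-].
have mQ := mean_gt0 measurable_cubes lebesgue_cubes qQ pu iu.
rewrite avgE (meanE qQ pu iu).
apply: (@le_trans _ _ ((mean mu Q u)%:E * (C / mean mu Q u)%:E)).
  apply: lee_wpmul2l; first by rewrite lee_fin ltW.
  apply: ereal_inf_lbound => /=; apply: filterS (uC Q qQ) => x /[apply] H.
  rewrite inver gt_eqF ?pu.2// lee_fin ler_pdivlMr// ler_pdivrMl ?pu.2//.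
  by rewrite mulrC.
by rewrite -EFinM mulrCA divff ?mulr1// gt_eqF.
Qed.

(** An essential upper bound [r] of [1 / u] on the cube gives [u >= 1 / r] there, hence the mean of
    [u] is at least [1 / r]. *)
Lemma A1_const_ge1 : 1 <= A_const 1 (EFin \o u).
Proof.
rewrite /A_const eqxx; have qQ := cubes_unit; set Q := cube _ _ in qQ.
have mQ := mean_gt0 measurable_cubes lebesgue_cubes qQ pu iu.
apply: (@le_trans _ _ (avg Q (EFin \o u) * ess_sup_on Q (fun x => ((EFin \o u) x)^-1))); last first.
  by apply: ereal_sup_ubound; exists Q.
rewrite avgE (meanE qQ pu iu).
apply: (@le_trans _ _ ((mean mu Q u)%:E * ((mean mu Q u)^-1)%:E)).
  by rewrite -EFinM divff// gt_eqF.
apply: lee_wpmul2l; first by rewrite lee_fin ltW.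
apply: le_ereal_inf_tmp => -[r| |] /= H; [|by rewrite leey|]; last first.
  have [x Qx /(_ Qx)] := ae_exists (measurable_cubes qQ) (cube_mu qQ) H.
  by rewrite inver gt_eqF ?pu.2// leeNy_eq.
have r0 : (0 < r)%R.
  have [x Qx /(_ Qx)] := ae_exists (measurable_cubes qQ) (cube_mu qQ) H.
  rewrite inver gt_eqF ?pu.2// lee_fin; apply: lt_le_trans.
  by rewrite invr_gt0 pu.2.
rewrite lee_fin -[leRHS]invrK lef_pV2 ?invr_gt0//; last first.
  by rewrite qualifE /= invr_gt0.
apply: (cst_le_mean measurable_cubes lebesgue_cubes qQ pu iu).
  by rewrite invr_ge0 ltW.
apply: filterS H => x /[apply]; rewrite inver gt_eqF ?pu.2// lee_fin => Hx.
have ux := pu.2 x; rewrite -[leLHS]div1r ler_pdivrMr// mulrC.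
by rewrite -[leLHS](mulVf (lt0r_neq0 ux)) ler_pM2r.
Qed.

Lemma RH_const_le (t C : R) : (0 < t)%R -> (0 <= C)%R -> RH mu Qs u t C ->
  RH_const t%:E (EFin \o u) <= C%:E.
Proof.
move=> t0 C0 rC; apply: ge_ereal_sup => _ [Q qQ <-].
have mQ := mean_gt0 measurable_cubes lebesgue_cubes qQ pu iu.
rewrite /= !avgE (meanE qQ pu iu) inver gt_eqF// powf_EFin.
have -> : C = (C * mean mu Q u / mean mu Q u)%R by rewrite mulfK// gt_eqF.
rewrite [X in _ <= X]EFinM; apply: lee_wpmul2r; first by rewrite lee_fin invr_ge0 ltW.
have Cm : (0 <= C * mean mu Q u)%R by rewrite mulr_ge0// ltW.
rewrite -[in leRHS](powRK Cm t0) -poweR_EFin; apply: le_poweR.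
- by rewrite invr_ge0 ltW.
- by apply: mavg_ge0 => x; rewrite lee_fin powR_ge0.
- exact: rC.
Qed.

Lemma RH_const_fin (t : R) : (0 < t)%R -> RH_const t%:E (EFin \o u) < +oo ->
  exists2 C : R, (0 <= C)%R & RH mu Qs u t C.
Proof.
move=> t0; set S := RH_const _ _ => Soo.
have H Q : Qs Q -> mavg mu Q (fun x => (u x `^ t)%:E) `^ t^-1 * ((mean mu Q u)^-1)%:E <= S.
  move=> qQ; have mQ := mean_gt0 measurable_cubes lebesgue_cubes qQ pu iu.
  apply: ereal_sup_ubound; exists Q => //.
  by rewrite /= !avgE (meanE qQ pu iu) inver gt_eqF// powf_EFin.
have p0 Q : 0 <= mavg mu Q (fun x => (u x `^ t)%:E).
  by apply: mavg_ge0 => x; rewrite lee_fin powR_ge0.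
have S0 : 0 <= S.
  have qQ := cubes_unit; apply: le_trans (H _ qQ).
  apply: mule_ge0; first exact: poweR_ge0.
  by rewrite lee_fin invr_ge0; apply: ltW; exact: (mean_gt0 measurable_cubes lebesgue_cubes).
have SE : (fine S)%:E = S by rewrite fineK// ge0_fin_numE.
exists (fine S); first exact: fine_ge0.
move=> Q qQ; have mQ := mean_gt0 measurable_cubes lebesgue_cubes qQ pu iu.
have := H Q qQ; rewrite -SE lee_pdivrMr// -EFinM => H'.
rewrite -[leLHS](poweRVK (p0 Q) t0) -poweR_EFin; apply: le_poweR => //; first exact: ltW.
exact: poweR_ge0.
Qed.

Lemma RHoo_const_le (C : R) : (0 <= C)%R ->
  (forall Q, Qs Q -> {ae mu, forall x, Q x -> (u x <= C * mean mu Q u)%R}) ->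
  RH_const +oo (EFin \o u) <= C%:E.
Proof.
move=> C0 rC; apply: ge_ereal_sup => _ [Q qQ <-].
have mQ := mean_gt0 measurable_cubes lebesgue_cubes qQ pu iu.
rewrite /= !avgE (meanE qQ pu iu) inver gt_eqF//.
have -> : C = (C * mean mu Q u / mean mu Q u)%R by rewrite mulfK// gt_eqF.
rewrite [X in _ <= X]EFinM; apply: lee_wpmul2r; first by rewrite lee_fin invr_ge0 ltW.
by apply: ereal_inf_lbound => /=; apply: filterS (rC Q qQ) => x /[apply]; rewrite lee_fin.
Qed.

(** The union that defines RH_1 contains RH_oo; this brings that case to the finite exponent 2. *)
Lemma RHoo_const_fin : RH_const +oo (EFin \o u) < +oo ->
  exists2 C : R, (0 <= C)%R & RH mu Qs u 2 C.
Proof.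
set S := RH_const _ _ => Soo.
have H Q : Qs Q -> ess_sup_on Q (EFin \o u) * ((mean mu Q u)^-1)%:E <= S.
  move=> qQ; have mQ := mean_gt0 measurable_cubes lebesgue_cubes qQ pu iu.
  apply: ereal_sup_ubound; exists Q => //.
  by rewrite /= !avgE (meanE qQ pu iu) inver gt_eqF.
(* Strictly above the supremum, so that an actual essential bound, and not only the infimum of such
   bounds, lies below [C * mean]. *)
pose C := (Num.max 0 (fine S) + 1)%R.
have C0 : (0 < C)%R by rewrite ltr_wpDl// le_max lexx.
have SC : S < C%:E.
  case: S Soo @C C0 {H} => [r| |]//= _ _; last by rewrite ltNyr.
  rewrite lte_fin; apply: (@le_lt_trans _ _ (Num.max 0 r)%R); last by rewrite ltrDl.
  by rewrite le_max lexx orbT.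
exists C => [|Q qQ]; first exact: ltW.
have mQ := mean_gt0 measurable_cubes lebesgue_cubes qQ pu iu.
have Cm : (0 <= C * mean mu Q u)%R by rewrite mulr_ge0// ltW.
rewrite -(mavg_cst measurable_cubes lebesgue_cubes _ qQ).
have pu2 := pos_meas_powR 2 pu.
apply: (le_mavg_ae measurable_cubes qQ) => //.
- exact: measurable_funTS (pos_meas_EFin pu2).
- by move=> x; rewrite lee_fin powR_ge0.
- by move=> x; rewrite lee_fin powR_ge0.
have : ess_sup_on Q (EFin \o u) < (C * mean mu Q u)%:E.
  have := le_lt_trans (H Q qQ) SC.
  by rewrite lte_pdivrMr// -EFinM.
move=> /ereal_inf_lt[y Hy yC]; apply: filterS Hy => x /[apply] /= Hx.
rewrite lee_fin; apply: le_powR => //; first exact: ltW (pu.2 x).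
by rewrite -lee_fin; exact: le_trans Hx (ltW yC).
Qed.

End A1_const.

End weight_constants.

(** * Weights that agree almost everywhere *)

Lemma ae_pos_real d (T : measurableType d) (R : realType)
    (mu : {measure set T -> \bar R}) (w : T -> \bar R) :
  measurable_fun [set: T] w -> {ae mu, forall x, 0 < w x < +oo} ->
  exists2 u : T -> R, pos_meas u & {ae mu, forall x, w x = (u x)%:E}.
Proof.
move=> mw w0; pose D := [set x | 0 < w x < +oo].
have DE : D = w @^-1` (`]0, +oo[ `\` [set +oo]).
  apply/seteqP; split => x; rewrite /D/= in_itv/= andbT ltey.
    by move=> /andP[? /eqP].
  by move=> [-> /eqP].
have mD : measurable D.
  rewrite DE -[X in measurable X]setTI; apply: mw => //.
  by apply: measurableD; [exact: emeasurable_itv|exact: emeasurable_set1].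
pose u := (fun x => fine (if x \in D then w x else 1)).
have mu' : measurable_fun [set: T] u.
  apply: (measurableT_comp (fine_measurable measurableT)).
  have -> : (fun x => if x \in D then w x else 1) =
    (fun x => if (fun x => x \in D) x then w x else cst 1 x) by [].
  apply: measurable_fun_ifT => //.
  by apply: (measurable_fun_bool true); rewrite setTI preimage_mem_true.
have u0 x : (0 < u x)%R.
  rewrite /u; case: ifPn => [|_] //=; rewrite inE /D /=.
  by case: (w x) => [r| |]//= /andP[].
exists u; first by split.
apply: filterS w0 => x wx; rewrite /= /u mem_set//.
by rewrite fineK// ge0_fin_numE; case/andP: wx => // /ltW.
Qed.

Section weights_ae.
Context {R : realType} {n : nat}.
Local Notation T := (Rn R n).
Local Notation mu := (@lebesgue_Rn R n).
Implicit Types (w : T -> \bar R) (Q : set T).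

Definition ae_same w w' := [/\ measurable_fun [set: T] w, measurable_fun [set: T] w' &
  {ae mu, forall x, w x = w' x}].

Lemma ae_same_powf w w' r : ae_same w w' -> ae_same (powf w r) (powf w' r).
Proof.
move=> [mw mw' ww']; split; [exact: measurable_fun_poweR|exact: measurable_fun_poweR|].
by apply: filterS ww' => x; rewrite /powf => ->.
Qed.

Lemma ae_same_avg w w' Q : cubes Q -> ae_same w w' -> avg Q w = avg Q w'.
Proof.
move=> qQ [mw mw' ww']; congr (_ * _); apply: ae_eq_integral.
- exact: measurable_cubes.
- exact: measurable_funTS.
- exact: measurable_funTS.
- by apply: filterS ww' => x ->.
Qed.

Lemma ess_sup_on_ae (g h : T -> \bar R) Q : {ae mu, forall x, g x = h x} ->
  ess_sup_on Q g = ess_sup_on Q h.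
Proof.
move=> gh; congr ereal_inf; apply/seteqP; split => y /=.
- by apply: filterS2 gh => x ->.
- by apply: filterS2 gh => x ->.
Qed.

Lemma ae_same_A_const s w w' : ae_same w w' -> A_const s w = A_const s w'.
Proof.
move=> ww'; rewrite /A_const; case: (s == 1%R); congr ereal_sup.
  apply: eq_imagel => Q qQ; rewrite (ae_same_avg qQ ww'); congr (_ * _).
  by apply: ess_sup_on_ae; case: ww' => _ _; apply: filterS => x ->.
apply: eq_imagel => Q qQ; rewrite (ae_same_avg qQ ww'); congr (_ * _ `^ _).
exact: (ae_same_avg qQ (ae_same_powf _ ww')).
Qed.

Lemma ae_same_RH_const s w w' : ae_same w w' -> RH_const s w = RH_const s w'.
Proof.
move=> ww'; rewrite /RH_const; congr ereal_sup.
apply: eq_imagel => Q qQ; rewrite (ae_same_avg qQ ww'); congr (_ * _).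
case: s => [r| |] /=; last 2 first.
- by apply: ess_sup_on_ae; case: ww'.
- by apply: ess_sup_on_ae; case: ww'.
by rewrite (ae_same_avg qQ (ae_same_powf _ ww')).
Qed.

Lemma ae_same_weight w w' : ae_same w w' -> weight w -> weight w'.
Proof. by move=> [mw mw' ww'] [_ w0]; split => //; apply: filterS2 ww' w0 => x ->. Qed.

Lemma ae_same_in_RH_gt1 s w w' : ae_same w w' -> in_RH_gt1 s w -> in_RH_gt1 s w'.
Proof.
move=> ww' [ww wQ wR]; split; first exact: ae_same_weight ww.
- by move=> Q qQ; rewrite -(ae_same_avg qQ ww'); exact: wQ.
- by rewrite -(ae_same_RH_const _ ww').
Qed.

Lemma ae_same_in_ARH pm pp p w w' : ae_same w w' ->
  in_ARH pm pp p w -> in_ARH pm pp p w'.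
Proof.
move=> ww' [[ww wA] wR]; have wwp := ae_same_powf p ww'; split.
  by split; [exact: ae_same_weight ww|rewrite -(ae_same_A_const _ wwp)].
move: wR; rewrite /in_RH; case: (rh_exp pp p == 1) => wR.
  by have [t [t1 tR]] := wR; exists t; split; [exact: t1|exact: (ae_same_in_RH_gt1 wwp)].
exact: (ae_same_in_RH_gt1 wwp wR).
Qed.

Lemma ae_same_ARH_const pm pp p w w' : ae_same w w' ->
  ARH_const pm pp p w = ARH_const pm pp p w'.
Proof.
move=> ww'; rewrite /ARH_const (ae_same_A_const _ (ae_same_powf _ ww')).
by rewrite (ae_same_A_const _ (ae_same_powf p ww')) (ae_same_RH_const _ (ae_same_powf p ww')).
Qed.

Lemma weight_real w : weight w ->
  exists2 u : T -> R, pos_meas u & ae_same w (EFin \o u).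
Proof.
move=> [mw w0]; have [u pu wu] := ae_pos_real mw w0.
by exists u; [exact: pu|split; [exact: mw|exact: pos_meas_EFin|exact: wu]].
Qed.

End weights_ae.

(** * Exponents and their gaps to the ends of the range *)

Section exponents.
Variable R : realType.
Implicit Types (p q pm : R) (pp : \bar R).

Definition lower_gap pm p : R := (pm^-1 - p^-1)%R.
(** For [pp = +oo] the term [1 / p_+] is correct through two default values, [fine +oo = 0] and
    [0^-1 = 0]. *)
Definition upper_gap pp p : R := (p^-1 - (fine pp)^-1)%R.

Lemma upper_gap_gt0 pp p : (0 < p)%R -> p%:E < pp -> (0 < upper_gap pp p)%R.
Proof.
rewrite /upper_gap; case: pp => [P| |]//=.
  rewrite lte_fin => p0 pP; rewrite subr_gt0 ltf_pV2//.
  exact: lt_trans pP.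
by move=> p0 _; rewrite invr0 subr0 invr_gt0.
Qed.

Lemma upper_gap_le pp p : (0 < p)%R -> p%:E < pp -> (0 < p * upper_gap pp p <= 1)%R.
Proof.
move=> p0 ppp; rewrite mulr_gt0 ?upper_gap_gt0//= /upper_gap mulrBr divff ?gt_eqF//.
rewrite gerBl mulr_ge0 ?(ltW p0)// invr_ge0.
by case: pp ppp => [P| |]//= /ltW; rewrite lee_fin; apply: le_trans; exact: ltW.
Qed.

Lemma rh_expE pp p : (0 < p)%R -> p%:E < pp ->
  rh_exp pp p = ((p * upper_gap pp p)^-1)%:E.
Proof.
move=> p0; rewrite /rh_exp /upper_gap; case: pp => [P| |]//=.
  rewrite lte_fin => pP; rewrite inver gt_eqF// -EFinM.
  rewrite hoelder_conjugate_EFin; last by rewrite ltr_pdivlMr// mul1r.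
  have P0 := lt_trans p0 pP; have Pp : (P - p != 0)%R by rewrite subr_eq0 gt_eqF.
  by congr EFin; field; rewrite (gt_eqF p0) (gt_eqF P0) mulN1r Pp.
move=> _; rewrite inver gt_eqF// gt0_mulye ?lte_fin ?invr_gt0//.
by rewrite hoelder_conjugatey invr0 subr0 divff ?gt_eqF// invr1.
Qed.

(** [in_RH] reads the exponent 1 as a union of classes; below the top this reading occurs exactly
    for [p_+ = oo]. *)
Lemma rh_exp_eq1 pp p : (0 < p)%R -> p%:E < pp -> (rh_exp pp p == 1) = (pp == +oo).
Proof.
move=> p0 ppp; rewrite rh_expE// eqe invr_eq1.
move: ppp; rewrite /upper_gap; case: pp => [P| |]//=.
  rewrite lte_fin => pP; have P0 := lt_trans p0 pP.
  transitivity false; last by [].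
  rewrite mulrBr (divff (lt0r_neq0 p0)); apply/negbTE.
  by rewrite lt_eqF// ltrBlDr ltrDl divr_gt0.
by rewrite invr0 subr0 (divff (lt0r_neq0 p0)) !eqxx.
Qed.

Lemma tauE pm pp p : (0 < p)%R -> p%:E < pp ->
  tau pm pp p = (lower_gap pm p / upper_gap pp p + 1)%R.
Proof.
move=> p0 ppp; rewrite /tau rh_expE//= /lower_gap; have y0 := upper_gap_gt0 p0 ppp.
move: (upper_gap pp p) y0 => y y0.
have -> : (p / pm - 1 = p * (pm^-1 - p^-1))%R by rewrite mulrBr divff// gt_eqF.
by rewrite invfM mulrCA mulrA mulrA divff ?gt_eqF// mul1r mulrC.
Qed.

Lemma exponent_rh pp p : (0 < p)%R -> p%:E < pp ->
  (p * fine (rh_exp pp p) = (upper_gap pp p)^-1)%R.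
Proof. by move=> p0 ppp; rewrite rh_expE//= invfM mulVKf// gt_eqF. Qed.

Lemma exponent_low pm p : (0 < p)%R -> (p / pm - 1 = p * lower_gap pm p)%R.
Proof. by move=> p0; rewrite /lower_gap mulrBr divff// gt_eqF. Qed.

End exponents.

Lemma in_RH_oo (R : realType) n (w : Rn R n -> \bar R) :
  in_RH_gt1 +oo w -> in_RH +oo w.
Proof. by []. Qed.

(** * Mixed weights and the limited range classes *)

Section mixed_weights.
Context {R : realType} {n : nat}.
Local Notation T := (Rn R n).
Local Notation mu := (@lebesgue_Rn R n).
Local Notation Qs := (@cubes R n).
Variables (pm p : R) (pp : \bar R).
Hypothesis pm0 : (0 < pm)%R.
Let x := lower_gap pm p.
Let y := upper_gap pp p.
Let s := ((p * y)^-1)%R.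

Section below_top.
Hypothesis p0 : (0 < p)%R.
Hypothesis ppp : p%:E < pp.

Let y0 : (0 < y)%R. Proof. exact: upper_gap_gt0. Qed.
Let py : (0 < p * y <= 1)%R. Proof. exact: upper_gap_le. Qed.
Let s0 : (0 < s)%R. Proof. by have /andP[h _] := py; rewrite invr_gt0. Qed.
Let pys : (p * y * s = 1)%R. Proof. by rewrite divff// gt_eqF//; case/andP: py. Qed.

Let pow_s (w : T -> R) : (fun z => ((w z `^ p) `^ s)%:E) = EFin \o (fun z => w z `^ y^-1)%R.
Proof.
apply/funext => z /=; rewrite -powRrM; congr (_ `^ _)%:E.
by rewrite /s invfM mulVKf// gt_eqF.
Qed.

Let ARHE (w : T -> R) : ARH_const pm pp p (EFin \o w) =
  A_const (x / y + 1) (EFin \o (fun z => w z `^ y^-1)%R).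
Proof. rewrite /ARH_const ppp (tauE _ p0 ppp) (exponent_rh p0 ppp); exact: erefl. Qed.

(** Half of a classical equivalence: [u = w ^ p] is in A_(p/p_-) and RH_s iff [u ^ s = w ^ (1/y)] is
    in A_tau. RH_s bounds the mean of [u ^ s] by the power [s] of the mean of [u], and the first
    condition raised to [s] gives A_tau, because [p * x * s = x / y]. *)
Lemma in_ARH_mixed (w : T -> R) : (pm < p)%R -> pos_meas w ->
  in_ARH pm pp p (EFin \o w) ->
  let K := fine (ARH_const pm pp p (EFin \o w)) in
  (1 <= K)%R /\ mixed_weight mu Qs x y w K (pp == +oo).
Proof.
move=> pmp pw [[_ wA] wR].
have x0 : (0 < x)%R by rewrite subr_gt0 ltf_pV2.
pose u := (fun z => w z `^ p)%R.
have pu : pos_meas u by exact: pos_meas_powR.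
have r1 : (1 < p / pm)%R by rewrite ltr_pdivlMr// mul1r.
have [iu iV uV] := A_const_fin r1 pu wA.
pose S := (fun z => w z `^ (- x^-1))%R.
pose W := (fun z => w z `^ y^-1)%R.
have pW : pos_meas W by exact: pos_meas_powR.
have pS : pos_meas S by exact: pos_meas_powR.
have VS : (fun z => u z `^ (- (p / pm - 1)^-1))%R = S.
  apply/funext => z; rewrite /u /S -powRrM exponent_low// -/x; congr (_ `^ _)%R.
  by field; rewrite !gt_eqF.
have WS : (fun z => W z `^ (- (x / y + 1 - 1)^-1))%R = S.
  apply/funext => z; rewrite /W /S -powRrM addrK; congr (_ `^ _)%R.
  by field; rewrite !gt_eqF.
rewrite VS in iV uV.
(* For [p_+ = oo] one has [s = 1]: the quantitative condition [rs] holds with constant 1, and the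
   content of RH_1 goes into [rp]. *)
have [rs rp] : (exists2 C : R, (0 <= C)%R & RH mu Qs u s C) /\
    (pp == +oo -> RH_some mu Qs u).
  move: wR; rewrite /in_RH (rh_exp_eq1 p0 ppp) (rh_expE p0 ppp) -/y -/s.
  case: (pp =P +oo) => [ppE [t [t1 [_ _ tR]]]|_ [_ _ sR]].
    split=> [|_].
      have sE : s = 1%R by rewrite /s /y /upper_gap ppE/= invr0 subr0 divff ?invr1 ?gt_eqF.
      exists 1%R; first exact: ler01.
      move=> Q qQ; have mQ := mean_gt0 measurable_cubes lebesgue_cubes qQ pu iu.
      have -> : (fun z => (u z `^ s)%:E) = EFin \o u.
        by apply/funext => z; rewrite sE powRr1// ltW// pu.2.
      rewrite (meanE qQ pu iu) sE mul1r lee_fin powRr1 ?(ltW mQ)//.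
    case: t t1 tR => [t| |]// t1 tR.
      have [C C0 rC] := RH_const_fin pu iu (lt_trans ltr01 t1) tR.
      by exists t, C; split; [exact: t1|exact: C0|exact: rC].
    have [C C0 rC] := RHoo_const_fin pu iu tR.
    by exists 2%R, C; split; [rewrite ltr1n|exact: C0|exact: rC].
  by split => //; exact: (RH_const_fin pu iu s0 sR).
have [C C0 rC] := rs.
have WC Q : Qs Q -> mavg mu Q (EFin \o W) <= ((C * mean mu Q u) `^ s)%:E.
  by move=> qQ; have := rC Q qQ; rewrite /u pow_s.
have iW : loc_int mu Qs W.
  by move=> Q qQ; apply: le_lt_trans (WC Q qQ) _; rewrite ltry.
have tau1 : (1 < x / y + 1)%R by rewrite ltrDr divr_gt0.
have iWS : loc_int mu Qs (fun z => W z `^ (- (x / y + 1 - 1)^-1))%R.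
  by rewrite WS; exact: iV.
set K := fine _; have KE : K = fine (A_const (x / y + 1) (EFin \o W)) by rewrite /K ARHE.
have Afin : A_const (x / y + 1) (EFin \o W) < +oo.
  set A := fine _ in uV.
  apply: (@le_lt_trans _ _ ((C `^ s * A `^ s)%R%:E)); last by rewrite ltry.
  apply: (A_const_le tau1 pW iW iWS) => Q qQ; rewrite WS addrK.
  have mu1 := mean_gt0 measurable_cubes lebesgue_cubes qQ pu iu.
  have mS1 := mean_gt0 measurable_cubes lebesgue_cubes qQ pS iV.
  have := WC Q qQ; rewrite (meanE qQ pW iW) lee_fin => /(ler_wpM2r (powR_ge0 (mean mu Q S) (x / y))).
  move=> /le_trans; apply; have := uV Q qQ; rewrite exponent_low// -/x.
  move: (mean mu Q u) (mean mu Q S) mu1 mS1 => a b a0 b0 /(le_powR (ltW s0)).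
  move=> /(_ (mulr_ge0 (ltW a0) (powR_ge0 _ _))) abA.
  rewrite (powRM _ C0 (ltW a0)) -mulrA; apply: ler_wpM2l; first exact: powR_ge0.
  apply: le_trans abA; rewrite (powRM _ (ltW a0) (powR_ge0 _ _)) -powRrM.
  rewrite (_ : p * x * s = x / y)%R; first exact: lexx.
  by rewrite /s; field; rewrite !gt_eqF.
have [_ _ WK] := A_const_fin tau1 pW Afin.
split.
  rewrite KE -lee_fin fineK; first exact: (A_const_ge1 tau1 pW iW iWS).
  rewrite ge0_fin_numE//.
  exact: le_trans lee01 (A_const_ge1 tau1 pW iW iWS).
split.
- exact: pw.
- by move=> _; exact: iW.
- by move=> _; exact: iV.
- by move=> _ _ Q qQ; have := WK Q qQ; rewrite WS addrK KE.
- by move=> E; rewrite E ltxx in x0.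
- by move=> E; have := y0; rewrite E ltxx.
- move=> ppE _; have uW : (fun z => w z `^ y^-1)%R = u.
    apply/funext => z; rewrite /y /upper_gap (eqP ppE)/= invr0 subr0 invrK//.
  by rewrite uW; exact: rp.
Qed.

(** Here [u = W ^ (p * y)] with [p * y <= 1], so Jensen's inequality bounds the mean of [u] by a
    power of that of [W], which gives A_(p/p_-). The reverse Hoelder bound combines the condition on
    [W] with [mean_dual_ge1] for [u]. *)
Lemma mixed_in_ARH (v : T -> R) (L : R) (b : bool) : (pm <= p)%R ->
  (1 <= L)%R -> mixed_weight mu Qs x y v L b -> (pp == +oo -> b) ->
  in_ARH pm pp p (EFin \o v) /\ 1 <= ARH_const pm pp p (EFin \o v) <= L%:E.
Proof.
move=> pmp L1 [pv iW iS WS W1 _ rW] ppb.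
have L0 : (0 < L)%R by exact: lt_le_trans L1.
have x0 : (0 <= x)%R by rewrite subr_ge0 lef_pV2.
have {}iW := iW y0; have {}rW b' := rW b' y0.
pose u := (fun z => v z `^ p)%R; pose W := (fun z => v z `^ y^-1)%R.
have pu : pos_meas u by exact: pos_meas_powR.
have pW : pos_meas W by exact: pos_meas_powR.
have py0 : (0 < p * y)%R by have /andP[] := py.
have py01 : (0 <= p * y <= 1)%R by have /andP[h1 h2] := py; rewrite ltW.
have uE : (fun z => W z `^ (p * y))%R = u.
  by apply/funext => z; rewrite /W /u -powRrM mulrCA mulVf ?mulr1// gt_eqF.
have iu : loc_int mu Qs u.
  by rewrite -uE; exact: (loc_int_powR measurable_cubes lebesgue_cubes pW iW py01).
have muW Q : Qs Q -> (mean mu Q u <= mean mu Q W `^ (p * y))%R.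
  by move=> qQ; rewrite -uE; exact: (mean_powR measurable_cubes lebesgue_cubes pW iW py01 qQ).
pose L' := (L `^ (p * y))%R.
have L'0 : (0 <= L')%R by exact: powR_ge0.
suff [Afin rs ARH1 ARHL] : [/\ A_const (p / pm) (EFin \o u) < +oo,
   forall Q, Qs Q -> (mean mu Q W <= L * mean mu Q u `^ s)%R,
   1 <= A_const (x / y + 1) (EFin \o W) & A_const (x / y + 1) (EFin \o W) <= L%:E].
  split; last by rewrite ARHE ARH1 ARHL.
  have wu : weight (EFin \o u) by exact: weight_EFin.
  split; first by split; [exact: wu|exact: Afin].
  rewrite /in_RH (rh_exp_eq1 p0 ppp) (rh_expE p0 ppp) -/y -/s; case: ifP => [ppE|_].
    have [t [C [t1 C0 rC]]] := rW (ppb ppE).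
    have uW : W = u.
      by apply/funext => z; rewrite /W /y /upper_gap (eqP ppE)/= invr0 subr0 invrK.
    exists t%:E; split; first by rewrite lte_fin.
    split; [exact: wu|exact: iu|].
    have rC' : RH mu Qs u t C by rewrite -uW.
    apply: le_lt_trans (RH_const_le pu iu (lt_trans ltr01 t1) C0 rC') _.
    by rewrite ltry.
  split; [exact: wu|exact: iu|].
  have rC : RH mu Qs u s L'.
    move=> Q qQ; have mQ := mean_gt0 measurable_cubes lebesgue_cubes qQ pu iu.
    rewrite /u pow_s (meanE qQ pW iW) lee_fin (powRM _ L'0 (ltW mQ)) /L' -powRrM pys.
    by rewrite (powRr1 (ltW L0)); exact: rs.
  apply: le_lt_trans (RH_const_le pu iu s0 L'0 rC) _.
  by rewrite ltry.
(* [x = 0] means [p = p_-]. The class is A_1, and the lower bound for the mean of [u] comes from the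
   essential infimum of [W] instead of duality. *)
have [x00|xn0] := eqVneq x 0%R.
  have {}W1 := W1 x00; have ppm : (p / pm = 1)%R.
    have := exponent_low pm p0; rewrite -/x x00 mulr0 => /eqP.
    by rewrite subr_eq0 => /eqP.
  rewrite ppm x00 mul0r add0r; split.
  - apply: (@le_lt_trans _ _ L'%:E); last by rewrite ltry.
    apply: (A1_const_le pu iu L'0) => Q qQ; apply: filterS (W1 Q qQ) => z /[apply] Wz.
    have mW := mean_gt0 measurable_cubes lebesgue_cubes qQ pW iW.
    apply: le_trans (muW Q qQ) _; apply: le_trans (le_powR (ltW py0) (ltW mW) Wz) _.
    rewrite (powRM _ (ltW L0) (ltW (pW.2 z))) -[u](uE).
    exact: lexx.
  - move=> Q qQ; have mW := mean_gt0 measurable_cubes lebesgue_cubes qQ pW iW.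
    have mQ := mean_gt0 measurable_cubes lebesgue_cubes qQ pu iu.
    have H : ((L^-1 * mean mu Q W) `^ (p * y) <= mean mu Q u)%R.
      apply: (cst_le_mean measurable_cubes lebesgue_cubes qQ pu iu); first exact: powR_ge0.
      apply: filterS (W1 Q qQ) => z /[apply] Wz; rewrite -uE; apply: le_powR.
      - exact: ltW.
      - by rewrite mulr_ge0 ?invr_ge0 ?(ltW L0) ?(ltW mW).
      - by rewrite ler_pdivrMl.
    have := le_powR (ltW s0) (powR_ge0 _ _) H; rewrite -powRrM pys powRr1.
      by rewrite ler_pdivrMl.
    by rewrite mulr_ge0 ?invr_ge0 ?(ltW L0) ?(ltW mW).
  - exact: (A1_const_ge1 pW iW).
  - exact: (A1_const_le pW iW (ltW L0) W1).
have x1 : (0 < x)%R by rewrite lt0r xn0.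
have {}iS := iS x1; have {}WS := WS x1 y0.
pose S := (fun z => v z `^ (- x^-1))%R.
have pS : pos_meas S by exact: pos_meas_powR.
have WS' Q : Qs Q -> (mean mu Q W * mean mu Q S `^ (x / y) <= L)%R by exact: (WS Q).
have ppm : (1 < p / pm)%R by rewrite -subr_gt0 exponent_low// mulr_gt0.
have uS : (fun z => u z `^ (- (p / pm - 1)^-1))%R = S.
  apply/funext => z; rewrite /u /S -powRrM exponent_low// -/x; congr (_ `^ _)%R.
  by field; rewrite !gt_eqF.
have WSE : (fun z => W z `^ (- (x / y + 1 - 1)^-1))%R = S.
  apply/funext => z; rewrite /W /S -powRrM addrK; congr (_ `^ _)%R.
  by field; rewrite !gt_eqF.
have tau1 : (1 < x / y + 1)%R by rewrite ltrDr divr_gt0.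
have iu' : loc_int mu Qs (fun z => u z `^ (- (p / pm - 1)^-1))%R.
  by rewrite uS; exact: iS.
have iW' : loc_int mu Qs (fun z => W z `^ (- (x / y + 1 - 1)^-1))%R.
  by rewrite WSE; exact: iS.
have pxy : (x / y * (p * y) = p * x)%R by field; rewrite gt_eqF.
split.
- apply: (@le_lt_trans _ _ L'%:E); last by rewrite ltry.
  apply: (A_const_le ppm pu iu iu') => Q qQ; rewrite uS exponent_low// -/x.
  have mW := mean_gt0 measurable_cubes lebesgue_cubes qQ pW iW.
  have mS := mean_gt0 measurable_cubes lebesgue_cubes qQ pS iS.
  apply: le_trans (ler_wpM2r (powR_ge0 _ _) (muW Q qQ)) _.
  have := WS' Q qQ.
  move: (mean mu Q W) (mean mu Q S) mW mS => a c a0 c0.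
  move=> /(le_powR (ltW py0) (mulr_ge0 (ltW a0) (powR_ge0 _ _))).
  by rewrite (powRM _ (ltW a0) (powR_ge0 _ _)) -[((c `^ (x / y)) `^ _)%R]powRrM pxy.
- move=> Q qQ; have mW := mean_gt0 measurable_cubes lebesgue_cubes qQ pW iW.
  have mQ := mean_gt0 measurable_cubes lebesgue_cubes qQ pu iu.
  have mS := mean_gt0 measurable_cubes lebesgue_cubes qQ pS iS.
  have px0 : (0 < p / pm - 1)%R by rewrite subr_gt0.
  have := mean_dual_ge1 measurable_cubes lebesgue_cubes qQ pu iu px0 iu'.
  rewrite uS (exponent_low pm p0) -/x; have := WS' Q qQ.
  move: (mean mu Q W) (mean mu Q S) (mean mu Q u) mW mS mQ => a c e a0 c0 e0 H1.
  move=> /(le_powR (ltW s0) ler01); rewrite powR1 (powRM _ (ltW e0) (powR_ge0 _ _)).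
  rewrite -[((c `^ _) `^ _)%R]powRrM (_ : p * x * s = x / y)%R; last first.
    by rewrite -pxy -mulrA pys mulr1.
  move=> /(ler_wpM2l (ltW a0)); rewrite mulr1 => /le_trans; apply.
  rewrite mulrCA mulrC; apply: ler_wpM2r H1.
  exact: powR_ge0.
- exact: (A_const_ge1 tau1 pW iW iW').
- apply: (A_const_le tau1 pW iW iW') => Q qQ; rewrite WSE addrK.
  exact: WS.
Qed.

End below_top.

(** At [p = p_+] the weight [u = v ^ p] is [H ^ (- p * x)] with [H] in A_1, so on each cube it is at
    most [(L / mean H) ^ (p * x)]. This one pointwise bound yields both the A and the RH_oo
    condition. *)
Lemma mixed_in_ARH_top (v : T -> R) (L : R) (b : bool) : p%:E = pp -> (pm < p)%R ->
  (1 <= L)%R -> mixed_weight mu Qs x y v L b ->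
  in_ARH pm pp p (EFin \o v) /\
  1 <= ARH_const pm pp p (EFin \o v) <= (L `^ (p * x))%:E.
Proof.
move=> ppE pmp L1 [pv _ iS _ _ V1 _].
have p0 : (0 < p)%R by exact: lt_trans pmp.
have y00 : y = 0%R by rewrite /y /upper_gap -ppE subrr.
have x0 : (0 < x)%R by rewrite subr_gt0 ltf_pV2.
have L0 : (0 < L)%R by exact: lt_le_trans L1.
have {}iS := iS x0; have {}V1 := V1 y00.
pose H := (fun z => v z `^ (- x^-1))%R.
have pH : pos_meas H by exact: pos_meas_powR.
pose u := (fun z => v z `^ p)%R.
have pu : pos_meas u by exact: pos_meas_powR.
have px0 : (0 < p * x)%R by rewrite mulr_gt0.
have ppm : (1 < p / pm)%R by rewrite ltr_pdivlMr// mul1r.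
have uH : (fun z => u z `^ (- (p / pm - 1)^-1))%R = H.
  apply/funext => z; rewrite /u /H -powRrM exponent_low// -/x; congr (_ `^ _)%R.
  by field; rewrite !gt_eqF.
have Hu z : u z = (H z `^ (- (p * x)))%R.
  by rewrite /u /H -powRrM; congr (_ `^ _)%R; field; rewrite gt_eqF.
have ule Q : Qs Q -> {ae mu, forall z, Q z -> (u z <= (L / mean mu Q H) `^ (p * x))%R}.
  move=> qQ; have mH := mean_gt0 measurable_cubes lebesgue_cubes qQ pH iS.
  apply: filterS (V1 Q qQ) => z /[apply] Hz; have hz := pH.2 z.
  rewrite Hu -(powRVN _ (ltW hz)); apply: le_powR; first exact: ltW.
    by rewrite invr_ge0 ltW.
  by rewrite ler_pdivlMr// ler_pdivrMl// mulrC.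
have uavg Q : Qs Q -> mavg mu Q (EFin \o u) <= ((L / mean mu Q H) `^ (p * x))%:E.
  move=> qQ; apply: (mavg_le_cst measurable_cubes lebesgue_cubes qQ pu (ule Q qQ)).
  exact: powR_ge0.
have iu : loc_int mu Qs u.
  by move=> Q qQ; apply: le_lt_trans (uavg Q qQ) _; rewrite ltry.
have iu' : loc_int mu Qs (fun z => u z `^ (- (p / pm - 1)^-1))%R.
  by rewrite uH; exact: iS.
have A1u : A_const (p / pm) (EFin \o u) <= (L `^ (p * x))%:E.
  apply: (A_const_le ppm pu iu iu') => Q qQ; rewrite uH exponent_low// -/x.
  have := uavg Q qQ; rewrite (meanE qQ pu iu) lee_fin.
  have mH := mean_gt0 measurable_cubes lebesgue_cubes qQ pH iS.
  move: (mean mu Q H) mH => h h0 /(ler_wpM2r (powR_ge0 h (p * x))) /le_trans; apply.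
  rewrite -powRM ?(ltW h0) ?divr_ge0 ?(ltW L0) ?(ltW h0)//.
  by rewrite divfK ?lexx// gt_eqF.
have RHu : RH_const +oo (EFin \o u) <= (L `^ (p * x))%:E.
  apply: (RHoo_const_le pu iu (powR_ge0 _ _)) => Q qQ.
  have mH := mean_gt0 measurable_cubes lebesgue_cubes qQ pH iS.
  have mQ := mean_gt0 measurable_cubes lebesgue_cubes qQ pu iu.
  have rx : (0 < p / pm - 1)%R by rewrite subr_gt0.
  have := mean_dual_ge1 measurable_cubes lebesgue_cubes qQ pu iu rx iu'.
  rewrite uH exponent_low// -/x => H1; apply: filterS (ule Q qQ) => z /[apply] /le_trans; apply.
  move: (mean mu Q H) (mean mu Q u) mH mQ H1 => h a h0 a0 H1.
  rewrite (powRM _ (ltW L0) _) ?invr_ge0 ?(ltW h0)//; apply: ler_wpM2l; first exact: powR_ge0.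
  rewrite (powRVinv _ (ltW h0)) -[leLHS]div1r ler_pdivrMr//.
  exact: powR_gt0.
have rhE : rh_exp pp p = +oo.
  rewrite /rh_exp -ppE inver gt_eqF// -EFinM divff ?gt_eqF//.
  exact: hoelder_conjugate1.
have wu : weight (EFin \o u) by exact: weight_EFin.
have Lfin : (L `^ (p * x))%:E < +oo by rewrite ltry.
split.
  split; first by split; [exact: wu|exact: le_lt_trans A1u Lfin].
  rewrite rhE; apply: in_RH_oo.
  by split; [exact: wu|exact: iu|exact: le_lt_trans RHu Lfin].
rewrite /ARH_const -ppE ltxx ppE rhE ge_max A1u RHu !andbT.
by rewrite le_max (A_const_ge1 ppm pu iu iu').
Qed.

End mixed_weights.

(** * Extrapolation weights on R^n *)

Section extrapolation_weight_Rn.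
Context {R : realType} {n : nat}.
Local Notation T := (Rn R n).
Local Notation mu := (@lebesgue_Rn R n).
Local Notation Qs := (@cubes R n).
Local Notation cst := (@majorant_const R n).

Lemma majorant_const_ge1 (t : R) : (1 < t)%R -> (1 <= cst t)%R.
Proof.
move=> t1; have [] := @buckley_const_le R n t t t1 (lexx t).
  by lra.
by move: (12 ^+ n * _)%R => b b1; apply: le_trans; lra.
Qed.

Lemma mixed_cst_ge1 (x y xq yq : R) : (0 < x)%R -> (0 < y)%R -> (0 <= xq)%R ->
  (0 <= yq)%R -> (xq + yq = x + y)%R -> (1 <= mixed_cst cst x y xq yq)%R.
Proof.
move=> x0 y0 xq0 yq0 sumq; rewrite /mixed_cst.
have c1 : (1 <= cst ((x + y) / y))%R.
  by apply: majorant_const_ge1; rewrite ltr_pdivlMr// mul1r ltrDr.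
have c2 : (1 <= cst ((x + y) / x))%R.
  by apply: majorant_const_ge1; rewrite ltr_pdivlMr// mul1r ltrDl.
case: ltP => xxq.
  case: eqP => [_|/eqP yqn]; first exact: c1.
  have yq1 : (0 < yq)%R by rewrite lt0r yqn.
  apply: powR_ge1 => //; rewrite mulr_ge0//; first by rewrite addr_ge0 ?ltW.
  by rewrite subr_ge0 lef_pV2//; lra.
case: eqP => [_|/eqP xqn]; first exact: c2.
have xq1 : (0 < xq)%R by rewrite lt0r xqn.
apply: powR_ge1 => //; rewrite mulr_ge0//; last by rewrite divr_ge0.
rewrite mulr_ge0//; first by rewrite addr_ge0 ?ltW.
by rewrite subr_ge0 lef_pV2.
Qed.

(** The power [q * lower_gap pm q] at [q = p_+] comes from [mixed_in_ARH_top]. The maximum with 1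
    makes the constant at least 1 for all arguments, admissible or not. *)
Definition extrap_const (p q pm : R) (pp : \bar R) : R :=
  let c := mixed_cst cst (lower_gap pm p) (upper_gap pp p)
    (lower_gap pm q) (upper_gap pp q) in
  Num.max 1%R (if q%:E < pp then c else (c `^ (q * lower_gap pm q))%R).

Lemma extrap_const_ge1 p q pm pp : (1 <= extrap_const p q pm pp)%R.
Proof. by rewrite /extrap_const le_max lexx. Qed.

Lemma tau'E pm pp (p : R) : (0 < p)%R -> (0 < lower_gap pm p)%R -> p%:E < pp ->
  tau' pm pp p = ((lower_gap pm p + upper_gap pp p) / lower_gap pm p)%R.
Proof.
move=> p0 x0 ppp; rewrite /tau' tauE//; have y0 := upper_gap_gt0 p0 ppp.
move: (lower_gap pm p) (upper_gap pp p) x0 y0 => x y x0 y0.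
rewrite hoelder_conjugate_EFin/=; last by rewrite ltrDr divr_gt0.
by field; rewrite !gt_eqF.
Qed.

Lemma extrapolation_weight_Rn (p q pm : R) (pp : \bar R) (w : T -> R) (g0 : T -> \bar R) :
  (0 < pm)%R -> (pm < p)%R -> p%:E < pp -> (pm <= q)%R -> q%:E <= pp -> p != q ->
  pos_meas w -> in_ARH pm pp p (EFin \o w) ->
  measurable_fun [set: T] g0 -> (forall z, 0 <= g0 z) -> 0 < \int[mu]_z g0 z < +oo ->
  exists G : T -> R, [/\ pos_meas G, {ae mu, forall z, g0 z <= (G z)%:E},
    \int[mu]_z (G z)%:E <=
      (2 `^ (if (p < q)%R then tau pm pp p else tau' pm pp p))%:E * \int[mu]_z g0 z &
    let v := (fun z => w z * G z `^ (q^-1 - p^-1))%R in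
    [/\ pos_meas v, in_ARH pm pp q (EFin \o v) &
     (1 <= fine (ARH_const pm pp q (EFin \o v)) <=
      extrap_const p q pm pp *
      fine (ARH_const pm pp p (EFin \o w)) `^ gamma pm pp p q)%R]].
Proof.
move=> pm0 pmp ppp pmq qpp pq pw wARH mg0 g00 g0fin.
have p0 : (0 < p)%R by exact: lt_trans pmp.
have q0 : (0 < q)%R by exact: lt_le_trans pmq.
have := in_ARH_mixed pm0 p0 ppp pmp pw wARH; cbv zeta.
generalize (fine (ARH_const pm pp p (EFin \o w))) => K [K1 mw].
have K0 : (0 < K)%R by exact: lt_le_trans K1.
have x0 : (0 < lower_gap pm p)%R by rewrite subr_gt0 ltf_pV2.
have y0 : (0 < upper_gap pp p)%R by exact: upper_gap_gt0.
have xq0 : (0 <= lower_gap pm q)%R by rewrite subr_ge0 lef_pV2.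
have yq0 : (0 <= upper_gap pp q)%R.
  move: qpp; rewrite le_eqVlt => /orP[/eqP <-|qpp]; first by rewrite /upper_gap subrr.
  exact/ltW/upper_gap_gt0.
have sumq : (lower_gap pm q + upper_gap pp q = lower_gap pm p + upper_gap pp p)%R.
  by rewrite /lower_gap /upper_gap; ring.
have xqx : (lower_gap pm q != lower_gap pm p)%R.
  apply: contra pq => /eqP; rewrite /lower_gap => /addrI/oppr_inj/invr_inj ->.
  exact: eqxx.
have dE : (lower_gap pm p - lower_gap pm q = q^-1 - p^-1)%R by rewrite /lower_gap; ring.
have [G [pG gG IG]] := extrapolation_weight measurable_cubes lebesgue_cubes
  majorant_const_ge1 (@A1_majorant_Rn R n) x0 y0 xq0 yq0 xqx sumq K1 mw mg0 g00 g0fin.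
rewrite dE => mv; exists G; split; [exact: pG|exact: gG| |].
  have -> : (p < q)%R = (lower_gap pm p < lower_gap pm q)%R.
    by rewrite /lower_gap ltrD2l ltrN2 ltf_pV2.
  move: IG; rewrite /mixed_kappa (tauE _ p0 ppp) (tau'E p0 x0 ppp).
  rewrite (_ : lower_gap pm p / upper_gap pp p + 1 =
    (lower_gap pm p + upper_gap pp p) / upper_gap pp p)%R//.
  by rewrite (mulrDl (lower_gap pm p)) (divff (lt0r_neq0 y0)).
cbv zeta; pose v := (fun z => w z * G z `^ (q^-1 - p^-1))%R.
have pv := mixed_meas mv.
have c1 := mixed_cst_ge1 x0 y0 xq0 yq0 sumq.
set c := mixed_cst _ _ _ _ _ in c1 mv.
have c0 : (0 <= c)%R by exact: le_trans c1.
have e0 : (0 <= mixed_exponent (lower_gap pm p) (upper_gap pp p) (lower_gap pm q) (upper_gap pp q))%R.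
  rewrite /mixed_exponent; case: ifP => _; first exact: ler01.
  by case: ifP => _; rewrite divr_ge0 ?mulr_ge0 ?(ltW x0) ?(ltW y0).
have L1 : (1 <= c * K `^ mixed_exponent (lower_gap pm p) (upper_gap pp p)
    (lower_gap pm q) (upper_gap pp q))%R.
  by rewrite mulr_ege1// powR_ge1.
have fin_bounds (A : \bar R) (B : R) : 1 <= A <= B%:E -> (1 <= fine A <= B)%R.
  by case: A => [a| |]// /andP[].
move: qpp; rewrite le_eqVlt => /orP[/eqP qppE|qpp].
  have pmq' : (pm < q)%R by rewrite -lte_fin qppE (lt_trans _ ppp)// lte_fin.
  have [vA] := mixed_in_ARH_top pm0 qppE pmq' L1 mv.
  move=> /fin_bounds/andP[vA1 vA2]; split; [exact: pv|exact: vA|].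
  rewrite vA1; apply: le_trans vA2 _.
  have yqE : upper_gap pp q = 0%R by rewrite /upper_gap -qppE subrr.
  have qF : (q%:E < pp) = false by rewrite -qppE ltxx.
  rewrite (powRM _ c0 (powR_ge0 _ _)) /extrap_const qF -/c.
  apply: ler_pM; rewrite ?powR_ge0//; first by rewrite le_max lexx orbT.
  rewrite -powRrM le_eqVlt; apply/orP; left; apply/eqP; congr (_ `^ _)%R.
  (* At [q = p_+] the factor [1/p_- - 1/p_+] of [gamma] is the lower gap of [q]. *)
  have fE : (pm^-1 - (fine pp)^-1)%R = lower_gap pm q by rewrite -qppE.
  have xF : (lower_gap pm q < lower_gap pm p)%R = false.
    apply/negbTE; rewrite -leNgt /lower_gap lerD2l lerN2 lef_pV2//.
    by rewrite -lee_fin qppE ltW.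
  rewrite /gamma qF fE (tauE _ p0 ppp) addrK /mixed_exponent yqE eqxx xF invf_div.
  by move: (_ / _)%R (lower_gap pm q) => a b; ring.
have yq1 : (0 < upper_gap pp q)%R by exact: upper_gap_gt0.
have [//|vA] := mixed_in_ARH pm0 q0 qpp pmq L1 mv _.
move=> /fin_bounds/andP[vA1 vA2]; split; [exact: pv|exact: vA|].
rewrite vA1; apply: le_trans vA2 _; rewrite /extrap_const qpp -/c.
apply: ler_pM; rewrite ?powR_ge0//; first by rewrite le_max lexx orbT.
(* [mixed_exponent] is one of the two terms of the maximum in [gamma], namely 1 if the exponent is
   lowered. *)
apply: ler_powR => //; rewrite /gamma qpp !tauE// !addrK /mixed_exponent.
case: ifP => _; first by rewrite le_max lexx.
rewrite gt_eqF// le_max; apply/orP; right.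
rewrite le_eqVlt; apply/orP; left; apply/eqP.
by field; rewrite !gt_eqF.
Qed.

End extrapolation_weight_Rn.

(** * Extrapolation in one slot *)

Section norm_step.
Context d (T : measurableType d) (R : realType).
Variable mu : {sigma_finite_measure set T -> \bar R}.
Implicit Types (f F : T -> \bar R) (G w : T -> R).

(** The exponent [r] may be below 1, as [harm] of several exponents can be, so the arguments rest on
    monotonicity, Hoelder's inequality and monotone convergence. Weights are multiplied into the
    function. *)
Definition nrm (r : R) f : \bar R := (\int[mu]_x f x `^ r) `^ r^-1.

Lemma nrm_ge0 r f : 0 <= nrm r f.
Proof. exact: poweR_ge0. Qed.

Lemma nrmK r f : (0 < r)%R -> nrm r f `^ r = \int[mu]_x f x `^ r.
Proof.
by move=> r0; rewrite /nrm poweRVK//; apply: integral_ge0 => x _; exact: poweR_ge0.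
Qed.

Lemma le_nrm r f g : (0 < r)%R -> measurable_fun [set: T] f ->
  measurable_fun [set: T] g -> (forall x, 0 <= f x) -> (forall x, 0 <= g x) ->
  {ae mu, forall x, f x <= g x} -> nrm r f <= nrm r g.
Proof.
move=> r0 mf mg f0 g0 fg; apply: le_poweR.
- by rewrite invr_ge0 ltW.
- by apply: integral_ge0 => x _; exact: poweR_ge0.
apply: ae_ge0_le_integral => //.
- by move=> x _; exact: poweR_ge0.
- exact: measurable_fun_poweR.
- by move=> x _; exact: poweR_ge0.
- exact: measurable_fun_poweR.
by apply: filterS fg => x fg _; apply: le_poweR => //; exact: ltW.
Qed.

Lemma nrm_eq0 r f : (0 < r)%R -> measurable_fun [set: T] f -> (forall x, 0 <= f x) ->
  nrm r f = 0 -> {ae mu, forall x, f x = 0}.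
Proof.
move=> r0 mf f0 N0; have I0 : \int[mu]_x f x `^ r = 0.
  by rewrite -nrmK// N0 poweR0r// gt_eqF.
have := integral_eq0_ae measurableT (measurable_fun_poweR r mf) (fun x => poweR_ge0 _ _) I0.
apply: filterS => x /(_ I) => /eqP; rewrite poweR_eq0//.
by case/andP => /eqP.
Qed.

Lemma nrm_ae0 r f : (0 < r)%R -> measurable_fun [set: T] f -> (forall x, 0 <= f x) ->
  {ae mu, forall x, f x = 0} -> nrm r f = 0.
Proof.
move=> r0 mf f0 fae; rewrite /nrm integral_ae0 ?poweR0r ?invr_eq0 ?gt_eqF//.
- exact: measurable_fun_poweR.
- by move=> x; exact: poweR_ge0.
- by apply: filterS fae => x -> _; rewrite poweR0r// gt_eqF.
Qed.

Lemma nrm_mul_powR (r s dl : R) f G : (0 < r)%R -> (0 < s)%R -> (0 <= dl)%R ->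
  (r^-1 = s^-1 + dl)%R -> measurable_fun [set: T] f -> (forall x, 0 <= f x) ->
  pos_meas G ->
  nrm r (fun x => f x * (G x `^ dl)%:E) <= nrm s f * (\int[mu]_x (G x)%:E) `^ dl.
Proof.
move=> r0 s0 dl0 rs mf f0 pG.
have G0 x : 0 <= (G x)%:E by rewrite lee_fin ltW// pG.2.
have dlE : (dl = r^-1 - s^-1)%R by rewrite rs addrAC subrr add0r.
have l1 : (1 - r / s = dl * r)%R by rewrite dlE; field; rewrite !gt_eqF.
have l01 : (0 <= r / s <= 1)%R.
  rewrite divr_ge0 ?(ltW r0) ?(ltW s0)//= -subr_ge0 l1 mulr_ge0//.
  exact: ltW.
have E x : (f x * (G x `^ dl)%:E) `^ r = (f x `^ s) `^ (r / s) * (G x)%:E `^ (1 - r / s).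
  rewrite -poweR_EFin poweRM//; last exact: poweR_ge0.
  by rewrite -!poweRrM l1 mulrCA divff ?mulr1 ?gt_eqF.
rewrite /nrm; under eq_integral do rewrite E.
have I1 : 0 <= \int[mu]_x f x `^ s by apply: integral_ge0 => x _; exact: poweR_ge0.
have I2 : 0 <= \int[mu]_x (G x)%:E by apply: integral_ge0.
apply: (@le_trans _ _ (((\int[mu]_x f x `^ s) `^ (r / s) *
   (\int[mu]_x (G x)%:E) `^ (1 - r / s)) `^ r^-1)).
  apply: le_poweR; first by rewrite invr_ge0 ltW.
    by apply: integral_ge0 => x _; apply: mule_ge0; exact: poweR_ge0.
  apply: hoelder_geom => //; first exact: measurable_fun_poweR.
  - exact: pos_meas_EFin.
  - by move=> x; exact: poweR_ge0.
rewrite poweRM ?poweR_ge0// -!poweRrM l1.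
rewrite (_ : r / s * r^-1 = s^-1)%R; last by field; rewrite !gt_eqF.
by rewrite mulfK// gt_eqF.
Qed.

(** The functions [min(f, j)], cut off to sets of finite measure, increase to [f] and have finite
    power integrals. *)
Lemma nrm_le_truncated r f (M : \bar R) : (0 < r)%R -> measurable_fun [set: T] f ->
  (forall x, 0 <= f x) ->
  (forall u : T -> \bar R, measurable_fun [set: T] u -> (forall x, 0 <= u x) ->
    (forall x, u x <= f x) -> \int[mu]_x u x `^ r < +oo -> nrm r u <= M) ->
  nrm r f <= M.
Proof.
move=> r0 mf f0 H.
have /sigma_finiteP[D [DT ndD Dfin]] := sigma_finiteT mu.
pose u (j : nat) x := mine (f x) j%:R%:E * (\1_(D j) x)%:E.
have mD j : measurable (D j) by have [] := Dfin j.
have mu_ j : measurable_fun [set: T] (u j).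
  apply: emeasurable_funM; first by apply: measurable_mine => //; exact: measurable_cst.
  by apply/measurable_EFinP; exact: measurable_indic.
have m0 j x : 0 <= mine (f x) j%:R%:E by rewrite le_min f0 lee_fin ler0n.
have u0 j x : 0 <= u j x by apply: mule_ge0 => //; rewrite lee_fin.
have uf j x : u j x <= f x.
  rewrite /u indicE; case: (x \in D j); rewrite ?mule1 ?mule0//.
  by rewrite ge_min lexx.
have umono x : {homo u ^~ x : i j / (i <= j)%N >-> i <= j}.
  move=> i j ij; rewrite /u; apply: lee_pmul => //.
    by rewrite le_min ge_min lexx/= ge_min lee_fin ler_nat ij orbT.
  rewrite lee_fin !indicE; have /subsetPset Dij := ndD _ _ ij.
  case: (boolP (x \in D i)) => //; rewrite inE => /Dij Dj.
  by rewrite mem_set.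
have ufin j : \int[mu]_x u j x `^ r < +oo.
  apply: (@le_lt_trans _ _ (\int[mu]_(x in D j) cst ((j%:R `^ r)%R%:E) x)); last first.
    rewrite integral_cst//; have [_ Dj] := Dfin j.
    by rewrite lte_mul_pinfty// ?lee_fin ?powR_ge0.
  rewrite [leRHS]integral_mkcond; apply: ge0_le_integral => //.
  - by move=> x _; exact: poweR_ge0.
  - exact: measurable_fun_poweR.
  - by apply/(measurable_restrictT _ (mD j)); exact: measurable_cst.
  - move=> x _; rewrite patchE /u indicE; case: (x \in D j).
      rewrite mule1 -poweR_EFin; apply: le_poweR => //; first exact: ltW.
      by rewrite ge_min lexx orbT.
    by rewrite mule0 poweR0r// gt_eqF.
have ulim x : u j x `^ r @[j --> \oo] --> f x `^ r.
  have [k _ Dk] : (\bigcup_j D j) x by rewrite -DT.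
  have uE j : (k <= j)%N -> u j x = mine (f x) j%:R%:E.
    move=> kj; rewrite /u indicE mem_set ?mule1//.
    by have /subsetPset Dkj := ndD _ _ kj; exact: Dkj.
  have := f0 x; case fx : (f x) => [a| |]// a0.
    apply: cvg_near_cst; near=> j; rewrite uE; last by near: j; exists k.
    rewrite fx min_l// lee_fin; near: j; exact: nbhs_infty_ger.
  rewrite poweRyr ?gt_eqF//; apply/cvgeyPge => A; near=> j.
  rewrite uE; last by near: j; exists k.
  rewrite fx min_r ?leey// poweR_EFin lee_fin; apply: le_trans (ler_norm A) _.
  rewrite -[leLHS](powRVK (normr_ge0 A) r0); apply: le_powR.
  - exact: ltW.
  - exact: powR_ge0.
  - near: j; exact: nbhs_infty_ger.
have Mr j : \int[mu]_x u j x `^ r <= M `^ r.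
  rewrite -nrmK//; apply: le_poweR; [exact: ltW|exact: nrm_ge0|].
  by apply: H.
have M0 : 0 <= M by apply: le_trans (nrm_ge0 r (u 0%N)) (H _ _ _ _ _).
rewrite -[M](poweRK M0 r0); apply: le_poweR; first by rewrite invr_ge0 ltW.
  by apply: integral_ge0 => x _; exact: poweR_ge0.
have -> : \int[mu]_x f x `^ r = \int[mu]_x limn (fun j => u j x `^ r).
  by apply: eq_integral => x _; apply/esym/cvg_lim.
rewrite monotone_convergence//.
- apply: lime_le; last by near=> j; exact: Mr.
  apply: ereal_nondecreasing_is_cvgn => i j ij; apply: ge0_le_integral => //.
  + by move=> x _; exact: poweR_ge0.
  + exact: measurable_fun_poweR.
  + exact: measurable_fun_poweR.
  + by move=> x _; apply: le_poweR; [exact: ltW|exact: u0|exact: umono].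
- by move=> j; exact: measurable_fun_poweR.
- by move=> j x _; exact: poweR_ge0.
- move=> x _ i j ij; apply: le_poweR => //; first exact: ltW.
  exact: umono.
Unshelve. all: by end_near. Qed.

Section off_diagonal_step.
Variables (p q th e kappa : R) (w : T -> R) (F f1 : T -> \bar R) (B : \bar R).
Hypothesis p0 : (0 < p)%R.
Hypothesis q0 : (0 < q)%R.
Hypothesis th0 : (0 <= th)%R.
Hypothesis kappa_e : (kappa * `|p^-1 - q^-1| <= e)%R.
Hypothesis pw : pos_meas w.
Hypothesis mF : measurable_fun [set: T] F.
Hypothesis F0 : forall x, 0 <= F x.
Hypothesis mf1 : measurable_fun [set: T] f1.
Hypothesis f10 : forall x, 0 <= f1 x.
Hypothesis B0 : 0 <= B.
Let q' := ((q^-1 + th)^-1)%R.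
Let p' := ((p^-1 + th)^-1)%R.
Hypothesis hyp : forall g0 : T -> \bar R, measurable_fun [set: T] g0 ->
  (forall x, 0 <= g0 x) -> 0 < \int[mu]_x g0 x < +oo ->
  exists G : T -> R, [/\ pos_meas G, {ae mu, forall x, g0 x <= (G x)%:E},
    \int[mu]_x (G x)%:E <= (2 `^ kappa)%:E * \int[mu]_x g0 x &
    nrm q' (fun x => F x * (w x * G x `^ (q^-1 - p^-1))%:E) <=
    nrm q (fun x => f1 x * (w x * G x `^ (q^-1 - p^-1))%:E) * B].

Let N := nrm p (fun x => f1 x * (w x)%:E).
Let mul_meas (f : T -> \bar R) (v : T -> R) : measurable_fun [set: T] f -> pos_meas v ->
  measurable_fun [set: T] (fun x => f x * (v x)%:E).
Proof. by move=> mf pv; apply: emeasurable_funM => //; exact: pos_meas_EFin. Qed.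
Let mul_ge0 (f : T -> \bar R) (v : T -> R) : (forall x, 0 <= f x) -> pos_meas v ->
  forall x, 0 <= f x * (v x)%:E.
Proof. by move=> f0 pv x; apply: mule_ge0 => //; exact: pos_meas_ge0. Qed.
Let mul_eq0 (f : T -> \bar R) (v : T -> R) : pos_meas v ->
  {ae mu, forall x, f x * (v x)%:E = 0} -> {ae mu, forall x, f x = 0}.
Proof.
move=> pv; apply: filterS => x /eqP; rewrite mule_eq0 => /orP[/eqP//|].
by rewrite eqe gt_eqF// pv.2.
Qed.
Let pv G : pos_meas G -> pos_meas (fun x => w x * G x `^ (q^-1 - p^-1))%R.
Proof. by move=> pG; apply: pos_measM => //; exact: pos_meas_powR. Qed.
Let p'0 : (0 < p')%R. Proof. by rewrite invr_gt0 ltr_pwDl// invr_gt0. Qed.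
Let q'0 : (0 < q')%R. Proof. by rewrite invr_gt0 ltr_pwDl// invr_gt0. Qed.
Let fac (dl : R) : (dl = `|p^-1 - q^-1| -> (2 `^ kappa) `^ dl <= 2 `^ e)%R.
Proof.
move=> ->; rewrite -powRrM; apply: ler_powR; first by rewrite ler1n.
exact: kappa_e.
Qed.

(** If [N] is 0, or if [B] is 0 while [N] may be infinite, [(f1 * w) ^ p] cannot always serve as
    [g0], whose integral must be positive and finite. The indicator of [A] is taken instead;
    vanishing almost everywhere does not depend on the weight. *)
Lemma off_diagonal_degenerate (A : set T) : measurable A -> 0 < mu A < +oo ->
  (N = 0 \/ B = 0) -> nrm p' (fun x => F x * (w x)%:E) = 0.
Proof.
move=> mA /andP[A0 A1] NB.
have [G [pG _ _ hG]] : exists G : T -> R, [/\ pos_meas G,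
    {ae mu, forall x, (\1_A x)%:E <= (G x)%:E},
    \int[mu]_x (G x)%:E <= (2 `^ kappa)%:E * \int[mu]_x (\1_A x)%:E &
    nrm q' (fun x => F x * (w x * G x `^ (q^-1 - p^-1))%:E) <=
    nrm q (fun x => f1 x * (w x * G x `^ (q^-1 - p^-1))%:E) * B].
  apply: hyp => //.
  - by apply/measurable_EFinP; exact: measurable_indic.
  - by rewrite integral_indic// setIT A0.
have pvG := pv pG.
have N0 : nrm q' (fun x => F x * (w x * G x `^ (q^-1 - p^-1))%:E) = 0.
  apply/eqP; rewrite eq_le nrm_ge0 andbT; apply: le_trans hG _.
  case: NB => [N0|->]; last by rewrite mule0.
  have f1ae := nrm_eq0 p0 (mul_meas mf1 pw) (mul_ge0 f10 pw) N0.
  rewrite (nrm_ae0 q0 (mul_meas mf1 pvG) (mul_ge0 f10 pvG)) ?mul0e//.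
  by apply: filterS (mul_eq0 pw f1ae) => x ->; rewrite mul0e.
have Fae := nrm_eq0 q'0 (mul_meas mF pvG) (mul_ge0 F0 pvG) N0.
apply: (nrm_ae0 p'0 (mul_meas mF pw) (mul_ge0 F0 pw)).
by apply: filterS (mul_eq0 pvG Fae) => x ->; rewrite mul0e.
Qed.

(** With [dl = 1/p - 1/q], Hoelder's inequality splits [F * w = (F * v) * G ^ dl]. As [g0 <= G]
    gives [(f1 * v) ^ q <= (f1 * w) ^ p], the bound is [B] times
    [N ^ (p / q) * (2 ^ kappa * N ^ p) ^ dl], and the powers of [N] add up to 1. *)
Lemma off_diagonal_up (A : set T) : measurable A -> 0 < mu A < +oo -> (p < q)%R ->
  nrm p' (fun x => F x * (w x)%:E) <= (2 `^ e)%:E * N * B.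
Proof.
move=> mA muA pq.
have N0 : 0 <= N by exact: nrm_ge0.
have e0 : 0 < (2 `^ e)%:E by rewrite lte_fin powR_gt0.
have [NE|Nn0] := eqVneq N 0.
  by rewrite (off_diagonal_degenerate mA muA (or_introl NE)) mule_ge0// mule_ge0// ltW.
have [BE|Bn0] := eqVneq B 0.
  by rewrite (off_diagonal_degenerate mA muA (or_intror BE)) mule_ge0// mule_ge0// ltW.
have Np : 0 < N by rewrite lt0e Nn0.
have Bp : 0 < B by rewrite lt0e Bn0.
have [NE|Noo] := eqVneq N +oo.
  by rewrite NE gt0_muley// gt0_mulye// leey.
have Nfin : N = (fine N)%:E by rewrite fineK// ge0_fin_numE// ltey.
pose g0 x := (f1 x * (w x)%:E) `^ p.
have mfw := mul_meas mf1 pw; have fw0 := mul_ge0 f10 pw.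
have Ig0 : \int[mu]_x g0 x = N `^ p by rewrite /N nrmK.
have [] := hyp (measurable_fun_poweR p mfw) (fun x => poweR_ge0 _ _).
  by rewrite Ig0 poweR_gt0//= Nfin poweR_EFin ltry.
move=> G [pG gG IG hG]; have pvG := pv pG.
set v := fun x => (w x * G x `^ (q^-1 - p^-1))%R in pvG.
pose dl := (p^-1 - q^-1)%R.
have dl0 : (0 <= dl)%R by rewrite subr_ge0 lef_pV2// ltW.
have dlE : (dl = `|p^-1 - q^-1|)%R by rewrite ger0_norm.
have Nq : nrm q (fun x => f1 x * (v x)%:E) <= N `^ (p / q).
  rewrite [in leRHS]/N /nrm -poweRrM mulKf ?gt_eqF//.
  apply: le_poweR; first by rewrite invr_ge0 ltW.
    by apply: integral_ge0 => x _; exact: poweR_ge0.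
  apply: ae_ge0_le_integral => //.
  - by move=> x _; exact: poweR_ge0.
  - exact/measurable_fun_poweR/mul_meas.
  - by move=> x _; exact: poweR_ge0.
  - exact: measurable_fun_poweR.
  apply: filterS gG => x; rewrite /g0 => gx _.
  have Gx := pG.2 x; have wx := pw.2 x.
  move: gx; rewrite /v EFinM muleA.
  have := fw0 x; case: (f1 x * _) => [a| |]//; rewrite ?poweRyr ?gt_eqF//.
  rewrite lee_fin => a0; rewrite poweR_EFin lee_fin => aG.
  rewrite -EFinM !poweR_EFin lee_fin.
  have -> : (q^-1 - p^-1 = - dl)%R by rewrite /dl opprB.
  rewrite (powRM _ a0 (powR_ge0 _ _)) -powRrM.
  have : (a `^ (q - p) * G x `^ (- dl * q) <= 1)%R.
    rewrite mulNr powRN ler_pdivrMr ?powR_gt0// mul1r.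
    have -> : (a `^ (q - p) = (a `^ p) `^ (dl * q))%R.
      by rewrite -powRrM; congr (_ `^ _)%R; rewrite /dl; field; rewrite !gt_eqF.
    apply: le_powR => //; first by rewrite mulr_ge0// ltW.
    exact: powR_ge0.
  move=> /(ler_wpM2l (powR_ge0 a p)); rewrite mulr1 mulrA; apply: le_trans.
  rewrite -powRD ?subrKC//; apply/implyP => /eqP/eqP qE.
  by rewrite gt_eqF in qE.
have FE : (fun x => F x * (w x)%:E) = (fun x => (F x * (v x)%:E) * (G x `^ dl)%:E).
  apply/funext => x; rewrite -muleA -EFinM; congr (_ * _%:E).
  by rewrite /v -mulrA -powRD ?(gt_eqF (pG.2 x)) ?implybT// /dl addrA subrK subrr powRr0 mulr1.
have pq' : (p'^-1 = q'^-1 + dl)%R by rewrite /p' /q' !invrK /dl; ring.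
rewrite FE.
apply: le_trans (nrm_mul_powR p'0 q'0 dl0 pq' (mul_meas mF pvG) (mul_ge0 F0 pvG) pG) _.
apply: (@le_trans _ _ (N `^ (p / q) * B * ((2 `^ kappa)%:E * N `^ p) `^ dl)).
  apply: lee_pmul; [exact: nrm_ge0|exact: poweR_ge0| |].
    by apply: le_trans hG _; exact: lee_wpmul2r.
  apply: le_poweR => //; first by apply: integral_ge0 => x _; exact: pos_meas_ge0.
  by rewrite -Ig0.
rewrite poweRM ?poweR_ge0// ?lee_fin ?powR_ge0// poweR_EFin -poweRrM.
rewrite muleCA -muleA -[leRHS]muleA; apply: lee_pmul.
- by rewrite lee_fin powR_ge0.
- by apply: mule_ge0; [exact: poweR_ge0|apply: mule_ge0 => //; exact: poweR_ge0].
- by rewrite lee_fin; exact: fac.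
rewrite muleCA muleC; apply: lee_wpmul2r => //.
have n0 : (0 < fine N)%R by rewrite -lte_fin -Nfin.
rewrite Nfin !poweR_EFin -EFinM lee_fin -powRD; last by rewrite (gt_eqF n0) implybT.
by rewrite (_ : _ + _ = 1)%R ?powRr1 ?(ltW n0)// /dl; field; rewrite !gt_eqF.
Qed.

(** Here [v = w * G ^ dl] with [dl > 0], so [g0 <= G] is used on the left and Hoelder's inequality
    on the right. The function [g0] is [u ^ p'] normalised to integral 1, for which the norm of [u]
    at [p'] equals that of [u * g0 ^ dl] at [q']. *)
Lemma off_diagonal_down : (q < p)%R ->
  nrm p' (fun x => F x * (w x)%:E) <= (2 `^ e)%:E * N * B.
Proof.
move=> qp; pose dl := (q^-1 - p^-1)%R.
have dl1 : (0 < dl)%R by rewrite subr_gt0 ltf_pV2.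
have dl0 : (0 <= dl)%R by rewrite subr_ge0 lef_pV2// ltW.
have dlE : (dl = `|p^-1 - q^-1|)%R by rewrite distrC ger0_norm.
have N0 : 0 <= N by exact: nrm_ge0.
have RHS0 : 0 <= (2 `^ e)%:E * N * B.
  by apply: mule_ge0 => //; apply: mule_ge0 => //; rewrite lee_fin powR_ge0.
apply: (nrm_le_truncated p'0 (mul_meas mF pw) (mul_ge0 F0 pw)) => u mu_ u0 uF ufin.
set I := \int[mu]_x u x `^ p' in ufin.
have I0 : 0 <= I by apply: integral_ge0 => x _; exact: poweR_ge0.
have [IE|In0] := eqVneq I 0.
  by rewrite /nrm -/I IE poweR0r// invr_eq0 gt_eqF.
pose i := fine I.
have Ii : I = i%:E by rewrite fineK// ge0_fin_numE.
have i0 : (0 < i)%R by rewrite -lte_fin -Ii lt0e In0.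
have mup : measurable_fun [set: T] (fun x => u x `^ p') by exact: measurable_fun_poweR.
pose g0 x := i^-1%:E * u x `^ p'.
have Ig0 : \int[mu]_x g0 x = 1.
  rewrite ge0_integralZl//; first by rewrite -/I Ii -EFinM mulVf// gt_eqF.
  - by move=> x _; exact: poweR_ge0.
  - by rewrite lee_fin invr_ge0 ltW.
have [] := hyp (g0 := g0).
- by apply: emeasurable_funM.
- by move=> x; apply: mule_ge0; [rewrite lee_fin invr_ge0 ltW|exact: poweR_ge0].
- by rewrite Ig0 lte01 ltry.
move=> G [pG gG IG hG]; have pvG := pv pG.
rewrite Ig0 mule1 in IG.
have Gdl : pos_meas (fun x => G x `^ dl)%R by exact: pos_meas_powR.
have qp' : (q'^-1 = p'^-1 + dl)%R by rewrite /p' /q' !invrK /dl; ring.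
have low : nrm p' u <= nrm q' (fun x => F x * (w x * G x `^ dl)%:E).
  have -> : nrm p' u = nrm q' (fun x => u x * g0 x `^ dl).
    have E x : (u x * g0 x `^ dl) `^ q' = (i^-1 `^ (dl * q'))%:E * u x `^ p'.
      have ux := u0 x.
      rewrite poweRM ?poweR_ge0// -poweRrM /g0 poweRM ?poweR_ge0//; last first.
        by rewrite lee_fin invr_ge0 ltW.
      rewrite poweR_EFin muleCA -[u x `^ p' `^ _]poweRrM; congr (_ * _).
      have pE : (p' = q' + p' * (dl * q'))%R.
        have -> : (dl = q'^-1 - p'^-1)%R by rewrite qp'; ring.
        by field; rewrite !gt_eqF.
      case: (u x) ux => [a| |]// a0; last first.
        rewrite (poweRyr (lt0r_neq0 q'0)) (poweRyr (lt0r_neq0 p'0)).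
        by rewrite poweRyr ?mulyy// gt_eqF// mulr_gt0// mulr_gt0.
      rewrite !poweR_EFin -EFinM -powRD -?pE//.
      by rewrite (gt_eqF p'0).
    rewrite /nrm; under [in RHS]eq_integral do rewrite E.
    rewrite ge0_integralZl//; last 2 first.
    - by move=> x _; exact: poweR_ge0.
    - by rewrite lee_fin powR_ge0.
    rewrite -/I Ii -EFinM !poweR_EFin; congr EFin.
    have -> : (i^-1 `^ (dl * q') * i = i `^ (1 - dl * q'))%R.
      rewrite powRVN ?(ltW i0)// addrC powRD; last by rewrite (gt_eqF i0) implybT.
      by rewrite powRr1// ltW.
    rewrite -powRrM; congr (_ `^ _)%R.
    have -> : (dl = q'^-1 - p'^-1)%R by rewrite qp'; ring.
    by field; rewrite !gt_eqF.
  apply: le_nrm => //.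
  - apply: emeasurable_funM => //; apply: measurable_fun_poweR.
    exact: emeasurable_funM.
  - apply: mul_meas => //; exact: pv.
  - by move=> x; apply: mule_ge0 => //; exact: poweR_ge0.
  - by apply: mul_ge0 => //; exact: pv.
  apply: filterS gG => x gx; rewrite EFinM muleA; apply: lee_pmul => //; first exact: poweR_ge0.
  rewrite -poweR_EFin; apply: le_poweR => //.
  by apply: mule_ge0; [rewrite lee_fin invr_ge0 ltW|exact: poweR_ge0].
apply: le_trans low _; apply: le_trans hG _; apply: lee_wpmul2r => //.
have pqdl : (q^-1 = p^-1 + dl)%R by rewrite /dl; ring.
have := nrm_mul_powR q0 p0 dl0 pqdl (mul_meas mf1 pw) (mul_ge0 f10 pw) pG.
have -> : (fun x => f1 x * (w x)%:E * (G x `^ dl)%:E) =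
    (fun x => f1 x * (w x * G x `^ (q^-1 - p^-1))%:E).
  by apply/funext => x; rewrite -muleA -EFinM.
move=> /le_trans; apply; rewrite muleC; apply: lee_wpmul2r => //.
apply: (@le_trans _ _ ((2 `^ kappa)%:E `^ dl)).
  by apply: le_poweR => //; apply: integral_ge0 => x _; exact: pos_meas_ge0.
by rewrite poweR_EFin lee_fin; exact: fac.
Qed.

End off_diagonal_step.

End norm_step.

(** * Finite products and Hoelder's inequality for series *)

Section ereal_products.
Variable R : realType.

Lemma poweR_prod (I : Type) (s : seq I) (P : pred I) (a : I -> \bar R) (r : R) :
  (forall i, 0 <= a i) ->
  (\prod_(i <- s | P i) a i) `^ r = \prod_(i <- s | P i) (a i `^ r).
Proof.
move=> a0; elim: s => [|i s IH]; first by rewrite !big_nil poweR_EFin powR1.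
rewrite !big_cons; case: (P i) => //; rewrite poweRM ?IH//.
exact: prode_ge0.
Qed.

Lemma le_prode (I : Type) (s : seq I) (P : pred I) (a b : I -> \bar R) :
  (forall i, P i -> 0 <= a i) -> (forall i, P i -> a i <= b i) ->
  \prod_(i <- s | P i) a i <= \prod_(i <- s | P i) b i.
Proof.
move=> a0 ab; elim: s => [|i s IH]; first by rewrite !big_nil.
rewrite !big_cons; case: ifP => // Pi; apply: lee_pmul => //; last exact: ab.
- exact: a0.
- exact: prode_ge0.
Qed.

(** Induction on the number of factors: one is split off by Hoelder's inequality for the counting
    measure, and the remaining exponents are divided by their sum [L] so that they again add up to
    1. *)
Lemma nneseries_hoelder (I : Type) (s : seq I) (lam : I -> R) (a : I -> nat -> \bar R) :
  (forall i, (0 < lam i)%R) -> (\sum_(i <- s) lam i = 1)%R -> (forall i k, 0 <= a i k) ->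
  \sum_(k <oo) \prod_(i <- s) (a i k `^ lam i) <=
  \prod_(i <- s) (\sum_(k <oo) a i k) `^ lam i.
Proof.
move=> + + a0; elim: s lam => [|i s IH] lam lam0.
  by rewrite big_nil => /eqP; rewrite eq_sym oner_eq0.
case: s IH => [_|j s IH].
  rewrite !big_seq1 => E; rewrite E poweRe1; last by apply: nneseries_ge0.
  by under eq_eseriesr do rewrite big_seq1 E poweRe1//.
rewrite big_cons; set L := (\sum_(i <- j :: s) lam i)%R => lamE.
have L0 : (0 < L)%R.
  by rewrite /L big_cons ltr_pwDl// sumr_ge0// => k _; exact: ltW.
have LE : (1 - lam i = L)%R by rewrite -lamE addrAC subrr add0r.
pose b k := \prod_(i <- j :: s) (a i k `^ (lam i / L)).
have b0 k : 0 <= b k by apply: prode_ge0 => ? _; exact: poweR_ge0.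
have bL k : b k `^ L = \prod_(i <- j :: s) (a i k `^ lam i).
  rewrite poweR_prod; last by move=> ?; exact: poweR_ge0.
  by apply: eq_bigr => ? _; rewrite -poweRrM divfK// gt_eqF.
have Hb : \sum_(k <oo) b k <= \prod_(i <- j :: s) (\sum_(k <oo) a i k) `^ (lam i / L).
  apply: IH => [?|]; first exact: divr_gt0.
  by rewrite -mulr_suml divff// gt_eqF.
under eq_eseriesr do rewrite big_cons -bL -LE.
have l01 : (0 <= lam i <= 1)%R by rewrite (ltW (lam0 i))/= -subr_ge0 LE ltW.
have := @hoelder_geom _ nat R counting setT (a i) b (lam i) measurableT
  ltac:(by []) ltac:(by []) (a0 i) b0 l01.
rewrite !ge0_integral_count//; last by move=> k; apply: mule_ge0; exact: poweR_ge0.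
move=> /le_trans; apply; rewrite big_cons; apply: lee_wpmul2l; first exact: poweR_ge0.
rewrite LE; apply: (@le_trans _ _
    ((\prod_(i <- j :: s) (\sum_(k <oo) a i k) `^ (lam i / L)) `^ L)).
  by apply: le_poweR => //; [exact: ltW|exact: nneseries_ge0].
rewrite poweR_prod; last by move=> ?; exact: poweR_ge0.
rewrite le_eqVlt; apply/orP; left; apply/eqP; apply: eq_bigr => ? _.
by rewrite -poweRrM divfK// gt_eqF.
Qed.

End ereal_products.

(** * Vector-valued inequalities *)

Section vector_valued.
Context d (T : measurableType d) (R : realType).
Variable mu : {sigma_finite_measure set T -> \bar R}.

Definition seq_norm (K : pred nat) (r : R) (f : nat -> T -> \bar R) (x : T) : \bar R :=
  (\sum_(k <oo | K k) `|f k x| `^ r) `^ r^-1.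

Lemma seq_norm_ge0 K r f x : 0 <= seq_norm K r f x.
Proof. exact: poweR_ge0. Qed.

Lemma measurable_seq_norm (K : pred nat) r f :
  (forall k, K k -> measurable_fun [set: T] (f k)) ->
  measurable_fun [set: T] (seq_norm K r f).
Proof.
move=> mf; apply: measurable_fun_poweR.
apply: ge0_emeasurable_sum => [k x _ _|k Kk]; first exact: poweR_ge0.
by apply: measurable_fun_poweR; apply: measurableT_comp => //; exact: mf.
Qed.

Lemma nrm_seq_norm (K : pred nat) r (f : nat -> T -> \bar R) (v : T -> R) : (0 < r)%R ->
  (forall k, K k -> measurable_fun [set: T] (f k) /\ (forall x, 0 <= f k x)) ->
  pos_meas v ->
  nrm mu r (fun x => seq_norm K r f x * (v x)%:E) `^ r =
  \sum_(k <oo) (if K k then nrm mu r (fun x => f k x * (v x)%:E) `^ r else 0).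
Proof.
move=> r0 Kf pv; rewrite nrmK//.
have v0 x : 0 <= (v x)%:E by rewrite lee_fin ltW// pv.2.
pose u k x := if K k then (f k x * (v x)%:E) `^ r else 0.
have u0 k x : 0 <= u k x by rewrite /u; case: ifP => // _; exact: poweR_ge0.
have mu_ k : measurable_fun [set: T] (u k).
  have := Kf k; rewrite /u; case: (K k) => [/(_ isT)[mfk _]|_]; last exact: measurable_cst.
  by apply: measurable_fun_poweR; apply: emeasurable_funM => //; exact: pos_meas_EFin.
transitivity (\int[mu]_x \sum_(k <oo) u k x).
  apply: eq_integral => x _; rewrite poweRM ?seq_norm_ge0//.
  rewrite /seq_norm poweRVK//; last by apply: nneseries_ge0 => k _ _; exact: poweR_ge0.
  rewrite muleC -nneseriesZl; last by move=> k _; exact: poweR_ge0.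
  rewrite eseries_mkcond; apply: eq_eseriesr => k _; rewrite /u; case: ifP => // Kk.
  have [_ fk0] := Kf _ Kk.
  by rewrite muleC gee0_abs// poweRM.
rewrite integral_nneseries//; apply: eq_eseriesr => k _.
rewrite /u; case: ifP => _; last by rewrite integral0.
by rewrite nrmK.
Qed.

(** The constants [c i] do not depend on [k], because the weights do not. The estimates are raised
    to the power [h] and summed, and the inequality for series applies with the exponents [h / r i],
    whose sum is 1. *)
Lemma nrm_seq_norm_le m (K : pred nat) (h : R) (r : 'I_m -> R) (c : 'I_m -> R)
    (f : nat -> T -> \bar R) (g : nat -> 'I_m -> T -> \bar R)
    (V : T -> R) (v : 'I_m -> T -> R) :
  (0 < h)%R -> (forall i, (0 < r i)%R) -> (h^-1 = \sum_(i < m) (r i)^-1)%R ->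
  (forall i, (0 <= c i)%R) ->
  (forall k, K k -> measurable_fun [set: T] (f k) /\ (forall x, 0 <= f k x)) ->
  (forall k, K k -> forall i, measurable_fun [set: T] (g k i) /\ (forall x, 0 <= g k i x)) ->
  pos_meas V -> (forall i, pos_meas (v i)) ->
  (forall k, K k -> nrm mu h (fun x => f k x * (V x)%:E) <=
    \prod_(i < m) ((c i)%:E * nrm mu (r i) (fun x => g k i x * (v i x)%:E))) ->
  nrm mu h (fun x => seq_norm K h f x * (V x)%:E) <=
    \prod_(i < m) ((c i)%:E * nrm mu (r i)
      (fun x => seq_norm K (r i) (fun k => g k i) x * (v i x)%:E)).
Proof.
move=> h0 r0 hr c0 Kf Kg pV pv Kle.
rewrite -[leLHS](poweRK (nrm_ge0 _ _ _) h0) nrm_seq_norm//.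
pose b i k := (c i `^ r i)%:E *
  (if K k then nrm mu (r i) (fun x => g k i x * (v i x)%:E) `^ r i else 0).
have b0 i k : 0 <= b i k.
  apply: mule_ge0; first by rewrite lee_fin powR_ge0.
  by case: ifP => // _; exact: poweR_ge0.
pose lam i := (h / r i)%R.
have lam0 i : (0 < lam i)%R by exact: divr_gt0.
have lam1 : (\sum_(i < m) lam i = 1)%R by rewrite -mulr_sumr -hr divff// gt_eqF.
have S0 i : 0 <= \sum_(k <oo) b i k by apply: nneseries_ge0.
have P0 : 0 <= \prod_(i < m) (\sum_(k <oo) b i k) `^ lam i.
  by apply: prode_ge0 => i _; exact: poweR_ge0.
have le1 : \sum_(k <oo) (if K k then nrm mu h (fun x => f k x * (V x)%:E) `^ h else 0) <=
    \prod_(i < m) (\sum_(k <oo) b i k) `^ lam i.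
  apply: le_trans (nneseries_hoelder lam0 lam1 b0); apply: lee_nneseries => [k _ _|k _].
    by case: ifP => // _; exact: poweR_ge0.
  case: ifPn => Kk; last by apply: prode_ge0 => i _; exact: poweR_ge0.
  apply: (@le_trans _ _ ((\prod_(i < m) ((c i)%:E * nrm mu (r i)
      (fun x => g k i x * (v i x)%:E))) `^ h)).
    by apply: le_poweR; [exact: ltW|exact: nrm_ge0|exact: Kle].
  rewrite poweR_prod; last by move=> i; apply: mule_ge0; [rewrite lee_fin|exact: nrm_ge0].
  apply: le_prode => [i _|i _]; first exact: poweR_ge0.
  rewrite /b Kk -poweR_EFin -poweRM ?nrm_ge0 ?lee_fin// -poweRrM.
  by rewrite /lam mulrCA divff ?mulr1 ?lexx// gt_eqF.
apply: (@le_trans _ _ ((\prod_(i < m) (\sum_(k <oo) b i k) `^ lam i) `^ h^-1)).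
  apply: le_poweR => //; first by rewrite invr_ge0 ltW.
  by apply: nneseries_ge0 => k _ _; case: ifP => // _; exact: poweR_ge0.
rewrite poweR_prod; last by move=> i; exact: poweR_ge0.
apply: le_prode => [i _|i _]; first exact: poweR_ge0.
rewrite -poweRrM (_ : lam i / h = (r i)^-1)%R; last first.
  by rewrite /lam; field; rewrite !gt_eqF.
rewrite /b nneseriesZl; last by move=> k _; case: ifP => // _; exact: poweR_ge0.
rewrite -nrm_seq_norm//; last by move=> k Kk; exact: Kg.
by rewrite -poweR_EFin -poweRM ?nrm_ge0 ?lee_fin// poweRK// mule_ge0 ?lee_fin// nrm_ge0.
Qed.

End vector_valued.

(** * Multilinear extrapolation *)

Section multilinear.
Context d (T : measurableType d) (R : realType).
Variable mu : {sigma_finite_measure set T -> \bar R}.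
Variable m : nat.

Lemma pos_meas_prod (P : pred 'I_m) (v : 'I_m -> T -> R) : (forall i, pos_meas (v i)) ->
  pos_meas (fun x => \prod_(i < m | P i) v i x)%R.
Proof.
move=> pv; elim: (index_enum _) => [|i s IH].
  split=> [|x]; last by rewrite big_nil.
  by under eq_fun do rewrite big_nil; exact: measurable_cst.
have -> : (fun x => \prod_(i <- i :: s | P i) v i x)%R = (fun x =>
    (if P i then v i x else 1) * \prod_(i <- s | P i) v i x)%R.
  by apply/funext => x; rewrite big_cons; case: ifP => //; rewrite mul1r.
apply: pos_measM => //; case: (P i); first exact: pv.
by split=> [|x]; [exact: measurable_cst|exact: ltr01].
Qed.

(* [cls i e v] : the weight [v] is admissible for the [i]-th slot at the exponent [e];
   [con i e v] is its constant there. *)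
Variable cls : 'I_m -> R -> (T -> R) -> Prop.
Variable con : 'I_m -> R -> (T -> R) -> R.
Hypothesis cls_pos : forall i e v, cls i e v -> pos_meas v.
Hypothesis con_ge1 : forall i e v, cls i e v -> (1 <= con i e v)%R.

Definition tuple_family := set ((T -> \bar R) * ('I_m -> T -> \bar R)).

Definition nonneg_family (F : tuple_family) := forall f g, F (f, g) ->
  (measurable_fun [set: T] f /\ (forall x, 0 <= f x)) /\
  (forall i, measurable_fun [set: T] (g i) /\ (forall x, 0 <= g i x)).

Definition estimate (F : tuple_family) (e : 'I_m -> R) (phi : 'I_m -> R -> R) :=
  forall v : 'I_m -> T -> R, (forall i, cls i (e i) (v i)) ->
  forall f g, F (f, g) ->
  nrm mu (harm e) (fun x => f x * (\prod_(i < m) v i x)%R%:E) <=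
  \prod_(i < m) ((phi i (con i (e i) (v i)))%:E *
    nrm mu (e i) (fun x => g i x * (v i x)%:E)).

Definition growing (phi : R -> R) :=
  (forall s t : R, (1 <= s)%R -> (s <= t)%R -> (phi s <= phi t)%R) /\
  (forall t, (1 <= t)%R -> (1 <= phi t)%R).

Section slot.
Variables (F : tuple_family) (k : 'I_m) (e e' : 'I_m -> R) (phi phi' : 'I_m -> R -> R).
Variables (kappa a : R) (L : R -> R).
Hypothesis Fok : nonneg_family F.
Hypothesis e0 : forall i, (0 < e i)%R.
Hypothesis e'0 : (0 < e' k)%R.
Hypothesis ee' : forall i, i != k -> e' i = e i.
Hypothesis phiphi' : forall i t, i != k -> phi' i t = phi i t.
Hypothesis phi'k : forall t, phi' k t = (2 `^ a * phi k (L t))%R.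
Hypothesis gphi : forall i, growing (phi i).
Hypothesis L1 : forall t, (1 <= t)%R -> (1 <= L t)%R.
Hypothesis a0 : (0 <= a)%R.
Hypothesis kappa_a : (kappa * `|(e' k)^-1 - (e k)^-1| <= a)%R.
Hypothesis same : e' k = e k -> forall t, (1 <= t)%R -> (t <= L t)%R.
Hypothesis extrap : e' k != e k -> forall (w : T -> R) (g0 : T -> \bar R),
  cls k (e' k) w -> measurable_fun [set: T] g0 -> (forall x, 0 <= g0 x) ->
  0 < \int[mu]_x g0 x < +oo ->
  exists G : T -> R, [/\ pos_meas G, {ae mu, forall x, g0 x <= (G x)%:E},
    \int[mu]_x (G x)%:E <= (2 `^ kappa)%:E * \int[mu]_x g0 x &
    let v := (fun x => w x * G x `^ ((e k)^-1 - (e' k)^-1))%R in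
    cls k (e k) v /\ (con k (e k) v <= L (con k (e' k) w))%R].
Variable A : set T.
Hypothesis mA : measurable A.
Hypothesis muA : 0 < mu A < +oo.

(** The other slots keep their weights throughout, so their norms and constants form a fixed factor
    [B2]; the hypothesis is used with the weight of slot [k] alone replaced by the extrapolated
    one. *)
Lemma estimate_slot : estimate F e phi -> estimate F e' phi'.
Proof.
move=> est v cv f g Ffg; have [[mf f0] mg] := Fok Ffg.
have pv i : pos_meas (v i) by exact: cls_pos (cv i).
have cvE i : i != k -> cls i (e i) (v i) by move=> ik; rewrite -(ee' ik); exact: cv.
set K := con k (e' k) (v k); have K1 : (1 <= K)%R by exact: con_ge1.
have phiL : (1 <= phi k (L K))%R by apply: (gphi k).2; exact: L1.
(* If the exponent does not change, no new weight is constructed and [t <= L t] suffices. *)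
have [ekE|ekn] := eqVneq (e' k) (e k).
  have eE : e' = e.
    by apply/funext => i; have [->|/ee'//] := eqVneq i k.
  rewrite eE; apply: (le_trans (est v _ _ _ Ffg)); first by move=> i; rewrite -eE.
  apply: le_prode => i _.
    apply: mule_ge0; last exact: nrm_ge0.
    rewrite lee_fin; apply: le_trans ler01 _; apply: (gphi i).2.
    by apply: con_ge1; rewrite -eE.
  apply: lee_wpmul2r; first exact: nrm_ge0.
  have [->|ik] := eqVneq i k; last by rewrite phiphi'.
  rewrite phi'k lee_fin; have KL : (con k (e k) (v k) <= L (con k (e k) (v k)))%R.
    by apply: same => //; apply: con_ge1; rewrite -ekE.
  apply: (@le_trans _ _ (phi k (L (con k (e k) (v k))))).
    by apply: (gphi k).1 => //; apply: con_ge1; rewrite -ekE.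
  apply: ler_peMl; last by apply: powR_ge1 => //; rewrite ler1n.
  by move: phiL; rewrite /K ekE; apply: le_trans; exact: ler01.
pose V x := (\prod_(i < m | i != k) v i x)%R.
have pV : pos_meas V by exact: pos_meas_prod.
pose B2 := \prod_(i < m | i != k) ((phi i (con i (e i) (v i)))%:E *
    nrm mu (e i) (fun x => g i x * (v i x)%:E)).
have B20 : 0 <= B2.
  apply: prode_ge0 => i ik; apply: mule_ge0; last exact: nrm_ge0.
  rewrite lee_fin; apply: le_trans ler01 _; apply: (gphi i).2; apply: con_ge1.
  exact: cvE.
pose B := (phi k (L K))%:E * B2.
have B0 : 0 <= B.
  by apply: mule_ge0 => //; rewrite lee_fin; apply: le_trans phiL; exact: ler01.
pose th := (\sum_(i < m | i != k) (e i)^-1)%R.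
have th0 : (0 <= th)%R by apply: sumr_ge0 => i _; rewrite invr_ge0 ltW.
have hE' : harm e' = (((e' k)^-1 + th)^-1)%R.
  rewrite /harm (bigD1 k)//=; congr ((_ + _)^-1)%R.
  by apply: eq_bigr => i ik; rewrite ee'.
have hE : harm e = (((e k)^-1 + th)^-1)%R by rewrite /harm (bigD1 k).
pose F0 x := f x * (V x)%:E.
have mF0 : measurable_fun [set: T] F0 by apply: emeasurable_funM => //; exact: pos_meas_EFin.
have F00 x : 0 <= F0 x by apply: mule_ge0 => //; exact: pos_meas_ge0.
have hyp (g0 : T -> \bar R) : measurable_fun [set: T] g0 -> (forall x, 0 <= g0 x) ->
    0 < \int[mu]_x g0 x < +oo ->
    exists G : T -> R, [/\ pos_meas G, {ae mu, forall x, g0 x <= (G x)%:E},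
    \int[mu]_x (G x)%:E <= (2 `^ kappa)%:E * \int[mu]_x g0 x &
    nrm mu (((e k)^-1 + th)^-1)%R
      (fun x => F0 x * (v k x * G x `^ ((e k)^-1 - (e' k)^-1))%:E) <=
    nrm mu (e k) (fun x => g k x * (v k x * G x `^ ((e k)^-1 - (e' k)^-1))%:E) * B].
  move=> mg0 g00 g0fin; have [G [pG gG IG [cu conu]]] := extrap ekn (cv k) mg0 g00 g0fin.
  exists G; split; [exact: pG|exact: gG|exact: IG|].
  pose u := (fun x => v k x * G x `^ ((e k)^-1 - (e' k)^-1))%R.
  pose vu i := if i == k then u else v i.
  have vuk : vu k = u by rewrite /vu eqxx.
  have vuE i : i != k -> vu i = v i by rewrite /vu => /negbTE ->.
  have cvu i : cls i (e i) (vu i).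
    by have [->|ik] := eqVneq i k; [rewrite vuk|rewrite vuE//; exact: cvE].
  have := est vu cvu f g Ffg; rewrite hE.
  have -> : (fun x => f x * (\prod_(i < m) vu i x)%R%:E) = (fun x => F0 x * (u x)%:E).
    apply/funext => x; rewrite /F0 -muleA -EFinM; congr (_ * _%:E).
    rewrite (bigD1 k)//= vuk mulrC; congr (_ * _)%R.
    by apply: eq_bigr => i ik; rewrite vuE.
  move=> /le_trans; apply; rewrite (bigD1 k)//= vuk.
  rewrite (eq_bigr (fun i => (phi i (con i (e i) (v i)))%:E *
    nrm mu (e i) (fun x => g i x * (v i x)%:E))); last by move=> i ik; rewrite vuE.
  rewrite -/B2 /B muleCA muleA; apply: lee_wpmul2r => //.
  apply: lee_wpmul2r; first exact: nrm_ge0.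
  by rewrite lee_fin; apply: (gphi k).1 => //; exact: con_ge1 cu.
have FE : (fun x => f x * (\prod_(i < m) v i x)%R%:E) = (fun x => F0 x * (v k x)%:E).
  apply/funext => x; rewrite /F0 -muleA -EFinM; congr (_ * _%:E).
  by rewrite (bigD1 k)//= mulrC.
rewrite FE hE' (bigD1 k)//=.
rewrite (eq_bigr (fun i => (phi i (con i (e i) (v i)))%:E *
    nrm mu (e i) (fun x => g i x * (v i x)%:E))); last first.
  by move=> i ik; rewrite ee'// phiphi'.
rewrite -/B2 phi'k EFinM -/K.
have -> : (2 `^ a)%:E * (phi k (L K))%:E *
    nrm mu (e' k) (fun x => g k x * (v k x)%:E) * B2 =
    (2 `^ a)%:E * nrm mu (e' k) (fun x => g k x * (v k x)%:E) * B.
  by rewrite /B -!muleA; congr (_ * _); rewrite muleCA.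
have [mgk gk0] := mg k.
move: ekn; rewrite neq_lt => /orP[lt1|lt1].
- exact: (off_diagonal_up e'0 (e0 k) th0 kappa_a (pv k) mF0 F00 mgk gk0 B0 hyp mA muA lt1).
- exact: (off_diagonal_down e'0 (e0 k) th0 kappa_a (pv k) mF0 F00 mgk gk0 B0 hyp lt1).
Qed.

End slot.

(** Sequence norms of members of [F] form a new family of tuples. Once the estimate at [e] is known
    for it, the scalar extrapolation applies to it verbatim and yields the vector-valued
    statement. *)
Definition seq_family (F : tuple_family) (e : 'I_m -> R) : tuple_family :=
  [set fg | exists (K : pred nat) (f : nat -> T -> \bar R) (g : nat -> 'I_m -> T -> \bar R),
    (forall k, K k -> F (f k, g k)) /\
    fg = (seq_norm K (harm e) f, fun i => seq_norm K (e i) (fun k => g k i))].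

Lemma estimate_seq_norm (F : tuple_family) (e : 'I_m -> R) (phi : 'I_m -> R -> R) :
  (0 < m)%N -> (forall i, (0 < e i)%R) -> nonneg_family F -> (forall i, growing (phi i)) ->
  estimate F e phi ->
  estimate (seq_family F e) e phi.
Proof.
move=> m0 e0 Fok gphi est v cv _ _ [K [f [g [KF [-> ->]]]]].
have pv i : pos_meas (v i) by exact: cls_pos (cv i).
have h0 : (0 < harm e)%R.
  rewrite invr_gt0 (bigD1 (Ordinal m0))//= ltr_pwDl ?invr_gt0//.
  by apply: sumr_ge0 => i _; rewrite invr_ge0 ltW.
apply: nrm_seq_norm_le => //.
- by rewrite /harm invrK.
- move=> i; apply: le_trans ler01 _; apply: (gphi i).2.
  exact: con_ge1.
- by move=> k /KF/Fok[].
- by move=> k /KF/Fok[].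
- exact: pos_meas_prod.
- by move=> k /KF; exact: est.
Qed.

Lemma nonneg_seq_norm (F : tuple_family) (e : 'I_m -> R) : nonneg_family F ->
  nonneg_family (seq_family F e).
Proof.
move=> Fok _ _ [K [f [g [KF [-> ->]]]]]; split=> [|i].
  split=> [|x]; last exact: seq_norm_ge0.
  by apply: measurable_seq_norm => k /KF/Fok[[]].
split=> [|x]; last exact: seq_norm_ge0.
by apply: measurable_seq_norm => k /KF/Fok[_ /(_ i)[]].
Qed.

End multilinear.

(** * Iteration over the slots *)

Section limited_range_estimates.
Context {R : realType} {n m : nat}.
Local Notation T := (Rn R n).
Local Notation mu := (@lebesgue_Rn R n).
Variables (pm : 'I_m -> R) (pp : 'I_m -> \bar R).
Hypothesis pm1 : forall i, (1 <= pm i)%R.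

Lemma cubes_mu (Q : set T) : cubes Q -> 0 < mu Q < +oo.
Proof. by move=> /lebesgue_cubes[r r0 ->]; rewrite lte_fin r0 ltry. Qed.

Definition arh (i : 'I_m) (e : R) (v : T -> R) : R :=
  fine (ARH_const (pm i) (pp i) e (EFin \o v)).

Definition arh_class (i : 'I_m) (e : R) (v : T -> R) : Prop :=
  [/\ pos_meas v, in_ARH (pm i) (pp i) e (EFin \o v) & (1 <= arh i e v)%R].

Lemma arh_class_pos i e v : arh_class i e v -> pos_meas v.
Proof. by case. Qed.

Lemma arh_class_ge1 i e v : arh_class i e v -> (1 <= arh i e v)%R.
Proof. by case. Qed.

Definition expo_bound i (p q : R) : R :=
  (Num.max (tau (pm i) (pp i) p / p) (tau' (pm i) (pp i) p / q))%R.

Definition growth i p q (t : R) : R :=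
  (@extrap_const R n p q (pm i) (pp i) * t `^ gamma (pm i) (pp i) p q)%R.

Definition extrap_phi i p q (phi : R -> R) (t : R) : R :=
  (2 `^ expo_bound i p q * phi (growth i p q t))%R.

Section one_slot.
Variables (i : 'I_m) (p q : R).
Hypothesis pmp : (pm i < p)%R.
Hypothesis ppp : p%:E < pp i.
Hypothesis pmq : (pm i <= q)%R.
Hypothesis qpp : q%:E <= pp i.

Let pm0 : (0 < pm i)%R. Proof. exact: lt_le_trans (pm1 i). Qed.
Let p0 : (0 < p)%R. Proof. exact: lt_trans pmp. Qed.
Let q0 : (0 < q)%R. Proof. exact: lt_le_trans pmq. Qed.
Let x0 : (0 < lower_gap (pm i) p)%R.
Proof. by rewrite subr_gt0 ltf_pV2. Qed.
Let y0 : (0 < upper_gap (pp i) p)%R.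
Proof. exact: upper_gap_gt0. Qed.

Lemma gamma_ge0 : (0 <= gamma (pm i) (pp i) p q)%R.
Proof.
rewrite /gamma; case: ifPn => [_|qpp']; first by rewrite le_max ler01.
have ppE : pp i = q%:E by apply/eqP; rewrite eq_le qpp andbT leNgt.
rewrite tauE// addrK mulr_ge0//.
  by rewrite divr_ge0 ?(ltW q0)// divr_ge0// ltW.
by rewrite ppE/= subr_ge0 lef_pV2.
Qed.

Lemma tau_ge0 : (0 <= tau (pm i) (pp i) p)%R.
Proof. by rewrite tauE// addr_ge0// divr_ge0// ltW. Qed.

Lemma tau'_ge0 : (0 <= tau' (pm i) (pp i) p)%R.
Proof. rewrite (tau'E p0 x0 ppp); apply: divr_ge0; last exact: ltW.
by apply: addr_ge0; exact: ltW. Qed.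

Lemma expo_bound_ge0 : (0 <= expo_bound i p q)%R.
Proof. by rewrite le_max divr_ge0 ?tau_ge0// ltW. Qed.

Lemma growth_ge1 t : (1 <= t)%R -> (1 <= growth i p q t)%R.
Proof.
move=> t1; rewrite mulr_ege1 ?extrap_const_ge1// powR_ge1//.
exact: gamma_ge0.
Qed.

Lemma growing_extrap_phi phi : growing phi -> growing (extrap_phi i p q phi).
Proof.
move=> [phim phi1]; split=> [s t s1 st|t t1].
  rewrite ler_wpM2l ?powR_ge0// phim ?growth_ge1// ler_wpM2l//.
    by apply: le_trans (extrap_const_ge1 _ _ _ _).
  by apply: le_powR => //; [exact: gamma_ge0|exact: le_trans ler01 s1].
rewrite mulr_ege1 ?phi1 ?growth_ge1// powR_ge1 ?ler1n//.
exact: expo_bound_ge0.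
Qed.

Lemma le_growth_diag t : p = q -> (1 <= t)%R -> (t <= growth i p q t)%R.
Proof.
move=> pq t1; have t0 : (0 <= t)%R by exact: le_trans t1.
apply: (@le_trans _ _ (t `^ gamma (pm i) (pp i) p q)%R).
  rewrite -[leLHS](powRr1 t0); apply: ler_powR => //.
  by rewrite /gamma -pq ppp le_max lexx.
by rewrite ler_peMl ?powR_ge0// extrap_const_ge1.
Qed.

Let kappa := if (p < q)%R then tau (pm i) (pp i) p else tau' (pm i) (pp i) p.

(** The origin of the constants [2 ^ max]: [tau * (1/p - 1/q) <= tau / p] when the exponent is
    raised, and [tau' * (1/q - 1/p) <= tau' / q] when it is lowered. *)
Lemma kappa_le : (kappa * `|p^-1 - q^-1| <= expo_bound i p q)%R.
Proof.
rewrite /kappa le_max; case: ltP => pq; apply/orP; [left|right].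
  rewrite ger0_norm ?subr_ge0 ?lef_pV2 ?(ltW pq)//.
  by rewrite ler_wpM2l ?tau_ge0// gerBl invr_ge0 ltW.
rewrite distrC ger0_norm ?subr_ge0 ?lef_pV2//.
by rewrite ler_wpM2l ?tau'_ge0// gerBl invr_ge0 ltW.
Qed.

Lemma extrap_slot (w : T -> R) (g0 : T -> \bar R) : p != q ->
  arh_class i p w -> measurable_fun [set: T] g0 -> (forall x, 0 <= g0 x) ->
  0 < \int[mu]_x g0 x < +oo ->
  exists G : T -> R, [/\ pos_meas G, {ae mu, forall x, g0 x <= (G x)%:E},
    \int[mu]_x (G x)%:E <= (2 `^ kappa)%:E * \int[mu]_x g0 x &
    let v := (fun x => w x * G x `^ (q^-1 - p^-1))%R in
    arh_class i q v /\ (arh i q v <= growth i p q (arh i p w))%R].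
Proof.
move=> pq [pw wA _] mg0 g00 g0fin.
have [G [pG gG IG]] := extrapolation_weight_Rn pm0 pmp ppp pmq qpp pq pw wA mg0 g00 g0fin.
move=> [pv vA /andP[v1 v2]]; exists G; split; [exact: pG|exact: gG|exact: IG|].
by split; [split; [exact: pv|exact: vA|exact: v1]|exact: v2].
Qed.

End one_slot.

Lemma extrapolated_estimate (F : tuple_family T R m) (p q : 'I_m -> R) (phi : 'I_m -> R -> R) :
  (forall i, (pm i < p i)%R /\ (p i)%:E < pp i) ->
  (forall i, (pm i <= q i)%R /\ (q i)%:E <= pp i) ->
  nonneg_family F -> (forall i, growing (phi i)) ->
  estimate mu arh_class arh F q phi ->
  estimate mu arh_class arh F p (fun i => extrap_phi i (p i) (q i) (phi i)).
Proof.
move=> hp hq Fok gphi est.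
(* After [j] steps the first [j] slots are at their target exponents and the others still at [q]. *)
pose e (j : nat) (i : 'I_m) := if (i < j)%N then p i else q i.
pose ph (j : nat) (i : 'I_m) := if (i < j)%N then extrap_phi i (p i) (q i) (phi i) else phi i.
suff H j : (j <= m)%N -> estimate mu arh_class arh F (e j) (ph j).
  have := H m (leqnn m); rewrite /e /ph.
  have -> : (fun i : 'I_m => if (i < m)%N then p i else q i) = p.
    by apply/funext => i; rewrite ltn_ord.
  have -> : (fun i : 'I_m => if (i < m)%N then extrap_phi i (p i) (q i) (phi i) else phi i) =
      (fun i => extrap_phi i (p i) (q i) (phi i)).
    by apply/funext => i; rewrite ltn_ord.
  exact.
have gph k i : growing (ph k i).
  rewrite /ph; case: ifP => _; last exact: gphi.
  by have [h1 h2] := hp i; have [h3 h4] := hq i; exact: growing_extrap_phi.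
have p0 i : (0 < p i)%R.
  by have [h _] := hp i; apply: lt_trans h; exact: lt_le_trans (pm1 i).
have q0 i : (0 < q i)%R.
  by have [h _] := hq i; apply: lt_le_trans h; exact: lt_le_trans (pm1 i).
have e0 k i : (0 < e k i)%R by rewrite /e; case: ifP.
elim: j => [_|j IH jm].
  have -> : e 0%N = q by apply/funext.
  by have -> : ph 0%N = phi by apply/funext.
have {}IH := IH (ltnW jm); pose k := Ordinal jm.
have ek : e j k = q k by rewrite /e ltnn.
have ek' : e j.+1 k = p k by rewrite /e ltnSn.
have phk : ph j k = phi k by rewrite /ph ltnn.
have phk' : ph j.+1 k = extrap_phi k (p k) (q k) (phi k) by rewrite /ph ltnSn.
have ltE (i : 'I_m) : i != k -> (i < j.+1)%N = (i < j)%N.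
  move=> ik; rewrite ltnS leq_eqVlt; case: eqP => // ij.
  by case/eqP: ik; exact: val_inj.
have [hp1 hp2] := hp k; have [hq1 hq2] := hq k.
apply: (@estimate_slot _ _ _ mu _ _ _ arh_class_pos arh_class_ge1 F k (e j) (e j.+1) (ph j)
  (ph j.+1) (if (p k < q k)%R then tau (pm k) (pp k) (p k) else tau' (pm k) (pp k) (p k))
  (expo_bound k (p k) (q k)) (growth k (p k) (q k)) Fok (e0 j) (e0 j.+1 k)
  _ _ _ (gph j) _ _ _ _ _ (cube (fun=> 0%R) 1%R)
  (measurable_cubes cubes_unit) _ IH).
- by move=> i ik; rewrite /e ltE.
- by move=> i t ik; rewrite /ph ltE.
- by move=> t; rewrite phk' phk.
- by move=> t; exact: growth_ge1.
- exact: expo_bound_ge0.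
- by rewrite ek ek'; exact: kappa_le.
- by rewrite ek ek' => E t; exact: le_growth_diag.
- by rewrite ek ek' => pq w g0; exact: extrap_slot.
- exact: cubes_mu cubes_unit.
Qed.

End limited_range_estimates.

(** * Return to extended-valued weights *)

Section weighted_norms.
Context {R : realType} {n m : nat}.
Local Notation T := (Rn R n).
Local Notation mu := (@lebesgue_Rn R n).

Lemma ae_same_prodw (w : 'I_m -> T -> \bar R) (W : 'I_m -> T -> R) :
  (forall i, pos_meas (W i)) -> (forall i, ae_same (w i) (EFin \o W i)) ->
  ae_same (prodw w) (EFin \o (fun x => \prod_(i < m) W i x)%R).
Proof.
move=> pW wW; split.
- rewrite /prodw; elim: (index_enum _) => [|i s IH].
    by under eq_fun do rewrite big_nil; exact: measurable_cst.
  under eq_fun do rewrite big_cons.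
  by apply: emeasurable_funM => //; case: (wW i).
- exact/pos_meas_EFin/pos_meas_prod.
- have : {ae mu, forall x, forall i, w i x = (W i x)%:E}.
    by apply: filter_forall => i; case: (wW i).
  apply: filterS => x H; rewrite /prodw /= -prodEFin.
  by apply: eq_bigr => i _; exact: H.
Qed.

End weighted_norms.

Lemma nrm_weight d (T : measurableType d) (R : realType)
    (mu : {sigma_finite_measure set T -> \bar R}) (p : R) (w f : T -> \bar R) (W : T -> R) :
  pos_meas W -> measurable_fun [set: T] w -> {ae mu, forall x, w x = (W x)%:E} ->
  measurable_fun [set: T] f -> (forall x, 0 <= f x) ->
  (\int[mu]_x (`|f x| `^ p * w x `^ p)) `^ p^-1 = nrm mu p (fun x => f x * (W x)%:E).
Proof.
move=> pW mw wW mf f0; congr (_ `^ _); apply: ge0_ae_eq_integral => //.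
- apply: emeasurable_funM; last exact: measurable_fun_poweR.
  by apply: measurable_fun_poweR; apply: measurableT_comp.
- apply: measurable_fun_poweR; apply: emeasurable_funM => //; exact: pos_meas_EFin.
- by move=> x _; apply: mule_ge0; exact: poweR_ge0.
- by move=> x _; exact: poweR_ge0.
- apply: filterS wW => x /= wx _; rewrite wx gee0_abs// poweRM//.
  exact: pos_meas_ge0 pW.
Qed.

Lemma wnorm_nrm (R : realType) (n : nat) (p : R) (w f : Rn R n -> \bar R)
    (W : Rn R n -> R) : pos_meas W ->
  ae_same w (EFin \o W) -> measurable_fun [set: Rn R n] f -> (forall x, 0 <= f x) ->
  wnorm p (powf w p) f = nrm (@lebesgue_Rn R n) p (fun x => f x * (W x)%:E).
Proof. by move=> pW [mw _ wW] mf f0; exact: nrm_weight. Qed.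

(** Each weight is replaced by a positive real-valued representative, which changes neither its
    class, its constant nor the norms. The lower bound 1 for the constants is returned as well, for
    the comparison of the factors in the vector-valued case. *)
Lemma estimate_wnorm (R : realType) (n m : nat) (pm : 'I_m -> R) (pp : 'I_m -> \bar R)
    (F : tuple_family (Rn R n) R m) (p : 'I_m -> R) (phi : 'I_m -> R -> R) :
  (forall i, (1 <= pm i)%R) -> (forall i, (pm i < p i)%R /\ (p i)%:E < pp i) ->
  nonneg_family F ->
  estimate (@lebesgue_Rn R n) (arh_class pm pp) (arh pm pp) F p phi ->
  forall w : 'I_m -> Rn R n -> \bar R,
  (forall i, weight (w i) /\ in_ARH (pm i) (pp i) (p i) (w i)) ->
  (forall i, (1 <= fine (ARH_const (pm i) (pp i) (p i) (w i)))%R) /\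
  forall f g, F (f, g) ->
  wnorm (harm p) (powf (prodw w) (harm p)) f <=
  \prod_(i < m) ((phi i (fine (ARH_const (pm i) (pp i) (p i) (w i))))%:E *
    wnorm (p i) (powf (w i) (p i)) (g i)).
Proof.
move=> pm1 hp Fok est w hw.
have [W [pW wW]] : exists W : 'I_m -> Rn R n -> R,
    (forall i, pos_meas (W i)) /\ (forall i, ae_same (w i) (EFin \o W i)).
  have [W hW] := fin_all_exists2 (fun i => weight_real (hw i).1).
  by exists W.
have arhE i : ARH_const (pm i) (pp i) (p i) (w i) = ARH_const (pm i) (pp i) (p i) (EFin \o W i).
  exact: ae_same_ARH_const.
have WA i : in_ARH (pm i) (pp i) (p i) (EFin \o W i).
  exact: ae_same_in_ARH (wW i) (hw i).2.
have cW i : arh_class pm pp i (p i) (W i).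
  have pm0 : (0 < pm i)%R by exact: lt_le_trans (pm1 i).
  have [h1 h2] := hp i; have p0 := lt_trans pm0 h1.
  have [K1 _] := in_ARH_mixed pm0 p0 h2 h1 (pW i) (WA i).
  by split; [exact: pW|exact: WA|exact: K1].
split=> [i|f g Ffg]; first by rewrite arhE; exact: arh_class_ge1 (cW i).
have [[mf f0] mg] := Fok _ _ Ffg.
have pP : pos_meas (fun x => \prod_(i < m) W i x)%R by exact: pos_meas_prod.
rewrite (wnorm_nrm _ pP (ae_same_prodw pW wW) mf f0).
apply: le_trans (est W cW f g Ffg) _.
rewrite le_eqVlt; apply/orP; left; apply/eqP; apply: eq_bigr => i _.
have [mgi gi0] := mg i.
by rewrite (wnorm_nrm _ (pW i) (wW i) mgi gi0) arhE.
Qed.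

Lemma wnorm_estimate (R : realType) (n m : nat) (pm : 'I_m -> R) (pp : 'I_m -> \bar R)
    (F : tuple_family (Rn R n) R m) (q : 'I_m -> R) (phi : 'I_m -> R -> R) :
  nonneg_family F ->
  (forall v : 'I_m -> Rn R n -> \bar R,
    (forall i, weight (v i) /\ in_ARH (pm i) (pp i) (q i) (v i)) ->
    forall f g, F (f, g) ->
    wnorm (harm q) (powf (prodw v) (harm q)) f <=
    \prod_(i < m) ((phi i (fine (ARH_const (pm i) (pp i) (q i) (v i))))%:E *
       wnorm (q i) (powf (v i) (q i)) (g i))) ->
  estimate (@lebesgue_Rn R n) (arh_class pm pp) (arh pm pp) F q phi.
Proof.
move=> Fok H v cv f g Ffg; have [[mf f0] mg] := Fok _ _ Ffg.
have pv i : pos_meas (v i) by case: (cv i).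
have vv i : ae_same (EFin \o v i) (EFin \o v i).
  by split; [exact: pos_meas_EFin|exact: pos_meas_EFin|exact: filterE].
have pP : pos_meas (fun x => \prod_(i < m) v i x)%R by exact: pos_meas_prod.
have := H (fun i => EFin \o v i) _ f g Ffg.
rewrite (wnorm_nrm _ pP (ae_same_prodw pv vv) mf f0) => /(_ _)/le_trans; apply.
  by move=> i; split; [exact: weight_EFin|case: (cv i)].
rewrite le_eqVlt; apply/orP; left; apply/eqP; apply: eq_bigr => i _.
have [mgi gi0] := mg i.
by rewrite (wnorm_nrm _ (pv i) (vv i) mgi gi0).
Qed.

(** Inserting [C_pr * t ^ gamma(p,r)] for [s] into [C_rq * s ^ gamma(r,q)] gives
    [C_rq * C_pr ^ gamma(r,q)] times [t ^ (gamma(p,r) * gamma(r,q))]. *)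
Definition extrap_const2 (R : realType) (n : nat) (p q r pm : R) (pp : \bar R) : R :=
  Num.max 1%R
    (@extrap_const R n r q pm pp * @extrap_const R n p r pm pp `^ gamma pm pp r q)%R.

Theorem theorem1p1 (R : realType) :
  exists (C : nat -> R -> R -> R -> \bar R -> R)
         (C' : nat -> R -> R -> R -> R -> \bar R -> R),
  [/\ forall n p q pm pp, (1 <= C n p q pm pp)%R,
      forall n p q r pm pp, (1 <= C' n p q r pm pp)%R &
  forall (n m : nat)
    (F : set ((Rn R n -> \bar R) * ('I_m -> Rn R n -> \bar R)))
    (pm : 'I_m -> R) (pp : 'I_m -> \bar R) (q : 'I_m -> R)
    (Phi : 'I_m -> R -> R),
  (0 < n)%N -> (0 < m)%N ->
  (forall f g, F (f, g) ->
    (measurable_fun [set: Rn R n] f /\ (forall x, 0 <= f x)) /\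
    (forall i, measurable_fun [set: Rn R n] (g i) /\ (forall x, 0 <= g i x))) ->
  (forall i, (1 <= pm i)%R /\ (pm i)%:E < pp i) ->
  (forall i, (pm i <= q i)%R /\ (q i)%:E <= pp i) ->
  (forall i (s t : R), (1 <= s)%R -> (s <= t)%R -> (Phi i s <= Phi i t)%R) ->
  (forall i (t : R), (1 <= t)%R -> (1 <= Phi i t)%R) ->
  (forall v : 'I_m -> Rn R n -> \bar R,
    (forall i, weight (v i) /\ in_ARH (pm i) (pp i) (q i) (v i)) ->
    forall f g, F (f, g) ->
    wnorm (harm q) (powf (prodw v) (harm q)) f <=
    \prod_(i < m)
      ((Phi i (fine (ARH_const (pm i) (pp i) (q i) (v i))))%:E *
       wnorm (q i) (powf (v i) (q i)) (g i))) ->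
  forall (p : 'I_m -> R) (w : 'I_m -> Rn R n -> \bar R),
  (forall i, (pm i < p i)%R /\ (p i)%:E < pp i) ->
  (forall i, weight (w i) /\ in_ARH (pm i) (pp i) (p i) (w i)) ->
  (forall f g, F (f, g) ->
    wnorm (harm p) (powf (prodw w) (harm p)) f <=
    \prod_(i < m)
      ((2 `^ Num.max (tau (pm i) (pp i) (p i) / p i)
                     (tau' (pm i) (pp i) (p i) / q i) *
        Phi i (C n (p i) (q i) (pm i) (pp i) *
               fine (ARH_const (pm i) (pp i) (p i) (w i))
                 `^ gamma (pm i) (pp i) (p i) (q i)))%R%:E *
       wnorm (p i) (powf (w i) (p i)) (g i))) /\
  (forall r : 'I_m -> R,
    (forall i, (pm i < r i)%R /\ (r i)%:E < pp i) ->
    forall (K : pred nat) (f : nat -> Rn R n -> \bar R)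
      (g : nat -> 'I_m -> Rn R n -> \bar R),
    (forall k, K k -> F (f k, g k)) ->
    wnorm (harm p) (powf (prodw w) (harm p)) (lr_norm K (harm r) f) <=
    \prod_(i < m)
      ((2 `^ (Num.max (tau (pm i) (pp i) (p i) / p i)
                      (tau' (pm i) (pp i) (p i) / r i) +
              Num.max (tau (pm i) (pp i) (r i) / r i)
                      (tau' (pm i) (pp i) (r i) / q i)) *
        Phi i (C' n (p i) (q i) (r i) (pm i) (pp i) *
               fine (ARH_const (pm i) (pp i) (p i) (w i))
                 `^ (gamma (pm i) (pp i) (p i) (r i) *
                     gamma (pm i) (pp i) (r i) (q i))))%R%:E *
       wnorm (p i) (powf (w i) (p i)) (lr_norm K (r i) (fun k => g k i))))].
Proof.
exists (@extrap_const R), (@extrap_const2 R); split.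
- by move=> n p q pm pp; exact: extrap_const_ge1.
- by move=> n p q r pm pp; rewrite le_max lexx.
move=> n m F pm pp q Phi n0 m0 Fok hpm hq Phim Phi1 H p w hp hw.
have pm1 i : (1 <= pm i)%R by case: (hpm i).
have Fok' : nonneg_family F by exact: Fok.
have gPhi i : growing (Phi i) by split; [exact: Phim|exact: Phi1].
have estq := wnorm_estimate Fok' H.
split.
  have estp := extrapolated_estimate pm1 hp hq Fok' gPhi estq.
  exact: (estimate_wnorm pm1 hp Fok' estp hw).2.
move=> r hr K f g KF.
have r0 i : (0 < r i)%R.
  by have [h _] := hr i; apply: lt_trans h; exact: lt_le_trans (pm1 i).
have hr' i : (pm i <= r i)%R /\ (r i)%:E <= pp i.
  by have [h1 h2] := hr i; split; exact: ltW.
pose phi i := extrap_phi pm pp (n := n) i (r i) (q i) (Phi i).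
have gphi i : growing (phi i).
  by have [h1 h2] := hr i; have [h3 h4] := hq i; exact: growing_extrap_phi.
have estr := extrapolated_estimate pm1 hr hq Fok' gPhi estq.
have ests := estimate_seq_norm (@arh_class_pos _ _ _ pm pp) (@arh_class_ge1 _ _ _ pm pp) m0 r0 Fok' gphi estr.
have Sok := nonneg_seq_norm (e := r) Fok'.
(* The second extrapolation, from [r] to [p], concerns the family of sequence norms and the
   functions [phi i] produced by the first. *)
have estp := extrapolated_estimate pm1 hp hr' Sok gphi ests.
have [K1 H2] := estimate_wnorm pm1 hp Sok estp hw.
apply: le_trans (H2 _ _ (ex_intro _ K (ex_intro _ f (ex_intro _ g (conj KF erefl))))) _.
apply: le_prode => [i _|i _].
  apply: mule_ge0; last exact: poweR_ge0.
  have [h1 h2] := hp i; have [h3 h4] := hr' i.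
  rewrite lee_fin; apply: le_trans ler01 _.
  have [_ ] := growing_extrap_phi (n := n) pm1 h1 h2 h3 h4 (gphi i).
  by apply; exact: K1.
apply: lee_wpmul2r; first exact: poweR_ge0.
have [h1 h2] := hp i; have [h3 h4] := hr' i; have [h5 h6] := hr i; have [h7 h8] := hq i.
move: (K1 i); move: (fine _) => t t1.
have t0 : (0 <= t)%R by exact: le_trans t1.
have g1 : (1 <= growth pm pp (n := n) i (p i) (r i) t)%R by exact: growth_ge1.
(* The two powers of 2 multiply, whence the sum of the two maxima in the exponent. *)
rewrite lee_fin /phi /extrap_phi mulrA -powRD; last by rewrite pnatr_eq0 implybT.
apply: ler_wpM2l; first exact: powR_ge0.
apply: Phim; first exact: growth_ge1.
rewrite /growth (powRM _ _ (powR_ge0 _ _)); last first.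
  by apply: le_trans (extrap_const_ge1 _ _ _ _).
rewrite -powRrM mulrA; apply: ler_wpM2r; first exact: powR_ge0.
by rewrite /extrap_const2 le_max lexx orbT.
Qed.
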